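(* Let $\Omega\subset\mathbb{R}^N$, $N\ge 2$, be a domain (open and connected) with finite Lebesgue measure, and let $d\ge 1$ be an integer. Let $f:\Omega\times\mathbb{R}^d\times\mathbb{R}^{Nd}\to\mathbb{R}$ be a normal integrand such that - $f(x,z,\cdot)$ is level convex for a.e. $x\in\Omega$ and every $z\in\mathbb{R}^d$; - there exist $\alpha,\gamma>0$ such that $f(x,z,\xi)\ge\alpha|\xi|^\gamma$ for a.e. $x\in\Omega$ and every $(z,\xi)\in\mathbb{R}^d\times\mathbb{R}^{Nd}$. Let $c,L\ge 1$, and for every $n\in\mathbb{N}$ let $\varphi_n\in\Phi_{\mathrm{w}}(\Omega)$ and $p_n\ge 1$ be such that - $\frac1c\le\varphi_n(x,1)\le c$ for a.e. $x\in\Omega$; - $\varphi_n$ satisfies $(\mathrm{aInc})_{p_n}$ with constant $L$. If $p_n\to\infty$ as $n\to\infty$, then $$\limsup_{n\to\infty}F_{\varphi_n}(u)\le F_\infty(u)\le\liminf_{n\to\infty}F_{\varphi_n}(u_n)$$ for all $u,u_n\in L^1(\Omega,\mathbb{R}^d)$ with $u_n\rightharpoonup u$ weakly in $L^1(\Omega,\mathbb{R}^d)$.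
   Context: Measurability and a.e. refer to the Lebesgue measure $\mathcal{L}^N$; $\mathcal{B}_k$ denotes the Borel measure/sets on $\mathbb{R}^k$. $L^0(\Omega)$ is the set of measurable functions $\Omega\to\mathbb{R}$. Level convex: $g:\mathbb{R}^{k}\to\mathbb{R}$ is level convex if $\{\xi\in\mathbb{R}^k: g(\xi)\le t\}$ is convex for every $t\in\mathbb{R}$. Normal integrand: $f:\Omega\times\mathbb{R}^d\times\mathbb{R}^k\to\mathbb{R}$ is a normal integrand if it is $\mathcal{L}^N\times\mathcal{B}_d\times\mathcal{B}_k$-measurable and $f(x,\cdot,\cdot)$ is lower semicontinuous for a.e. $x\in\Omega$. $(\mathrm{aInc})_p$: for $p>0$, a function $\varphi:\Omega\times[0,\infty)\to[0,\infty]$ satisfies $(\mathrm{aInc})_p$ with constant $L\ge1$ if $\varphi(x,\lambda t)\le L\lambda^p\varphi(x,t)$ for a.e. $x\in\Omega$ and all $t\ge0$, $\lambda\in[0,1]$ (with the convention $0\cdot\infty=0$). It satisfies $(\mathrm{aInc})_p$ if this holds for some $L\ge1$. Generalized weak $\Phi$-function: $\varphi:\Omega\times[0,\infty)\to[0,\infty]$ belongs to $\Phi_{\mathrm{w}}(\Omega)$ if: $x\mapsto\varphi(x,|g(x)|)$ is measurable for every $g\in L^0(\Omega)$; $\varphi(x,0)=0$, $\lim_{t\to0^+}\varphi(x,t)=0$ and $\lim_{t\to\infty}\varphi(x,t)=\infty$ for a.e. $x\in\Omega$; $t\mapsto\varphi(x,t)$ is increasing (in the non-strict sense) for a.e. $x\in\Omega$;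 and $\varphi$ satisfies $(\mathrm{aInc})_1$. Modular and Luxemburg quasinorm: for $g\in L^0(\Omega)$, $\rho_\varphi(g):=\int_\Omega\varphi(x,|g(x)|)\,dx$ and $\|g\|_\varphi:=\inf\{\lambda>0:\rho_\varphi(g/\lambda)\le1\}$ (with $\inf\emptyset=\infty$). Functional $F_\varphi:L^1(\Omega,\mathbb{R}^d)\to[0,\infty]$: $F_\varphi(u):=\|f(\cdot,u,Du)\|_\varphi$ if $u\in W^{1,1}_{\mathrm{loc}}(\Omega,\mathbb{R}^d)$, and $F_\varphi(u):=\infty$ otherwise. $F_\infty:=F_{\varphi_\infty}$ with $\varphi_\infty(x,t):=\infty\,\chi_{(1,\infty)}(t)$ (that is, $0$ for $t\le1$ and $\infty$ for $t>1$); since $\|\cdot\|_{\varphi_\infty}=\|\cdot\|_{L^\infty(\Omega)}$, $F_\infty(u)=\|f(\cdot,u,Du)\|_{L^\infty(\Omega)}$ if $u\in W^{1,1}_{\mathrm{loc}}(\Omega,\mathbb{R}^d)$ and $\infty$ otherwise. *)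

(* Defs.v *)
From HB Require Import structures.
From mathcomp Require Import all_boot all_order all_algebra.
From mathcomp Require Import all_classical all_reals all_analysis
  measurable_realfun.

Set Implicit Arguments.
Unset Strict Implicit.
Unset Printing Implicit Defensive.

Import Order.TTheory GRing.Theory Num.Theory.
Import numFieldNormedType.Exports.

Local Open Scope classical_set_scope.
Local Open Scope ring_scope.

(** * Lebesgue measure on R^n

    The outer measure is the usual infimum over countable covers by half-open
    boxes; Caratheodory's theorem turns it into a complete measure. The
    sigma-algebra of [lebT R n] is that of the Lebesgue-measurable sets. *)

Section lebesgue_outer.
Context {R : realType} {n : nat}.

Definition box (a b : 'rV[R]_n) : set 'rV[R]_n :=
  [set x | forall i, a 0 i < x 0 i <= b 0 i].

Definition box_vol (a b : 'rV[R]_n) : R :=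
  \prod_(i < n) Num.max 0 (b 0 i - a 0 i).

(* [None] stands for the empty set: for n = 0 the only box is a point. *)
Definition obox (ab : option ('rV[R]_n * 'rV[R]_n)) : set 'rV[R]_n :=
  if ab is Some (a, b) then box a b else set0.

Definition obox_vol (ab : option ('rV[R]_n * 'rV[R]_n)) : \bar R :=
  (if ab is Some (a, b) then box_vol a b else 0)%:E.

Definition leb_outer (A : set 'rV[R]_n) : \bar R :=
  ereal_inf [set (\sum_(k <oo) obox_vol (F k))%E |
             F in [set F | A `<=` \bigcup_k obox (F k)]].

Local Open Scope ereal_scope.

Lemma obox_vol_ge0 ab : 0 <= obox_vol ab.
Proof.
case: ab => [[a b]|]; rewrite /obox_vol lee_fin//.
by apply: prodr_ge0 => i _; rewrite le_max lexx.
Qed.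

Lemma leb_outer_ge0 A : 0 <= leb_outer A.
Proof.
apply: le_ereal_inf_tmp => _ [F _ <-].
by apply: nneseries_ge0 => k _ _; exact: obox_vol_ge0.
Qed.

Lemma leb_outer0 : leb_outer set0 = 0.
Proof.
apply/eqP; rewrite eq_le leb_outer_ge0 andbT.
apply: ereal_inf_lbound; exists (fun=> None); first exact: sub0set.
by rewrite eseries0.
Qed.

Lemma le_leb_outer : {homo leb_outer : A B / A `<=` B >-> A <= B}.
Proof.
move=> A B AB; apply/ereal_inf_le_tmp => x [F BF <-].
by exists F => //; exact: subset_trans AB BF.
Qed.

Lemma leb_outer_sigma_subadditive : sigma_subadditive leb_outer.
Proof.
move=> A; have [[i ioo]|] := pselect (exists i, leb_outer (A i) = +oo).
  rewrite (eseries_pinfty _ _ ioo) ?leey// => k _.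
  by rewrite -ltNye (lt_le_trans _ (leb_outer_ge0 _)).
rewrite -forallNE => Aoo.
suff add2e (e : {posnum R}) :
    leb_outer (\bigcup_k A k) <= \sum_(i <oo) leb_outer (A i) + e%:num%:E.
  by apply/lee_addgt0Pr => _/posnumP[].
rewrite (le_trans _ (epsilon_trick _ _ _))//; last first.
  by move=> k; exact: leb_outer_ge0.
pose P k F := A k `<=` \bigcup_j obox (F j) /\
  \sum_(j <oo) obox_vol (F j) <= leb_outer (A k) + (e%:num / (2 ^ k.+1)%:R)%:E.
have [G PG] : {G : forall k j : nat, option ('rV[R]_n * 'rV[R]_n) &
    forall k, P k (G k)}.
  apply: (@choice _ _ P) => k; rewrite /P.
  have fA : leb_outer (A k) \is a fin_num.
    by rewrite ge0_fin_numE ?leb_outer_ge0// ltey; apply/eqP/Aoo.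
  have ek : (0 < e%:num / (2 ^ k.+1)%:R :> R)%R by [].
  have [_ [F AF <-] /ltW FA] := lb_ereal_inf_adherent ek fA.
  by exists F; split.
have G0 x : 0 <= (obox_vol \o uncurry G) x by exact: obox_vol_ge0.
apply: (@le_trans _ _ (\sum_(i <oo) \sum_(j <oo) obox_vol (G i j))); last first.
  apply: lee_nneseries => [i _ _|i _].
    by apply: nneseries_ge0 => j _ _; exact: obox_vol_ge0.
  exact: (PG i).2.
have -> : \sum_(i <oo) \sum_(j <oo) obox_vol (G i j) =
    \esum_(i in setT) (obox_vol \o uncurry G) i.
  rewrite nneseries_esumT; last first.
    by move=> i; apply: nneseries_ge0 => j _ _; exact: obox_vol_ge0.
  rewrite (eq_esum (b := fun i => \esum_(j in setT) obox_vol (G i j))).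
    rewrite esum_esum; last by move=> i j _ _; exact: obox_vol_ge0.
    rewrite (_ : _ `*`` _ = setT); last by apply/seteqP; split.
    by apply: eq_esum => -[].
  by move=> i _; rewrite nneseries_esumT// => j; exact: obox_vol_ge0.
have /card_esym/ppcard_eqP[f] := card_nat2.
apply: ereal_inf_lbound; exists (uncurry G \o f).
  move=> x [i _ /((PG i).1) [j _ Gij]].
  by exists (f^-1%FUN (i, j)) => //=; rewrite invK ?inE.
rewrite nneseries_esumT//; last by move=> k; exact: obox_vol_ge0.
by rewrite [RHS](reindex_esum [set: nat] setT f).
Qed.

End lebesgue_outer.

Arguments leb_outer : clear implicits.

HB.instance Definition _ (R : realType) (n : nat) :=
  isOuterMeasure.Build R 'rV[R]_n (leb_outer R n)
    leb_outer0 leb_outer_ge0 le_leb_outer leb_outer_sigma_subadditive.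

Notation lebT R n := (caratheodory_type (leb_outer R n)).

Section lebesgue.
Context {R : realType} {n : nat}.

Definition leb (A : set (lebT R n)) : \bar R := leb_outer R n A.

HB.instance Definition _ := isMeasure.Build _ (lebT R n) R leb
  (@caratheodory_measure0 _ _ (leb_outer R n))
  (@caratheodory_measure_ge0 _ _ (leb_outer R n))
  (@caratheodory_measure_sigma_additive _ _ (leb_outer R n)).

End lebesgue.

Notation borelT R m n := (g_sigma_algebraType (@open 'M[R]_(m, n))).

(** * Integrands and generalized Phi-functions

    Functions on a set [Om] are total functions of which only the values on
    [Om] matter. *)

Section defs.
Context {R : realType}.

(* The library's norm on matrices is the sup norm. *)
Definition enorm m n (A : 'M[R]_(m, n)) : R :=
  Num.sqrt (\sum_(i < m) \sum_(j < n) A i j ^+ 2).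

Definition level_convex m n (g : 'M[R]_(m, n) -> R) : Prop :=
  forall t : R,
    convex_set ([set xi | g xi <= t] : set (convex_lmodType 'M[R]_(m, n))).

Section domain.
Context {N : nat} (Om : set 'rV[R]_N).

Definition normal_integrand d
    (f : 'rV[R]_N -> 'rV[R]_d -> 'M[R]_(d, N) -> R) : Prop :=
  measurable_fun
    ((Om `*` setT) `*` setT : set (lebT R N * borelT R 1 d * borelT R d N))
    (fun q => f q.1.1 q.1.2 q.2) /\
  {ae leb, forall x, Om x ->
    lower_semicontinuous
      (fun q : 'rV[R]_d * 'M[R]_(d, N) => (f x q.1 q.2)%:E)}.

Definition meas_fun (g : 'rV[R]_N -> R) : Prop :=
  measurable_fun (Om : set (lebT R N)) g.

Definition aInc_with (p L : R) (phi : 'rV[R]_N -> R -> \bar R) : Prop :=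
  {ae leb, forall x, Om x -> forall t l : R, 0 <= t -> 0 <= l <= 1 ->
    (phi x (l * t)%R <= (L * l `^ p)%:E * phi x t)%E}.

Definition aInc (p : R) (phi : 'rV[R]_N -> R -> \bar R) : Prop :=
  exists2 L : R, 1 <= L & aInc_with p L phi.

Record Phi_w (phi : 'rV[R]_N -> R -> \bar R) : Prop := {
  Phi_w_ge0 : forall x t, Om x -> 0 <= t -> (0 <= phi x t)%E ;
  Phi_w_meas : forall g, meas_fun g ->
    measurable_fun (Om : set (lebT R N)) (fun x => phi x `|g x|) ;
  Phi_w_0 : {ae leb, forall x, Om x -> phi x 0 = 0%E} ;
  Phi_w_cvg0 : {ae leb, forall x, Om x -> phi x t @[t --> 0^'+] --> 0%E} ;
  Phi_w_cvgy : {ae leb, forall x, Om x -> phi x t @[t --> +oo] --> +oo%E} ;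
  Phi_w_incr : {ae leb, forall x, Om x ->
    forall s t, 0 <= s -> s <= t -> (phi x s <= phi x t)%E} ;
  Phi_w_aInc : aInc 1 phi }.

Definition modular (phi : 'rV[R]_N -> R -> \bar R) (g : 'rV[R]_N -> R) : \bar R :=
  (\int[leb]_(x in (Om : set (lebT R N))) phi x `|g x|%R)%E.

Definition luxemburg (phi : 'rV[R]_N -> R -> \bar R) (g : 'rV[R]_N -> R) : \bar R :=
  ereal_inf [set l%:E | l in
    [set l : R | 0 < l /\ (modular phi (fun x => (g x / l)%R) <= 1)%E]].

(** * Function spaces *)

Definition L1loc (g : 'rV[R]_N -> R) : Prop :=
  meas_fun g /\
  forall K : set 'rV[R]_N, K `<=` Om -> compact K ->
    leb.-integrable (K : set (lebT R N)) (EFin \o g).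

Definition partial (j : 'I_N) (g : 'rV[R]_N -> R) : 'rV[R]_N -> R :=
  fun x => 'D_(delta_mx 0 j) g x.

Definition smooth (g : 'rV[R]_N -> R) : Prop :=
  forall s : seq 'I_N, continuous (foldr partial g s) /\
    forall x j, derivable (foldr partial g s) x (delta_mx 0 j).

(* C_c^oo(Om) *)
Definition test_fun (g : 'rV[R]_N -> R) : Prop :=
  smooth g /\ compact (closure [set x | g x != 0]) /\
  closure [set x | g x != 0] `<=` Om.

(* [G x i j] is the weak partial derivative of the i-th component of [u] in
   direction j. *)
Definition weak_gradient d (u : 'rV[R]_N -> 'rV[R]_d)
    (G : 'rV[R]_N -> 'M[R]_(d, N)) : Prop :=
  (forall i j, L1loc (fun x => G x i j)) /\
  forall g, test_fun g -> forall i j,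
    (\int[leb]_(x in (Om : set (lebT R N))) (u x 0 i * partial j g x)%:E =
     - \int[leb]_(x in (Om : set (lebT R N))) (G x i j * g x)%:E)%E.

Definition W11loc d (u : 'rV[R]_N -> 'rV[R]_d) : Prop :=
  (forall i, L1loc (fun x => u x 0 i)) /\ exists G, weak_gradient u G.

(* A weak gradient of [u], if there is one: it is unique up to null sets. *)
Definition wgrad d (u : 'rV[R]_N -> 'rV[R]_d) : 'rV[R]_N -> 'M[R]_(d, N) :=
  [get G | weak_gradient u G].

Definition L1 d (u : 'rV[R]_N -> 'rV[R]_d) : Prop :=
  forall i, leb.-integrable (Om : set (lebT R N)) (fun x => (u x 0 i)%:E).

Definition normL1 d (u : 'rV[R]_N -> 'rV[R]_d) : \bar R :=
  (\int[leb]_(x in (Om : set (lebT R N))) (enorm (u x))%:E)%E.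

(* Bounded linear functionals on L^1(Om, R^d). Elements of L^1 are represented
   by functions; the bound makes [l] invariant under a.e. equality. *)
Definition L1_dual d (l : ('rV[R]_N -> 'rV[R]_d) -> R) : Prop :=
  (forall (a : R) v w, L1 v -> L1 w ->
     l (fun x => a *: v x + w x) = a * l v + l w) /\
  exists C : R, forall v, L1 v -> (`|l v|%:E <= C%:E * normL1 v)%E.

Definition weak_cvg_L1 d (un : nat -> 'rV[R]_N -> 'rV[R]_d)
    (u : 'rV[R]_N -> 'rV[R]_d) : Prop :=
  forall l, L1_dual l -> l (un n) @[n --> \oo] --> l u.

(** * The functionals *)

Definition F_ d (f : 'rV[R]_N -> 'rV[R]_d -> 'M[R]_(d, N) -> R)
    (phi : 'rV[R]_N -> R -> \bar R) (u : 'rV[R]_N -> 'rV[R]_d) : \bar R :=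
  if `[< W11loc u >] then luxemburg phi (fun x => f x (u x) (wgrad u x))
  else +oo%E.

Definition phi_infty (x : 'rV[R]_N) (t : R) : \bar R :=
  if t <= 1 then 0%E else +oo%E.

Definition F_infty d (f : 'rV[R]_N -> 'rV[R]_d -> 'M[R]_(d, N) -> R)
    (u : 'rV[R]_N -> 'rV[R]_d) : \bar R :=
  F_ f phi_infty u.

End domain.
End defs.

(* Main.v *)
(** Upper bound: if |f(x,u,Du)| <= l a.e. and s > 1, then (aInc) gives
    phi_n(x, f/(s l)) <= L c s^(-p_n), whose integral tends to 0.

    Lower bound: along a subsequence with F_(phi_n)(u_n) < lam the modular of
    f(x,u_n,Du_n)/lam is at most 1, and t^(p_n) <= c L phi_n(x,t) for t >= 1.
    Coercivity then bounds Du_n in L^2, and |{f(x,u_n,Du_n) > lam'}| tends to 0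
    for lam' > lam. Dyadic convex combinations of tails of (Du_n) that nearly
    minimize the L^2 norm converge a.e. by the parallelogram identity, and the
    limit is the weak gradient of u. A Poincare inequality by bisection of boxes
    turns weak convergence of u_n into local strong convergence, so that a
    further subsequence converges a.e. At almost every x, coercivity, lower
    semicontinuity and convexity of the sublevel sets then give
    f(x,u,Du) <= lam'. *)

Require Import Defs.
From HB Require Import structures.
From mathcomp Require Import all_boot all_order all_algebra.
From mathcomp Require Import all_classical all_reals all_analysis
  measurable_realfun.
From mathcomp Require Import ring lra.

Set Implicit Arguments.
Unset Strict Implicit.
Unset Printing Implicit Defensive.

Import Order.TTheory GRing.Theory Num.Theory.
Import numFieldNormedType.Exports.

Local Open Scope classical_set_scope.
Local Open Scope ring_scope.

(** * Lebesgue measurability of boxes and open sets *)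

Section lebesgue_sets.
Context {R : realType} {N : nat}.
Implicit Types (a b v x : 'rV[R]_N) (i j : 'I_N) (t : R).

(** This is why almost everywhere convergence of [u_n] is needed besides convex combinations of the
    gradients. The exponent 2 comes from the growth: once [p_n >= 2/gamma], the modular controls
    [|Du_n|^2], and a Hilbert space argument replaces weak compactness. Two levels [lam < lam'] are
    kept apart because the bound 1 on the modular becomes smallness only through the factor
    [(lam/lam')^(p_n)]. Nothing is known about the boundary of the domain, so compactness is proved
    on countably many rational boxes with some room around them. The measure is given by half-open
    boxes and weak derivatives by smooth test functions; explicit smooth products converging
    pointwise to indicators of half-open boxes connect the two. The same products show that a weak
    gradient is unique, which matters because [wgrad] picks one by choice. *)

Definition upd a i t : 'rV[R]_N := \row_j if j == i then t else a 0 j.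

Lemma updE a i t j : upd a i t 0 j = if j == i then t else a 0 j.
Proof. by rewrite mxE. Qed.

Definition half_space i t : set 'rV[R]_N := [set x | t < x 0 i].

(** Caratheodory's criterion: cutting every box of a cover along the hyperplane gives covers of the
    two pieces whose total volume does not exceed that of the original cover. *)
Lemma measurable_half_space i t :
  measurable (half_space i t : set (lebT R N)).
Proof.
apply: le_caratheodory_measurable => Y.
apply: le_ereal_inf_tmp => _ [F YF <-].
pose F1 k := omap
  (fun ab => (upd ab.1 i (Num.max (ab.1 0 i) t), ab.2)) (F k).
pose F2 k := omap
  (fun ab => (ab.1, upd ab.2 i (Num.min (ab.2 0 i) t))) (F k).
apply: (@le_trans _ _
  (\sum_(k <oo) obox_vol (F1 k) + \sum_(k <oo) obox_vol (F2 k))%E).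
  apply: leeD; apply: ereal_inf_lbound.
  - exists F1 => // x [/YF[k _ Fk]] /= tx; exists k => //=.
    rewrite /F1; case: (F k) Fk => //= -[a b] /= abx j.
    by rewrite updE; have := abx j; case: eqP => // -> /andP[ax xb]; rewrite gt_max ax xb andbT.
  - exists F2 => // x [/YF[k _ Fk]] /= tx; exists k => //=.
    rewrite /F2; case: (F k) Fk => //= -[a b] /= abx j.
    rewrite updE; have := abx j; case: eqP => // -> /andP[ax xb]; rewrite ax /=.
    by rewrite le_min xb leNgt; apply/negP.
rewrite -nneseriesD; [|by move=> *; exact: obox_vol_ge0..].
apply: lee_nneseries => [k _ _|k _]; first by rewrite adde_ge0 ?obox_vol_ge0.
rewrite /F1 /F2; case: (F k) => [[a b]|]/=; last by rewrite adde0.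
rewrite /obox_vol -EFinD lee_fin /box_vol.
rewrite (bigD1 i)//= [X in _ + X <= _](bigD1 i)//= [X in _ <= X](bigD1 i)//=.
under eq_bigr => j ji do rewrite updE (negbTE ji).
under [X in _ + _ * X <= _]eq_bigr => j ji do rewrite updE (negbTE ji).
rewrite -mulrDl !updE eqxx; apply: ler_wpM2r.
  by apply: prodr_ge0 => j _; rewrite le_max lexx.
move: (a 0 i) (b 0 i) => {}a {}b.
rewrite /Num.max /Num.min.
by case: (ltP a t) => ?; case: (ltP b t) => ?; repeat case: ifPn => //;
  rewrite -?leNgt => *; lra.
Qed.

Lemma box_half_spaces a b : box a b =
  \bigcap_(i : 'I_N) (half_space i (a 0 i) `\` half_space i (b 0 i)).
Proof.
apply/seteqP; split => [x abx i _|x abx i].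
  by have /andP[ax xb] := abx i; split => //; apply/negP; rewrite -leNgt.
by have [] := abx i Logic.I; rewrite /= => -> /negP; rewrite -leNgt.
Qed.

Lemma measurable_box a b : measurable (box a b : set (lebT R N)).
Proof.
rewrite box_half_spaces; apply: fin_bigcap_measurable => // i _.
by apply: measurableD; exact: measurable_half_space.
Qed.

Lemma leb_box_lty a b : (leb (box a b : set (lebT R N)) < +oo)%E.
Proof.
pose F k : option ('rV[R]_N * 'rV[R]_N) := if k is 0 then Some (a, b) else None.
apply: (@le_lt_trans _ _ (\sum_(k <oo) obox_vol (F k))%E).
  by apply: ereal_inf_lbound; exists F => // x abx; exists 0.
rewrite (nneseries_split _ 1)//; last by move=> *; exact: obox_vol_ge0.
rewrite eseries0 ?adde0//.
  by rewrite add0n big_nat1 ltry.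
by case.
Qed.



End lebesgue_sets.

(** * Rational boxes and the Borel structure of matrix spaces *)

Section borel_matrices.
Context {R : realType} {m n : nat}.

(** The natural number in [q] encodes a margin above the upper corner: the closed box enlarged by it
    still lies in [U]. The data are countable, which later reduces statements on open sets to
    countably many boxes. *)
Lemma open_rat_box (U : set 'M[R]_(m, n)) x : open U -> U x ->
  exists q : 'M[rat]_(m, n) * 'M[rat]_(m, n) * nat,
    (forall i j, ratr (q.1.1 i j) < x i j <= ratr (q.1.2 i j)) /\
    (forall y : 'M[R]_(m, n), (forall i j,
      ratr (q.1.1 i j) <= y i j <= ratr (q.1.2 i j) + q.2.+1%:R^-1) -> U y).
Proof.
move=> oU Ux.
have /nbhs_ballP[e /= e0 eU] : nbhs x U by exact: open_nbhs_nbhs.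
have e20 : 0 < e / 2 by rewrite divr_gt0.
have rat_in (u v : R) : u < v -> exists q : rat, u < ratr q < v.
  by move=> uv; have [q] := rat_in_itvoo uv; rewrite in_itv/=; exists q.
have [q1 q1P] : {q1 : 'I_m * 'I_n -> rat &
    forall i, x i.1 i.2 - e < ratr (q1 i) < x i.1 i.2}.
  apply: (@choice _ _ (fun i q => x i.1 i.2 - e < ratr q < x i.1 i.2)) => i.
  by apply: rat_in; rewrite ltrBlDr ltrDl.
(* The upper corner uses half of the radius; the other half is reserved for the margin. *)
have [q2 q2P] : {q2 : 'I_m * 'I_n -> rat &
    forall i, x i.1 i.2 < ratr (q2 i) < x i.1 i.2 + e / 2}.
  apply: (@choice _ _ (fun i q => x i.1 i.2 < ratr q < x i.1 i.2 + e / 2)) => i.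
  by apply: rat_in; rewrite ltrDl.
pose k := Num.trunc (e / 2)^-1.
have ke : k.+1%:R^-1 < e / 2.
  rewrite -[ltRHS]invrK ltf_pV2 ?posrE ?invr_gt0//.
  exact/truncnS_gt.
exists (\matrix_(i, j) q1 (i, j), \matrix_(i, j) q2 (i, j), k); split => /=.
  move=> i j; rewrite !mxE; have /andP[_ ->] := q1P (i, j).
  by have /andP[/ltW -> _] := q2P (i, j).
move=> y yq; apply: eU; rewrite mx_norm_ball /ball_/=.
rewrite [ltLHS]mx_normrE; apply/bigmax_ltP; split => // -[i j] _ /=.
have := yq i j; have := q1P (i, j); have := q2P (i, j); rewrite !mxE/=.
by move: (k.+1%:R^-1) ke => c *; rewrite ltr_norml; lra.
Qed.

Lemma measurable_fun_mx d (T : measurableType d) (D : set T)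
    (g : T -> 'M[R]_(m, n)) :
  (forall i j, measurable_fun D (fun x => g x i j)) ->
  measurable_fun D (g : T -> borelT R m n).
Proof.
move=> mg mD.
apply: (@measurability _ _ T (borelT R m n) D g (@open 'M[R]_(m, n)) erefl _ mD).
move=> _ [U oU <-].
pose bx (q : 'M[rat]_(m, n) * 'M[rat]_(m, n)) (y : 'M[R]_(m, n)) :=
  forall i j, ratr (q.1 i j) < y i j <= ratr (q.2 i j).
(* The last intersection with [D] matters when the matrices have no entries: the intersection over
   an empty index set is the whole space. *)
pose W q : set T := if `[< bx q `<=` U >]
  then \bigcap_(i in [set: 'I_m * 'I_n])
    (D `&` (fun x => g x i.1 i.2) @^-1`
      `]ratr (q.1 i.1 i.2), ratr (q.2 i.1 i.2)]%classic) `&` D else set0.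
rewrite (_ : D `&` _ = \bigcup_q W q).
  apply: countable_bigcupT_measurable => // q.
  rewrite /W; case: ifP => // _; apply: measurableI => //.
  by apply: fin_bigcap_measurable => // -[i j] _ /=; exact: mg.
apply/seteqP; split => [x [Dx Ux]|x [q _]].
  have [[q k] [qx qU]] := open_rat_box oU Ux.
  exists q => //; rewrite /W; case: asboolP => [_|[]]; last first.
    move=> y qy; apply: qU => i j; have /andP[/ltW -> /=] := qy i j.
    by move/le_trans; apply; rewrite lerDl.
  by split => // -[i j] _; split => //=; rewrite in_itv/= qx.
rewrite /W; case: asboolP => // qU [qx Dx]; split => //; apply: qU => i j.
by have [_] := qx (i, j) Logic.I; rewrite /= in_itv.
Qed.

End borel_matrices.

(** * Topology versus Lebesgue measure: open and compact sets, translations, outer approximation *)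

Section lebesgue_borel.
Context {R : realType} {N : nat}.
Implicit Types (a b v x : 'rV[R]_N).

Definition cbox a b : set 'rV[R]_N := [set x | forall i, a 0 i <= x 0 i <= b 0 i].

Lemma box_cbox a b : box a b `<=` cbox a b.
Proof. by move=> x abx i; have /andP[/ltW -> ->] := abx i. Qed.

Definition ratv (q : 'rV[rat]_N) : 'rV[R]_N := map_mx ratr q.

Definition vshift a (e : R) : 'rV[R]_N := \row_i (a 0 i + e).

Lemma le_cbox a a' b b' : (forall i, a' 0 i <= a 0 i) ->
  (forall i, b 0 i <= b' 0 i) -> cbox a b `<=` cbox a' b'.
Proof.
move=> aa bb x abx i; have /andP[ax xb] := abx i.
by rewrite (le_trans (aa i) ax) (le_trans xb).
Qed.

Lemma cbox_vshift a b (e : R) : 0 <= e -> cbox a b `<=` cbox a (vshift b e).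
Proof. by move=> e0; apply: le_cbox => // i; rewrite mxE lerDl. Qed.

(* The boxes have some room above, since they are approximated from outside. *)
Lemma open_bigcup_box (U : set 'rV[R]_N) : open U ->
  U = \bigcup_(q in [set q : 'rV[rat]_N * 'rV[rat]_N * nat |
      cbox (ratv q.1.1) (vshift (ratv q.1.2) q.2.+1%:R^-1) `<=` U])
    box (ratv q.1.1) (ratv q.1.2).
Proof.
move=> oU; apply/seteqP; split => [x Ux|x [q qU /box_cbox]]; last first.
  by move=> qx; apply/qU/(@cbox_vshift _ _ q.2.+1%:R^-1).
have [q [qx qU]] := open_rat_box oU Ux; exists q => /=.
  move=> y qy; apply: qU => i j; have := qy j; rewrite !mxE ord1.
  by apply.
by move=> i; have := qx 0 i; rewrite !mxE.
Qed.

Lemma measurable_open (U : set 'rV[R]_N) :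
  open U -> measurable (U : set (lebT R N)).
Proof.
move=> /open_bigcup_box ->; rewrite bigcup_mkcond.
apply: countable_bigcupT_measurable => // q.
by case: ifP => // _; exact: measurable_box.
Qed.

Lemma measurable_closed (U : set 'rV[R]_N) :
  closed U -> measurable (U : set (lebT R N)).
Proof.
by move=> cU; rewrite -[U]setCK; apply/measurableC/measurable_open/closed_openC.
Qed.

Lemma measurable_compact (U : set 'rV[R]_N) :
  compact U -> measurable (U : set (lebT R N)).
Proof.
move=> cU; apply: measurable_closed; apply: (compact_closed _ cU).
exact: (@norm_hausdorff _ 'rV[R]_N).
Qed.

Lemma compact_cbox a b : compact (cbox a b).
Proof.
rewrite (_ : cbox a b = [set x | forall i, `[a 0 i, b 0 i]%classic (x ord0 i)]).
  apply: (@rV_compact _ _ (fun i => `[a 0 i, b 0 i]%classic)) => i.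
  exact: segment_compact.
by apply/seteqP; split => x abx i; have := abx i; rewrite /= in_itv.
Qed.

Lemma closed_cbox a b : closed (cbox a b).
Proof.
apply: compact_closed; last exact: compact_cbox.
exact: (@norm_hausdorff _ 'rV[R]_N).
Qed.

(** Translating the boxes of a cover keeps their volumes, which gives one inequality for all vectors
    and sets; the other is the same inequality for the opposite vector. *)
Lemma leb_outer_shift v (A : set 'rV[R]_N) :
  leb_outer R N [set x | A (x - v)] = leb_outer R N A.
Proof.
suff le_shift (w : 'rV[R]_N) (B : set 'rV[R]_N) :
    (leb_outer R N [set x : 'rV[R]_N | (B (x - w)%R : Prop)] <= leb_outer R N B)%E.
  apply/eqP; rewrite eq_le le_shift/=.
  have := le_shift (- v) [set x | A (x - v)].
  by under eq_set do rewrite /= opprK addrK.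
apply: le_ereal_inf_tmp => _ [F BF <-].
pose G k := omap (fun ab => (ab.1 + w, ab.2 + w)) (F k).
apply: ereal_inf_lbound; exists G.
  move=> x /= /BF[k _ Fk]; exists k => //; rewrite /G.
  case: (F k) Fk => //= -[a b] /= abx i; have := abx i; rewrite !mxE.
  by rewrite ltrBrDr lerBlDr.
apply: eq_eseriesr => k _; rewrite /G; case: (F k) => //= -[a b] /=.
rewrite /obox_vol; congr EFin; apply: eq_bigr => i _; rewrite !mxE.
by congr Num.max; ring.
Qed.

(** Intersect covers whose excess volume is at most [1/(k+1)]. The hull is built from boxes alone,
    hence is measurable for every sigma-algebra containing the boxes; [null_on_subsets] relies on
    this. *)
Lemma leb_outer_approx (A : set 'rV[R]_N) : (leb_outer R N A < +oo)%E ->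
  exists F : nat -> nat -> option ('rV[R]_N * 'rV[R]_N),
    A `<=` \bigcap_k \bigcup_j obox (F k j) /\
    leb_outer R N (\bigcap_k \bigcup_j obox (F k j)) = leb_outer R N A.
Proof.
move=> Aoo; have fA : leb_outer R N A \is a fin_num.
  by rewrite ge0_fin_numE// leb_outer_ge0.
have [F FP] : {F : nat -> nat -> option ('rV[R]_N * 'rV[R]_N) & forall k,
    A `<=` \bigcup_j obox (F k j) /\
    (\sum_(j <oo) obox_vol (F k j) <= leb_outer R N A + k.+1%:R^-1%:E)%E}.
  apply: (@choice _ _ (fun k F => A `<=` \bigcup_j obox (F j) /\
    (\sum_(j <oo) obox_vol (F j) <= leb_outer R N A + k.+1%:R^-1%:E)%E)) => k.
  have k0 : 0 < k.+1%:R^-1 :> R by [].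
  have [_ [F AF <-] /ltW FA] := lb_ereal_inf_adherent k0 fA.
  by exists F; split.
have AF : A `<=` \bigcap_k \bigcup_j obox (F k j).
  by move=> x Ax k _; exact: (FP k).1.
exists F; split => //; apply/eqP; rewrite eq_le (le_leb_outer AF) andbT.
apply/lee_addgt0Pr => e e0.
pose k := Num.trunc e^-1.
have ke : k.+1%:R^-1 <= e.
  rewrite -[leRHS]invrK lef_pV2 ?posrE ?invr_gt0//.
  by apply/ltW/truncnS_gt.
apply: (@le_trans _ _ (leb_outer R N A + k.+1%:R^-1%:E)%E); last first.
  by rewrite leeD2l// lee_fin.
apply: le_trans (FP k).2; apply: ereal_inf_lbound; exists (F k) => //.
by move=> x; apply.
Qed.

End lebesgue_borel.

(** * Real-valued integrals *)

Section real_integral.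
Context d (T : measurableType d) (R : realType).
Variable mu : {measure set T -> \bar R}.
Implicit Types (D : set T) (f g h : T -> R) (C : R).

Local Notation intg D f := (mu.-integrable D (EFin \o f)).

Lemma intg_meas D f : intg D f -> measurable_fun D f.
Proof. by move=> /integrableP[/measurable_EFinP]. Qed.

Lemma intgD D f g : measurable D -> intg D f -> intg D g ->
  intg D (fun x => f x + g x).
Proof. by move=> mD fi gi; have := integrableD mD fi gi. Qed.

Lemma intgZ D f k : measurable D -> intg D f -> intg D (fun x => k * f x).
Proof. by move=> mD fi; have := integrableZl mD k fi. Qed.

Lemma intgB D f g : measurable D -> intg D f -> intg D g ->
  intg D (fun x => f x - g x).
Proof. by move=> mD fi gi; have := integrableB mD fi gi. Qed.

Lemma intg_norm D f : measurable D -> intg D f -> intg D (fun x => `|f x|).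
Proof. by move=> mD; exact: integrable_norm. Qed.

Lemma intg_le D f g : measurable D -> measurable_fun D f -> intg D g ->
  (forall x, D x -> `|f x| <= g x) -> intg D f.
Proof.
move=> mD mf ig fg; apply: (le_integrable mD _ _ ig).
  exact/measurable_EFinP.
by move=> x Dx /=; rewrite lee_fin (le_trans (fg _ Dx))// ler_norm.
Qed.

Lemma intgMb D f g C : measurable D -> intg D f -> measurable_fun D g ->
  (forall x, D x -> `|g x| <= C) -> intg D (fun x => f x * g x).
Proof.
move=> mD fi mg gC; apply: (@intg_le _ _ (fun x => C * `|f x|)) => //.
- by apply: measurable_funM => //; exact: intg_meas.
- exact/intgZ/intg_norm.
- by move=> x Dx; rewrite normrM mulrC ler_wpM2r// gC.
Qed.

Lemma intg_bounded D f C : measurable D -> (mu D < +oo)%E -> measurable_fun D f ->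
  (forall x, D x -> `|f x| <= C) -> intg D f.
Proof.
move=> mD Doo mf fC; apply: (@intg_le _ _ (cst C)) => //.
apply: measurable_bounded_integrable => //.
by exists `|C|; split => // x Cx y _ /=; exact: ltW.
Qed.

Lemma intg_sum D I (s : seq I) (f : I -> T -> R) : measurable D ->
  (forall i, intg D (f i)) -> intg D (fun x => \sum_(i <- s) f i x).
Proof.
move=> mD fi; elim: s => [|i s IH].
  rewrite (_ : _ \o _ = cst 0%E); first exact: integrable0.
  by apply/funext => x /=; rewrite big_nil.
rewrite (_ : _ \o _ = EFin \o (fun x => f i x + \sum_(j <- s) f j x)).
  exact: intgD.
by apply/funext => x /=; rewrite big_cons.
Qed.

Lemma Rintegral_EFin D f : measurable D -> intg D f ->
  (\int[mu]_(x in D) (f x)%:E)%E = (\int[mu]_(x in D) f x)%:E.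
Proof. by move=> mD fi; rewrite fineK//; exact: integrable_fin_num. Qed.

Lemma Rintegral_sum D I (s : seq I) (f : I -> T -> R) : measurable D ->
  (forall i, intg D (f i)) ->
  \int[mu]_(x in D) (\sum_(i <- s) f i x) =
  \sum_(i <- s) \int[mu]_(x in D) f i x.
Proof.
move=> mD fi; elim: s => [|i s IH].
  rewrite big_nil; under eq_Rintegral do rewrite big_nil.
  by rewrite Rintegral_cst// mul0r.
rewrite big_cons -IH -RintegralD//; last exact: intg_sum.
by apply: eq_Rintegral => x _; rewrite big_cons.
Qed.

Lemma Rintegral_indic D A f : measurable D -> measurable A -> A `<=` D ->
  \int[mu]_(x in D) (f x * \1_A x) = \int[mu]_(x in A) f x.
Proof.
move=> mD mA AD; rewrite -{2}(setIidr AD) Rintegral_mkcondr.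
apply: eq_Rintegral => x _; rewrite /patch indicE.
by case: (x \in A); rewrite ?mulr1 ?mulr0.
Qed.

Lemma intg_indic D A f : measurable D -> measurable A -> intg D f ->
  intg D (fun x => f x * \1_A x).
Proof.
move=> mD mA fi.
have mI : measurable_fun D (\1_A : T -> R) by exact: measurable_indic.
apply: (intgMb (C := 1) mD fi mI).
by move=> x _; rewrite indicE; case: (_ \in _); rewrite ?normr1 ?normr0.
Qed.

Lemma Rintegral_subset_le D A f : measurable D -> measurable A -> A `<=` D ->
  intg D f -> (forall x, D x -> 0 <= f x) ->
  \int[mu]_(x in A) f x <= \int[mu]_(x in D) f x.
Proof.
move=> mD mA AD fi f0; rewrite -(@Rintegral_indic D)//.
apply: le_Rintegral => //.
  exact: intg_indic.
move=> x Dx; rewrite indicE; case: (_ \in _); rewrite ?mulr1// mulr0.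
exact: f0.
Qed.

Lemma Rintegral_dct D (f : nat -> T -> R) g h : measurable D ->
  (forall k, measurable_fun D (f k)) -> intg D g ->
  (forall k x, D x -> `|f k x| <= g x) ->
  (forall x, D x -> f k x @[k --> \oo] --> h x) ->
  intg D h /\
  \int[mu]_(x in D) f k x @[k --> \oo] --> \int[mu]_(x in D) h x.
Proof.
move=> mD mf gi fg fh.
have mh : measurable_fun D h.
  by apply: (measurable_fun_cvg (h := f)).
have [|||||hi _] := @dominated_convergence _ T R mu D mD
  (fun k x => (f k x)%:E) (EFin \o h) (EFin \o g).
- by move=> k; exact/measurable_EFinP.
- exact/measurable_EFinP.
- by apply: aeW => x Dx; apply/fine_cvgP; split; [exact: nearW|exact: fh].
- exact: gi.
- by apply: aeW => x k Dx; rewrite lee_fin fg.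
move=> cv; split => //; apply: fine_cvg.
by rewrite -Rintegral_EFin.
Qed.

Lemma Rintegral_dctM D (psi : nat -> T -> R) (phi : T -> R) f C : measurable D ->
  intg D f -> (forall k, measurable_fun D (psi k)) ->
  (forall k x, D x -> `|psi k x| <= C) ->
  (forall x, D x -> psi k x @[k --> \oo] --> phi x) ->
  \int[mu]_(x in D) (f x * psi k x) @[k --> \oo] -->
  \int[mu]_(x in D) (f x * phi x).
Proof.
move=> mD fi mpsi psiC cpsi.
apply: (@Rintegral_dct D _ (fun x => C * `|f x|) _ mD _ _ _ _).2.
- by move=> k; apply: measurable_funM => //; exact: intg_meas.
- exact/intgZ/intg_norm.
- by move=> k x Dx; rewrite normrM mulrC ler_wpM2r// psiC.
- by move=> x Dx; apply: cvgMr; exact: cpsi.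
Qed.

Lemma Rintegral_norm_eq0 D f : measurable D -> intg D f ->
  \int[mu]_(x in D) `|f x| = 0 -> {ae mu, forall x, D x -> f x = 0}.
Proof.
move=> mD fi f0.
have mf : measurable_fun D (EFin \o f) by exact/measurable_EFinP/intg_meas.
have : (\int[mu]_(x in D) `|(EFin \o f) x| = 0)%E.
  by rewrite /= Rintegral_EFin// ?f0//; exact: intg_norm.
move=> /(ae_eq_integral_abs mu mD mf); apply: filterS => x /= fx Dx.
by have [] := fx Dx.
Qed.

Lemma Rintegral_norm_ae0 D f : measurable D -> intg D f ->
  {ae mu, forall x, D x -> f x = 0} -> \int[mu]_(x in D) `|f x| = 0.
Proof.
move=> mD fi f0.
have mf : measurable_fun D (EFin \o f) by exact/measurable_EFinP/intg_meas.
have : (\int[mu]_(x in D) `|(EFin \o f) x| = 0)%E.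
  apply/(ae_eq_integral_abs mu mD mf).
  by apply: filterS f0 => x fx /fx /= ->.
by rewrite /Rintegral /= => ->.
Qed.

Lemma geometric_lty (a : nat -> \bar R) C : 0 <= C -> (forall k, (0 <= a k)%E) ->
  (forall k, a k <= (C / 2 ^+ k)%:E)%E -> (\sum_(k <oo) a k < +oo)%E.
Proof.
move=> C0 a0 aC.
(* [epsilon_trick0] sums terms with denominators [2^(k+1)], whence the factor 2. *)
have C20 : 0 <= 2 * C by rewrite mulr_ge0.
apply: le_lt_trans (ltry (2 * C)); apply: le_trans (epsilon_trick0 xpredT C20).
apply: lee_nneseries => [k _ _ //|k _]; apply: le_trans (aC k) _.
rewrite lee_fin natrX exprS le_eqVlt; apply/orP; left; apply/eqP.
by field; rewrite expf_neq0.
Qed.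

(** By monotone convergence the sum has a finite integral, so it is finite almost everywhere, and
    there it bounds the nondecreasing partial sums. *)
Lemma ae_summable D (h : nat -> T -> R) : measurable D ->
  (forall k, measurable_fun D (h k)) -> (forall k x, D x -> 0 <= h k x) ->
  (\sum_(k <oo) \int[mu]_(x in D) (h k x)%:E < +oo)%E ->
  mu.-integrable D (fun x => (\sum_(k <oo) (h k x)%:E)%E) /\
  {ae mu, forall x, D x -> cvgn (series (fun k => h k x))}.
Proof.
move=> mD mh h0 hoo.
have mh' k : measurable_fun D (EFin \o h k) by exact/measurable_EFinP.
have h0' k x : D x -> (0 <= (h k x)%:E)%E by move=> Dx; rewrite lee_fin h0.
have ih : mu.-integrable D (fun x => (\sum_(k <oo) (h k x)%:E)%E).
  apply/integrableP; split.
    exact: (@ge0_emeasurable_sum _ _ _ _ (fun k => EFin \o h k) xpredT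
      (fun k x Dx _ => h0' k x Dx) (fun k _ => mh' k)).
  rewrite -integral_nneseries// in hoo.
  rewrite (le_lt_trans _ hoo)// le_eqVlt; apply/orP; left; apply/eqP.
  apply: eq_integral => x /set_mem Dx; rewrite gee0_abs//.
  by apply: nneseries_ge0 => k _ _; exact: h0'.
have [N [mN N0 NP]] := integrable_ae mD ih.
split => //; exists N; split => // x /= /not_implyP[Dx ncv]; apply: NP => /=.
move=> /(_ Dx) fx; apply: ncv.
apply: nondecreasing_is_cvgn.
  by apply/nondecreasing_seqP => k; rewrite !seriesEnat/= big_nat_recr//= lerDl h0.
exists (fine (\sum_(k <oo) (h k x)%:E)%E) => _ [k _ <-].
rewrite -lee_fin fineK// seriesEnat/= -sumEFin.
by apply: nneseries_lim_ge => i _ _; exact: h0'.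
Qed.

Lemma ae_cvg0 D (h : nat -> T -> R) : measurable D ->
  (forall k, measurable_fun D (h k)) -> (forall k x, D x -> 0 <= h k x) ->
  (\sum_(k <oo) \int[mu]_(x in D) (h k x)%:E < +oo)%E ->
  {ae mu, forall x, D x -> h k x @[k --> \oo] --> 0}.
Proof.
move=> mD mh h0 /(ae_summable mD mh h0)[_]; apply: filterS => x hx Dx.
exact: cvg_series_cvg_0 (hx Dx).
Qed.

(** The Riesz-Fischer argument: the series of increments converges absolutely almost everywhere, and
    its sum plus [|h 0|] dominates the sequence. *)
Lemma L1_complete D (h : nat -> T -> R) : measurable D ->
  (forall k, intg D (h k)) ->
  (\sum_(k <oo) \int[mu]_(x in D) `|h k.+1 x - h k x|%:E < +oo)%E ->
  exists g, [/\ intg D g,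
    {ae mu, forall x, D x -> h k x @[k --> \oo] --> g x} &
    \int[mu]_(x in D) `|h k x - g x| @[k --> \oo] --> 0].
Proof.
move=> mD ih hoo.
have mh k : measurable_fun D (h k) by exact: intg_meas.
have md k : measurable_fun D (fun x => `|h k.+1 x - h k x|).
  by apply: measurableT_comp => //; exact: measurable_funB.
have [iS aeS] := ae_summable mD md (fun k x _ => normr_ge0 _) hoo.
(* An upper limit is measurable whether or not the sequence converges; on the null set of divergence
   its value is irrelevant. *)
pose g x := fine (limn_esup (fun k => (h k x)%:E)).
have aeg : {ae mu, forall x, D x -> h k x @[k --> \oo] --> g x}.
  apply: filterS aeS => x cx Dx.
  have ch : cvgn (fun k => h k x).
    have /normed_cvg := cx Dx.
    rewrite (_ : series _ = fun n => h n x - h 0 x); last first.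
      exact: (telescopeK (fun k => h k x)).
    move=> c; rewrite (_ : (fun k => h k x) = (fun k => (h k x - h 0 x) + h 0 x)).
      by apply: is_cvgD => //; exact: is_cvg_cst.
    by apply/funext => k; rewrite subrK.
  rewrite /g is_cvg_limn_esupE.
    by rewrite EFin_lim.
  by apply/cvg_ex; exists (limn (fun k => h k x))%:E; apply: cvg_EFin => //; exact: nearW.
have mg : measurable_fun D g.
  apply: measurableT_comp => //; apply: measurable_fun_limn_esup => k.
  exact/measurable_EFinP.
have [|||||ig cv _] := @dominated_convergence _ T R mu D mD
  (fun k x => (h k x)%:E) (EFin \o g)
  (fun x => `|h 0 x|%:E + \sum_(k <oo) `|h k.+1 x - h k x|%:E)%E.
- by move=> k; exact/measurable_EFinP.
- exact/measurable_EFinP.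
- apply: filterS aeg => x gx Dx; apply/fine_cvgP; split; first exact: nearW.
  exact: gx.
- by apply: integrableD => //; exact: intg_norm.
- apply: aeW => x k Dx.
  apply: (@le_trans _ _ (`|h 0 x|%:E + \sum_(0 <= i < k) `|h i.+1 x - h i x|%:E)%E).
    rewrite sumEFin -EFinD lee_fin.
    elim: k => [|k IH]; first by rewrite big_geq// addr0.
    rewrite big_nat_recr//= addrA (le_trans _ (lerD IH (lexx _)))//.
    by rewrite -[X in `|X| <= _](subrK (h k x)) addrC ler_normD.
  by rewrite leeD2l//; apply: nneseries_lim_ge => i _ _.
exists g; split => //.
have -> : 0 = fine (0%E : \bar R) by [].
exact: fine_cvg.
Qed.

End real_integral.

Notation intg mu D f := (mu.-integrable D (EFin \o f)).

(** * Smooth cutoff functions *)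

Section smooth_real.
Context {R : realType}.
Implicit Types (f g : R -> R) (t : R) (n : nat).

(** Smoothness as a greatest fixed point: [f] belongs to some class of functions that is stable
    under differentiation. Exhibiting such a class replaces computations of iterated derivatives. *)
Definition smooth1 f := exists C : set (R -> R),
  C f /\ forall g, C g -> exists2 dg, C dg & forall t, is_derive t 1 g (dg t).

Lemma smooth1_derive f : smooth1 f ->
  exists2 df, smooth1 df & forall t, is_derive t 1 f (df t).
Proof.
move=> [C [Cf CC]]; have [df Cdf fdf] := CC f Cf.
by exists df => //; exists C; split.
Qed.

(** The algebra generated by the smooth functions and affine substitutions. Sum, product and chain
    rules make it stable under differentiation, so it serves as its own witness class for
    [smooth1]. *)
Inductive smooth_alg : (R -> R) -> Prop :=
| salg_base f : smooth1 f -> smooth_alg f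
| salg_cst (k : R) : smooth_alg (cst k)
| salg_add f g : smooth_alg f -> smooth_alg g -> smooth_alg (f + g)
| salg_mul f g : smooth_alg f -> smooth_alg g -> smooth_alg (f * g)
| salg_affine f (k l : R) : smooth_alg f -> smooth_alg (fun t => f (k * t + l)).

Lemma smooth_algP f : smooth_alg f -> smooth1 f.
Proof.
move=> sf; exists smooth_alg; split => // {sf} g; elim=> {g}.
- by move=> g /smooth1_derive[dg sdg gdg]; exists dg => //; exact: salg_base.
- by move=> k; exists (cst 0) => [|t]; [exact: salg_cst|exact: is_derive_cst].
- move=> f1 f2 _ [d1 s1 fd1] _ [d2 s2 fd2].
  by exists (d1 + d2) => [|t]; [exact: salg_add|exact: is_deriveD].
- move=> f1 f2 sf1 [d1 s1 fd1] sf2 [d2 s2 fd2].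
  exists (f1 * d2 + f2 * d1) => [|t].
    by apply: salg_add; exact: salg_mul.
  exact: is_deriveM.
- move=> f1 k l sf1 [d1 s1 fd1].
  exists ((fun t => d1 (k * t + l)) * cst k) => [|t].
    by apply: salg_mul; [exact: salg_affine|exact: salg_cst].
  apply: (@is_derive1_comp _ f1 (fun t => k * t + l) t) => //.
  have -> : (fun t => k * t + l) = k *: (id : R -> R) + cst l by [].
  by apply: is_derive_eq; rewrite addr0 -[RHS]mulr1.
Qed.

Lemma smooth1_cst (k : R) : smooth1 (cst k).
Proof. exact/smooth_algP/salg_cst. Qed.

Lemma smooth1D f g : smooth1 f -> smooth1 g -> smooth1 (fun t => f t + g t).
Proof.
by move=> sf sg; apply: smooth_algP; apply: salg_add; exact: salg_base.
Qed.

Lemma smooth1M f g : smooth1 f -> smooth1 g -> smooth1 (fun t => f t * g t).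
Proof.
by move=> sf sg; apply: smooth_algP; apply: salg_mul; exact: salg_base.
Qed.

Lemma smooth1_affine f (k l : R) : smooth1 f -> smooth1 (fun t => f (k * t + l)).
Proof.
by move=> sf; apply: smooth_algP; apply: salg_affine; exact: salg_base.
Qed.

(** Adjoining a primitive of [f] to a stable class containing [f] leaves it stable. *)
Lemma smooth1_primitive f g : smooth1 f ->
  (forall t, is_derive t 1 g (f t)) -> smooth1 g.
Proof.
move=> [C [Cf CC]] gf; exists (C `|` [set g]); split; first by right.
move=> h [/CC[dh Cdh hdh]|->]; [exists dh => //|exists f => //]; by left.
Qed.

Lemma smooth1_continuous f : smooth1 f -> continuous f.
Proof.
move=> /smooth1_derive[df _ fdf] t.
by apply/differentiable_continuous/derivable1_diffP; case: (fdf t).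
Qed.

(** The classical flat function [exp(-1/t)], extended by zero, times powers of [1/t]. The linear
    span of this family is stable under differentiation, so it is a witness class for [smooth1]. *)
Definition theta n t : R := if 0 < t then t^-1 ^+ n * expR (- t^-1) else 0.

Lemma theta_ge0 n t : 0 <= theta n t.
Proof.
rewrite /theta; case: ifP => // t0.
by rewrite mulr_ge0// ?expR_ge0// exprn_ge0// invr_ge0 ltW.
Qed.

Lemma theta_le0 n t : t <= 0 -> theta n t = 0.
Proof. by rewrite /theta ltNge => ->. Qed.

(** From [s^(n+2)/(n+2)! <= exp s] at [s = 1/t]. A quadratic bound is what makes the difference
    quotient at zero vanish in the limit. *)
Lemma theta_bound n t : 0 < t -> theta n t <= n.+2`!%:R * t ^+ 2.
Proof.
move=> t0; rewrite /theta t0 expRN ler_pdivrMr ?expR_gt0//.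
have s0 : 0 <= t^-1 by rewrite invr_ge0 ltW.
have sn : t^-1 ^+ n.+2 / n.+2`!%:R <= expR t^-1.
  by apply: le_trans (expR_ge1Dxn n.+1 s0); rewrite lerDr.
move: sn; rewrite ler_pdivrMr ?ltr0n ?fact_gt0// => sn.
rewrite mulrAC -ler_pdivrMr ?exprn_gt0//.
by rewrite -exprVn -exprD addn2 mulrC.
Qed.

Lemma is_derive_theta n t :
  is_derive t 1 (theta n) (theta n.+2 t - n%:R * theta n.+1 t).
Proof.
have [t0|t0|->] := ltgtP t 0.
- rewrite !theta_le0 ?mulr0 ?subr0 ?ltW//.
  apply: (near_eq_is_derive (f := (cst (0 : R) : R -> R))).
  near=> u; rewrite theta_le0//; near: u.
  by apply: filterS (lt_nbhsl t0) => u /ltW.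
- have tn0 : t != 0 by rewrite gt_eqF.
  pose s : R -> R := fun u => u^-1.
  have ds : is_derive t 1 s (- t ^- 2).
    have := is_deriveV tn0 (is_derive_id t (1 : R)).
    by move=> /is_derive_eq; apply; rewrite scaler1.
  have de : is_derive t 1 (fun u => expR (- s u)) (expR (- s t) * t ^- 2).
    apply: (@is_derive1_comp _ expR (fun u => - s u)).
    by have := is_deriveN ds; rewrite opprK.
  have dp : is_derive t 1 (s ^+ n) (- (n%:R * s t ^+ n.+1)).
    case: n => [|n].
      rewrite expr0 mul0r oppr0; exact: is_derive_cst.
    apply: (is_derive_eq (is_deriveX n.+1 ds)).
    rewrite /s -exprVn [_ *: _]mulrN; congr (- _).
    by rewrite -mulrA -exprD addn2.
  apply: (near_eq_is_derive (f := (s ^+ n) * (fun u => expR (- s u)))).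
    near=> u; have u0 : 0 < u by near: u; exact: lt_nbhsr.
    by rewrite /theta u0 /s [LHS]/(_ * _) /= exprfctE.
  apply: (is_derive_eq (is_deriveM dp de)).
  rewrite /theta t0 exprfctE/= /s -[t ^- 2]exprVn.
  by rewrite /GRing.scale/= !exprS; ring.
(* At the junction the value is zero on the left, and [theta_bound] keeps the difference quotient
   below a constant times [|h|]. *)
- rewrite !theta_le0// mulr0 subr0.
  have cv : (fun h => h^-1 *: ((theta n \o shift 0) (h *: 1) - theta n 0)) h
      @[h --> 0^'] --> (0 : R).
    apply/cvgr0Pnorm_le => e e0.
    pose c : R := n.+2`!%:R.
    have c0 : 0 < c by rewrite ltr0n fact_gt0.
    near=> h.
    have hn0 : h != 0 by near: h; exact: nbhs_dnbhs_neq.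
    have hle : `|h| <= e / c by near: h; apply: dnbhs0_le; rewrite divr_gt0.
    rewrite /= [theta n 0]theta_le0// subr0 addr0 [h *: 1]mulr1.
    rewrite [_ *: _]/(_ * _) normrM normfV ler_pdivrMl ?normr_gt0//.
    have [h0|h0] := leP h 0.
      by rewrite theta_le0// normr0 mulr_ge0// ltW.
    rewrite ger0_norm ?theta_ge0// (le_trans (theta_bound n h0))//.
    rewrite (gtr0_norm h0) in hle *; rewrite -/c expr2 mulrCA ler_pM2l//.
    by rewrite mulrC -ler_pdivlMr.
  by apply: DeriveDef; [apply/cvg_ex; exists 0|exact: cvg_lim].
Unshelve. all: by end_near. Qed.

Lemma smooth1_theta n : smooth1 (theta n).
Proof.
pose C := [set f | exists p : seq (R * nat),
  f = fun t => \sum_(x <- p) x.1 * theta x.2 t].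
exists C; split.
  by exists [:: (1, n)]; apply/funext => t; rewrite big_seq1 mul1r.
move=> _ [p ->].
suff [q pq] : exists q : seq (R * nat), forall t,
    is_derive t 1 (fun t => \sum_(x <- p) x.1 * theta x.2 t)
      (\sum_(x <- q) x.1 * theta x.2 t).
  by exists (fun t => \sum_(x <- q) x.1 * theta x.2 t) => //; exists q.
elim: p => [|[k m] p [q pq]].
  exists [::] => t; rewrite big_nil.
  rewrite (_ : (fun _ => _) = cst 0); first exact: is_derive_cst.
  by apply/funext => u; rewrite big_nil.
exists [:: (k, m.+2), (- (k * m%:R), m.+1) & q] => t.
rewrite (_ : (fun _ => _) =
    k *: theta m + (fun t => \sum_(x <- p) x.1 * theta x.2 t)); last first.
  by apply/funext => u; rewrite big_cons.
apply: (is_derive_eq (is_deriveD (is_deriveZ k (is_derive_theta m t)) (pq t))).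
by rewrite !big_cons/= /GRing.scale/=; ring.
Qed.

Lemma theta0_le1 t : theta 0 t <= 1.
Proof.
rewrite /theta; case: ifP => // t0.
by rewrite mul1r -expR0 ler_expR oppr_le0 invr_ge0 ltW.
Qed.

Lemma theta0_ge t : 0 < t -> 1 - t^-1 <= theta 0 t.
Proof. by move=> t0; rewrite /theta t0 mul1r; exact: expR_ge1Dx. Qed.

Lemma theta0_cvg1 (s : nat -> R) (c : R) : 0 < c ->
  (forall k, c * k.+1%:R <= s k) -> theta 0 (s k) @[k --> \oo] --> (1 : R).
Proof.
move=> c0 cs.
have s0 k : 0 < s k by rewrite (lt_le_trans _ (cs k))// mulr_gt0.
apply: (@squeeze_cvgr _ _ _ _ (fun k => 1 - c^-1 * k.+1%:R^-1) (cst 1)).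
- apply: nearW => k; rewrite theta0_le1 andbT.
  apply: le_trans (theta0_ge (s0 k)).
  by rewrite lerB// -invfM lef_pV2 ?posrE// mulr_gt0.
- rewrite -[X in _ --> X]subr0 -(mulr0 c^-1).
  apply: cvgB; first exact: cvg_cst.
  by apply: cvgMr; exact: cvg_harmonic.
- exact: cvg_cst.
Qed.

(* Smooth functions converging pointwise and boundedly to the indicator of
   ]a, b]; the second factor is nearly one at b itself, so that no boundary
   point has to be discarded. *)
Definition bump (a b : R) (k : nat) t : R :=
  theta 0 (k.+1%:R * (t - a)) *
  theta 0 (k.+1%:R * (k.+1%:R * (b - t) + 1)).

Lemma bump_ge0 (a b : R) k t : 0 <= bump a b k t.
Proof. by rewrite mulr_ge0 ?theta_ge0. Qed.

Lemma bump_le1 (a b : R) k t : bump a b k t <= 1.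
Proof. by rewrite mulr_ile1 ?theta_ge0 ?theta0_le1. Qed.

Lemma bump_neq0 (a b : R) k t : bump a b k t != 0 -> a < t < b + k.+1%:R^-1.
Proof.
have k0 : 0 < k.+1%:R :> R by [].
rewrite mulf_eq0 negb_or => /andP[h1 h2]; apply/andP; split.
  rewrite ltNge; apply: contra h1 => ta.
  by rewrite theta_le0// pmulr_rle0// subr_le0.
rewrite ltNge; apply: contra h2 => tb.
rewrite theta_le0// pmulr_rle0//.
rewrite -lerBrDr sub0r mulrC -ler_pdivlMr// mulN1r.
by move: (k.+1%:R^-1) tb => c; lra.
Qed.

Lemma bump_cvg (a b : R) t : bump a b k t @[k --> \oo] --> ((a < t <= b)%R%:R : R).
Proof.
have [at_|ta] := ltP a t; last first.
  rewrite (_ : (fun k => _) = cst 0); first exact: cvg_cst.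
  apply/funext => k; apply/eqP; apply: contraT => /bump_neq0/andP[].
  by rewrite ltNge ta.
have [tb|bt] := leP t b; last first.
  apply: cvg_near_cst.
  have /= : k.+1%:R^-1 @[k --> \oo] --> (0 : R) by exact: cvg_harmonic.
  move=> /cvgrPdist_lt /(_ (t - b)); rewrite subr_gt0 => /(_ bt).
  apply: filterS => k; rewrite sub0r normrN gtr0_norm// => kb.
  apply/eqP; apply: contraT => /bump_neq0/andP[_].
  by rewrite ltNge; move: (k.+1%:R^-1) kb => c kb; lra.
rewrite -[X in _ --> X]mulr1; apply: cvgM.
  apply: (@theta0_cvg1 _ (t - a)); first by rewrite subr_gt0.
  by move=> k; rewrite mulrC.
(* Since [t <= b], the inner factor is at least one and the argument at least [k+1]; the endpoint
   [t = b] is included. *)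
apply: (@theta0_cvg1 _ 1) => // k; rewrite mul1r ler_peMr// lerDr.
by rewrite mulr_ge0// subr_ge0.
Qed.

Lemma smooth1_bump (a b : R) k : smooth1 (bump a b k).
Proof.
apply: smooth1M.
  rewrite (_ : (fun _ => _) = (fun t => theta 0 (k.+1%:R * t + - (k.+1%:R * a)))).
    exact/smooth1_affine/smooth1_theta.
  by apply/funext => t; rewrite mulrBr.
rewrite (_ : (fun _ => _) = (fun t => theta 0
    (- (k.+1%:R * k.+1%:R) * t + k.+1%:R * (k.+1%:R * b + 1)))).
  exact/smooth1_affine/smooth1_theta.
by apply/funext => t; congr (theta 0 _); ring.
Qed.

End smooth_real.

(** * Smooth tent functions over the two halves of an interval *)

Section tent.
Context {R : realType}.

Lemma continuous_primitive (f : R -> R) (a : R) : continuous f ->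
  (forall t, t <= a -> f t = 0) ->
  exists P : R -> R, forall t : R, is_derive t 1 P (f t).
Proof.
(* Starting to the left of [a] makes every [t >= a] an interior point of [[a0, t + 1]], where the
   fundamental theorem of calculus applies; before [a] the primitive is zero. *)
move=> cf f0; pose a0 := a - 1.
pose P (x : R) : R := (\int[lebesgue_measure]_(t in [set` `[a0, x]]) f t).
exists P => t; have [ta|at_] := ltP t a.
  rewrite f0 ?ltW//.
  apply: (near_eq_is_derive (f := (cst (0 : R) : R -> R))).
  near=> u; have ua : u < a by near: u; exact: lt_nbhsl.
  have -> : P u = \int[lebesgue_measure]_(t in [set` `[a0, u]]) cst 0 t.
    apply: eq_Rintegral => v /set_mem/=; rewrite in_itv/= => /andP[_ vu].
    by rewrite f0// (le_trans vu)// ltW.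
  by rewrite Rintegral_cst ?mul0r.
have tt1 : t < t + 1 by rewrite ltrDl.
have fi : lebesgue_measure.-integrable `[a0, t + 1] (EFin \o f).
  apply: continuous_compact_integrable; first exact: segment_compact.
  exact: continuous_subspaceT.
have a0t : a0 < t by rewrite (lt_le_trans _ at_)// ltrBlDr ltrDl.
have [dP eP] := continuous_FTC1_closed tt1 fi a0t (cf t).
by apply: DeriveDef; rewrite -?derive1E.
Unshelve. all: by end_near. Qed.

(** With [P] a primitive of the bump on []a, m]] and [d = m - a], the tent is [P(t) - P(t - d)]. As
    the halves have equal length, shifting that bump by [d] gives the bump on []m, b]], whence the
    derivative. The mean value theorem writes the tent as [d] times a bump value at some point of
    [[t - d, t]], whence the bound and the support. *)
Lemma smooth_tent (a m b : R) (k : nat) : a <= m -> m - a = b - m ->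
  exists T : R -> R, [/\ smooth1 T,
    forall t : R, is_derive t 1 T (bump a m k t - bump m b k t),
    forall t, `|T t| <= m - a &
    forall t, T t != 0 -> a < t < b + k.+1%:R^-1].
Proof.
move=> am amb; set d := m - a.
have d0 : 0 <= d by rewrite subr_ge0.
have sb : smooth1 (bump a m k) by exact: smooth1_bump.
have [t ta|P dP] := @continuous_primitive (bump a m k) a (smooth1_continuous sb).
  by apply/eqP; apply: contraT => /bump_neq0; rewrite ltNge ta.
have sP : smooth1 P by exact: (smooth1_primitive sb).
have PMVT (t : R) : exists2 c : R, t - d <= c <= t & P t - P (t - d) = bump a m k c * d.
  have ttd : t - d <= t by rewrite lerBlDr lerDl.
  have [|c cI ->] := MVT_segment ttd (fun x _ => dP x).
    exact/continuous_subspaceT/smooth1_continuous.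
  by exists c; [move: cI; rewrite in_itv|congr (_ * _); ring].
exists (fun t => P t + -1 * P (1 * t + - d)); split.
- apply: smooth1D => //; apply: smooth1M; first exact: smooth1_cst.
  exact: smooth1_affine.
- move=> t.
  have dPd : is_derive t 1 (fun t => P (1 * t + - d)) (bump a m k (t - d) * 1).
    apply: (@is_derive1_comp _ P (fun t => 1 * t + - d) t).
      by rewrite mul1r; exact: dP.
    rewrite (_ : (fun _ => _) = id + cst (- d)).
      apply: (is_derive_eq (is_deriveD (is_derive_id t (1 : R)) (is_derive_cst _ t 1))).
      by rewrite addr0.
    by apply/funext => u; rewrite mul1r.
  rewrite (_ : (fun _ => _) = P - (fun t => P (1 * t + - d))); last first.
    by apply/funext => u; rewrite mulN1r.
  apply: (is_derive_eq (is_deriveB (dP t) dPd)).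
  rewrite mulr1; congr (_ - _); rewrite /bump.
  congr (theta 0 _ * theta 0 _); [rewrite /d; ring|rewrite /d amb; ring].
- move=> t; rewrite mulN1r mul1r.
  have [c _ ->] := PMVT t.
  rewrite ger0_norm; last by rewrite mulr_ge0 ?bump_ge0.
  by apply: ler_piMl => //; exact: bump_le1.
- move=> t; rewrite mulN1r mul1r; have [c /andP[c1 c2] ->] := PMVT t.
  rewrite mulf_eq0 negb_or => /andP[/bump_neq0/andP[ac cm] _].
  rewrite (lt_le_trans ac c2)/=.
  by move: (k.+1%:R^-1) cm => e cm; rewrite /d in c1; lra.
Qed.

End tent.

(** * Smooth functions of several variables as sums and products of functions of one coordinate *)

Section tensor.
Context {R : realType} {N : nat}.
Implicit Types (g : 'rV[R]_N -> R) (i j : 'I_N) (x v : 'rV[R]_N).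

Lemma is_derive_line g (phi : R -> R) x v (t d : R) :
  (forall h, g (h *: v + x) = phi (h + t)) -> is_derive t 1 phi d ->
  is_derive x v g d.
Proof.
move=> gphi [/cvg_ex[l dphi] <-].
have gE : (fun h => h^-1 *: ((g \o shift x) (h *: v) - g x)) =
    (fun h => h^-1 *: ((phi \o shift t) (h *: 1) - phi t)).
  apply/funext => h; rewrite /= gphi [h *: 1]mulr1.
  by have := gphi 0; rewrite scale0r !add0r => ->.
by apply: DeriveDef; [apply/cvg_ex; exists l; rewrite gE|rewrite /derive gE].
Qed.

Lemma delta_coord (h : R) x i j :
  (h *: delta_mx 0 j + x) 0 i = (i == j)%:R * h + x 0 i.
Proof. by rewrite !mxE/= mulrC. Qed.

(** The analogue of [smooth_alg] in several variables: an algebra of continuous functions stable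
    under all partial derivatives, hence made of smooth functions. *)
Inductive tens : ('rV[R]_N -> R) -> Prop :=
| tens_coord f i : smooth1 f -> tens (fun x => f (x 0 i))
| tens_cst (k : R) : tens (cst k)
| tens_add f g : tens f -> tens g -> tens (f + g)
| tens_mul f g : tens f -> tens g -> tens (f * g).

Lemma tens_derive g j : tens g ->
  exists2 dg, tens dg & forall x, is_derive x (delta_mx 0 j) g (dg x).
Proof.
elim=> {g} [f i sf|k|f g _ [df tdf fdf] _ [dg tdg gdg]|
            f g tf [df tdf fdf] tg [dg tdg gdg]].
- have [df sdf fdf] := smooth1_derive sf.
  have [<-|ij] := eqVneq i j.
    exists (fun x => df (x 0 i)); first exact: tens_coord.
    move=> x; apply: (@is_derive_line _ f _ _ (x 0 i)) => // h.
    by rewrite delta_coord eqxx mul1r.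
  exists (cst 0); first exact: tens_cst.
  move=> x; apply: (@is_derive_line _ (cst (f (x 0 i))) _ _ 0) => h.
  by rewrite delta_coord (negbTE ij) mul0r add0r.
- by exists (cst 0); [exact: tens_cst|move=> x; exact: is_derive_cst].
- by exists (df + dg); [exact: tens_add|move=> x; exact: is_deriveD].
- exists (f * dg + g * df); first by apply: tens_add; exact: tens_mul.
  by move=> x; exact: is_deriveM.
Qed.

Lemma tens_continuous g : tens g -> continuous g.
Proof.
elim=> {g} [f i sf|k|f g _ cf _ cg|f g _ cf _ cg] x.
- apply: (@continuous_comp _ _ _ (fun x : 'rV[R]_N => x 0 i)).
    exact: coord_continuous.
  exact: smooth1_continuous.
- exact: cst_continuous.
- by apply: (@continuousD R R^o 'rV[R]_N f g x); [exact: cf|exact: cg].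
- by apply: (@continuousM R 'rV[R]_N f g x); [exact: cf|exact: cg].
Qed.

Lemma tens_smooth g : tens g -> smooth g.
Proof.
move=> tg s; have : tens (foldr (@partial R N) g s).
  elim: s => //= j s /(tens_derive j)[dh tdh hdh].
  suff -> : partial j (foldr (@partial R N) g s) = dh by [].
  by apply/funext => x; rewrite /partial; case: (hdh x).
move=> th; split; first exact: tens_continuous.
by move=> x j; have [dh _ /(_ x)[]] := tens_derive j th.
Qed.

Definition prodf (b : 'I_N -> R -> R) x : R := \prod_i b i (x 0 i).

Lemma tens_prodf (b : 'I_N -> R -> R) :
  (forall i, smooth1 (b i)) -> tens (prodf b).
Proof.
move=> sb; rewrite /prodf; elim: (index_enum _) => [|i s IH].
  rewrite (_ : (fun _ => _) = cst 1); first exact: tens_cst.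
  by apply/funext => x; rewrite big_nil.
rewrite (_ : (fun _ => _) =
    (fun x => b i (x 0 i)) * (fun x => \prod_(j <- s) b j (x 0 j))).
  by apply: tens_mul => //; exact: tens_coord.
by apply/funext => x; rewrite big_cons.
Qed.

Definition fupd (b : 'I_N -> R -> R) j (f : R -> R) i :=
  if i == j then f else b i.

Lemma partial_prodf (b : 'I_N -> R -> R) j (db : R -> R) :
  (forall t : R, is_derive t 1 (b j) (db t)) ->
  partial j (prodf b) = prodf (fupd b j db).
Proof.
move=> bdb; apply/funext => x; rewrite /partial.
pose r := \prod_(i | i != j) b i (x 0 i).
suff [] : is_derive x (delta_mx 0 j) (prodf b) (prodf (fupd b j db) x) by [].
apply: (@is_derive_line _ (r *: b j) _ _ (x 0 j)).
  move=> h; rewrite /prodf (bigD1 j)//= delta_coord eqxx mul1r mulrC.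
  congr (_ * _); apply: eq_bigr => i ij.
  by rewrite delta_coord (negbTE ij) mul0r add0r.
apply: (is_derive_eq (is_deriveZ r (bdb (x 0 j)))).
rewrite /prodf (bigD1 j)//= /fupd eqxx mulrC; congr (_ * _).
by apply: eq_bigr => i /negbTE ->.
Qed.

Lemma test_prodf (Om : set 'rV[R]_N) (b : 'I_N -> R -> R) (a c : 'rV[R]_N) :
  (forall i, smooth1 (b i)) ->
  (forall i t, b i t != 0 -> a 0 i <= t <= c 0 i) ->
  cbox a c `<=` Om -> test_fun Om (prodf b).
Proof.
move=> sb bac acOm.
have sub : closure [set x | prodf b x != 0] `<=` cbox a c.
  rewrite closureE; apply: smallest_sub; first exact: closed_cbox.
  move=> x /= bx0 i; apply: bac; apply: contra bx0 => /eqP bi.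
  by rewrite /prodf (bigD1 i)//= bi mul0r.
split; first exact/tens_smooth/tens_prodf.
split; last exact: subset_trans sub acOm.
have clc := @closed_closure _ [set x : 'rV[R]_N | prodf b x != 0].
exact: (subclosed_compact clc (@compact_cbox R N a c)).
Qed.

End tensor.

(** * From test functions to integrals over half-open boxes *)

Section box_integrals.
Context {R : realType} {N : nat}.
Notation X := 'rV[R]_N.
Notation T := (lebT R N).
Implicit Types (w h : X -> R) (a b : X) (i j : 'I_N).

Lemma continuous_measurable_leb (D : set T) (g : X -> R) :
  continuous g -> measurable_fun D (g : T -> R).
Proof.
move=> /continuousP cg mD.
apply: (@measurability _ _ T R D g _ (RGenOpens.measurableE R) _ mD).
move=> _ [_ [x [y ->]] <-]; apply: measurableI => //.
by apply: measurable_open; apply: cg; exact: interval_open.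
Qed.

Lemma measurable_cbox a b : measurable (cbox a b : set T).
Proof. exact/measurable_closed/closed_cbox. Qed.

Lemma prodf_cvg (f : nat -> 'I_N -> R -> R) (c : 'I_N -> R -> R) (x : X) :
  (forall i, f k i (x 0 i) @[k --> \oo] --> c i (x 0 i)) ->
  prodf (f k) x @[k --> \oo] --> prodf c x.
Proof.
move=> fc; rewrite /prodf; elim: (index_enum _) => [|i s IH].
  rewrite big_nil (_ : (fun _ => _) = cst 1); first exact: cvg_cst.
  by apply/funext => k; rewrite big_nil.
rewrite big_cons (_ : (fun _ => _) =
    (fun k => f k i (x 0 i) * \prod_(j <- s) f k j (x 0 j))).
  by apply: cvgM.
by apply/funext => k; rewrite big_cons.
Qed.

Definition ind (a b t : R) : R := (a < t <= b)%R%:R.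

Lemma prodf_ind a b x : prodf (fun i => ind (a 0 i) (b 0 i)) x = \1_(box a b) x.
Proof.
rewrite indicE /prodf /ind; case: (boolP (x \in _)) => [/set_mem abx|].
  by rewrite big1// => i _; rewrite abx.
move=> /negP abx; apply/eqP/prodf_eq0.
apply: contrapT => nex; apply: abx; apply/mem_set => i.
apply: contrapT => /negP ni; apply: nex; exists i => //.
by rewrite (negbTE ni).
Qed.

Lemma prodf_norm_le1 (f : 'I_N -> R -> R) x :
  (forall i t, `|f i t| <= 1) -> `|prodf f x| <= 1.
Proof.
by move=> f1; rewrite /prodf normr_prod prodr_ile1// => i _; rewrite f1 normr_ge0.
Qed.

Lemma integral_support (Om K : set T) (F : X -> R) : measurable Om ->
  measurable K -> K `<=` Om -> (forall x, ~ K x -> F x = 0) ->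
  (\int[leb]_(x in Om) (F x)%:E = \int[leb]_(x in K) (F x)%:E)%E.
Proof.
move=> mO mK KO F0; rewrite -[in RHS](setIidr KO) integral_mkcondr.
apply: eq_integral => x _; rewrite patchE; case: ifPn => // /negP xK.
by rewrite F0// => Kx; apply: xK; exact/mem_set.
Qed.

Lemma Rintegral_prodf_cvg (K : set T) w (f : nat -> 'I_N -> R -> R)
    (c : 'I_N -> R -> R) : measurable K -> intg leb K w ->
  (forall k i, smooth1 (f k i)) -> (forall k i t, `|f k i t| <= 1) ->
  (forall i t, f k i t @[k --> \oo] --> c i t) ->
  \int[leb]_(x in K) (w x * prodf (f k) x) @[k --> \oo] -->
  \int[leb]_(x in K) (w x * prodf c x).
Proof.
move=> mK wi sf f1 fc.
have mf k : measurable_fun K (prodf (f k) : T -> R).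
  by apply: continuous_measurable_leb; exact/tens_continuous/tens_prodf.
have fle k x : K x -> `|prodf (f k) x| <= 1 by move=> _; exact: prodf_norm_le1.
have cf x : K x -> prodf (f k) x @[k --> \oo] --> prodf c x.
  by move=> _; exact: prodf_cvg.
exact: (Rintegral_dctM mK wi mf fle cf).
Qed.

Section test_limit.
Variables (Om : set X) (a b : X) (e : R).
Hypothesis mOm : measurable (Om : set T).
Hypothesis e0 : 0 < e.
Hypothesis KOm : cbox a (vshift b e) `<=` Om.
Let K : set T := cbox a (vshift b e).
Let mK : measurable K := measurable_cbox a (vshift b e).

Lemma near_harmonic_lt : \forall k \near \oo, k.+1%:R^-1 < e.
Proof.
have /cvgrPdist_lt/(_ e e0) := @cvg_harmonic R.
by apply: filterS => k; rewrite /harmonic/= sub0r normrN gtr0_norm.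
Qed.

Lemma box_room : box a b `<=` K.
Proof. by move=> x /box_cbox; apply: cbox_vshift; exact: ltW. Qed.

Let bumps k i := bump (a 0 i) (b 0 i) k.

Lemma test_bumps j (f : R -> R) k : k.+1%:R^-1 < e -> smooth1 f ->
  (forall t, f t != 0 -> a 0 j < t < b 0 j + k.+1%:R^-1) ->
  test_fun Om (prodf (fupd (bumps k) j f)).
Proof.
move=> ke sf fab; apply: (@test_prodf _ _ _ _ a (vshift b e)) => //.
  by move=> i; rewrite /fupd; case: ifP => // _; exact: smooth1_bump.
move=> i t; rewrite mxE /fupd; case: (i =P j) => [->|_] ft.
  have /andP[/ltW -> tb] := fab _ ft.
  by rewrite (le_trans (ltW tb))// lerD2l ltW.
have /andP[/ltW -> tb] := bump_neq0 ft.
by rewrite (le_trans (ltW tb))// lerD2l ltW.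
Qed.

Lemma prodf_bumps_out (f : 'I_N -> R -> R) x :
  (forall i t, f i t != 0 -> a 0 i <= t <= b 0 i + e) ->
  ~ K x -> prodf f x = 0.
Proof.
move=> fab nK; apply/eqP; apply: contrapT => /negP fx0; apply: nK => i.
rewrite mxE; apply: fab; apply: contra fx0 => /eqP fi.
by rewrite /prodf (bigD1 i)//= fi mul0r.
Qed.

(** Products of bumps converge boundedly to the indicator of the half-open box. For large [k] their
    supports lie in the enlarged closed box [K], so they are admissible tests, and dominated
    convergence on [K] transfers the equality to the box. *)
Lemma test_eq_box h1 h2 : intg leb K h1 -> intg leb K h2 ->
  (forall g, test_fun Om g -> \int[leb]_(x in (Om : set T)) (h1 x * g x)%:E =
    \int[leb]_(x in (Om : set T)) (h2 x * g x)%:E)%E ->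
  \int[leb]_(x in (box a b : set T)) h1 x =
  \int[leb]_(x in (box a b : set T)) h2 x.
Proof.
move=> i1 i2 h12.
have bK := box_room; have mb : measurable (box a b : set T) by exact: measurable_box.
have lim h : intg leb K h ->
    \int[leb]_(x in K) (h x * prodf (bumps k) x) @[k --> \oo] -->
    \int[leb]_(x in (box a b : set T)) h x.
  move=> hi; rewrite -(Rintegral_indic leb h mK mb bK).
  under [X in _ --> X]eq_Rintegral do rewrite -prodf_ind.
  apply: Rintegral_prodf_cvg => // [k i|k i t|i t].
  - exact: smooth1_bump.
  - by rewrite ger0_norm ?bump_ge0// bump_le1.
  - exact: bump_cvg.
apply: (cvg_unique _ (lim h1 i1)) => //.
apply: cvg_trans (lim h2 i2); apply: near_eq_cvg.
apply: filterS near_harmonic_lt => k ke.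
have fab i t : bumps k i t != 0 -> a 0 i <= t <= b 0 i + e.
  move=> /bump_neq0/andP[/ltW -> tb].
  by rewrite (le_trans (ltW tb))// lerD2l ltW.
have tg : test_fun Om (prodf (bumps k)).
  apply: (@test_prodf _ _ _ _ a (vshift b e)) => // [i|i t /fab].
    exact: smooth1_bump.
  by rewrite mxE.
have := h12 _ tg; rewrite !(integral_support mOm mK KOm) => [/(congr1 fine)/esym//||].
- by move=> x nK; rewrite (prodf_bumps_out fab nK) mulr0.
- by move=> x nK; rewrite (prodf_bumps_out fab nK) mulr0.
Qed.

(* The tent in direction [j] over the two halves of the box, times bumps in the
   other directions, turns the weak derivative into a difference of integrals. *)
Lemma weak_partial_halves w h j m : a 0 j <= m -> m - a 0 j = b 0 j - m ->
  intg leb K w -> intg leb K h ->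
  (forall g, test_fun Om g ->
    \int[leb]_(x in (Om : set T)) (w x * partial j g x)%:E =
    - \int[leb]_(x in (Om : set T)) (h x * g x)%:E)%E ->
  `|\int[leb]_(x in (box a (upd b j m) : set T)) w x -
    \int[leb]_(x in (box (upd a j m) b : set T)) w x| <=
  (m - a 0 j) * \int[leb]_(x in (box a b : set T)) `|h x|.
Proof.
move=> am amb wi hi wh; set d := m - a 0 j.
have d0 : 0 <= d by rewrite subr_ge0.
have mb : m <= b 0 j by rewrite -subr_ge0 -amb.
have bK := box_room; have mbx a' b' : measurable (box a' b' : set T).
  exact: measurable_box.
have [tn tnP] := choice (fun k => @smooth_tent R (a 0 j) m (b 0 j) k am amb).
(* [dtn] is the derivative of the tent, and [dlim] its pointwise limit: the indicator of the lower
   half minus that of the upper half. *)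
pose dtn k (t : R) : R := bump (a 0 j) m k t - bump m (b 0 j) k t.
pose dlim (t : R) : R := ind (a 0 j) m t - ind m (b 0 j) t.
have b1K : box a (upd b j m) `<=` K.
  apply: subset_trans bK => x bx i; have := bx i; rewrite updE.
  by case: eqP => // -> /andP[-> /le_trans->].
have b2K : box (upd a j m) b `<=` K.
  apply: subset_trans bK => x bx i; have := bx i; rewrite updE.
  by case: eqP => // -> /andP[/(le_lt_trans am) -> ->].
have lim1 : \int[leb]_(x in K) (w x * prodf (fupd (bumps k) j (dtn k)) x)
    @[k --> \oo] -->
    \int[leb]_(x in (box a (upd b j m) : set T)) w x -
    \int[leb]_(x in (box (upd a j m) b : set T)) w x.
  rewrite -(Rintegral_indic leb w mK (mbx _ _) b1K).
  rewrite -(Rintegral_indic leb w mK (mbx _ _) b2K).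
  rewrite -(RintegralB mK (intg_indic mK (mbx _ _) wi) (intg_indic mK (mbx _ _) wi)).
  rewrite [X in _ --> X](_ : _ = \int[leb]_(x in K)
      (w x * prodf (fupd (fun i => ind (a 0 i) (b 0 i)) j dlim) x)); last first.
    apply: eq_Rintegral => x _; rewrite -mulrBr -!prodf_ind; congr (_ * _).
    rewrite /prodf !(bigD1 j (P := xpredT))//= /fupd !updE !eqxx /dlim mulrBl.
    congr (_ * _ - _ * _); apply: eq_bigr => i ij.
      by rewrite updE (negbTE ij).
    by rewrite updE (negbTE ij).
  apply: Rintegral_prodf_cvg => // [k i|k i t|i t]; rewrite /fupd; case: ifP => _.
  - have -> : dtn k = fun t => bump (a 0 j) m k t + -1 * bump m (b 0 j) k t.
      by apply/funext => t; rewrite mulN1r.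
    apply: smooth1D; first exact: smooth1_bump.
    by apply: smooth1M; [exact: smooth1_cst|exact: smooth1_bump].
  - exact: smooth1_bump.
  - have := bump_ge0 (a 0 j) m k t; have := bump_ge0 m (b 0 j) k t.
    have := bump_le1 (a 0 j) m k t; have := bump_le1 m (b 0 j) k t.
    by rewrite /dtn ler_norml => *; lra.
  - by rewrite ger0_norm ?bump_ge0// bump_le1.
  - by apply: cvgB; exact: bump_cvg.
  - exact: bump_cvg.
(* At stage [k] the test function is bounded by [d] on a box that sticks out of [box a b] by
   [1/(k+1)]. These boxes decrease exactly to the half-open box, so no boundary term is left
   over. *)
have lim2 : d * \int[leb]_(x in K) (`|h x| * \1_(box a (vshift b k.+1%:R^-1)) x)
    @[k --> \oo] --> d * \int[leb]_(x in (box a b : set T)) `|h x|.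
  apply: cvgMr; rewrite -(Rintegral_indic leb _ mK (mbx _ _) bK).
  have mI k : measurable_fun K (\1_(box a (vshift b k.+1%:R^-1)) : T -> R).
    exact: measurable_indic.
  have I1 k x : K x -> `|\1_(box a (vshift b k.+1%:R^-1)) x| <= (1 : R).
    by move=> _; rewrite indicE; case: (_ \in _); rewrite ?normr1 ?normr0.
  apply: (Rintegral_dctM mK (intg_norm mK hi) mI I1).
  - move=> x _; rewrite -prodf_ind.
    under eq_cvg do rewrite -prodf_ind.
    have -> : (fun k => prodf (fun i => ind (a 0 i) (vshift b k.+1%:R^-1 0 i)) x) =
              (fun k => prodf (fun i t => ind (a 0 i) (b 0 i + k.+1%:R^-1) t) x).
      by apply/funext => k; apply: eq_bigr => i _; rewrite mxE.
    apply: (@prodf_cvg (fun k i t => ind (a 0 i) (b 0 i + k.+1%:R^-1) t)) => i.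
    apply: cvg_near_cst; rewrite /ind; case: (ltP (a 0 i)) => /= _; last exact: nearW.
    have [xb|bx] := leP (x 0 i) (b 0 i).
      by apply: nearW => k; rewrite (le_trans xb)// lerDl.
    have /cvgrPdist_lt/(_ (x 0 i - b 0 i)) := @cvg_harmonic R.
    rewrite subr_gt0 => /(_ bx); apply: filterS => k.
    rewrite /harmonic/= sub0r normrN gtr0_norm// => kb.
    by rewrite leNgt (_ : _ < _ = true)//; apply/idP; rewrite -ltrBrDl.
(* What remains is the inequality at a fixed large [k], where integration by parts against the tent
   is legitimate. *)
apply: (ler_cvg_to (cvg_norm lim1) lim2).
apply: filterS near_harmonic_lt => k ke.
have [st dt t1 tab] := tnP k.
have tg : test_fun Om (prodf (fupd (bumps k) j (tn k))) by exact: test_bumps.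
have fab (f : R -> R) : (forall t, f t != 0 -> a 0 j < t < b 0 j + k.+1%:R^-1) ->
    forall i t, fupd (bumps k) j f i t != 0 -> a 0 i <= t <= b 0 i + e.
  move=> fj i t; rewrite /fupd; case: (i =P j) => [->|_].
    by move=> /fj/andP[/ltW -> tb]; rewrite (le_trans (ltW tb))// lerD2l ltW.
  move=> /bump_neq0/andP[/ltW -> tb].
  by rewrite (le_trans (ltW tb))// lerD2l ltW.
have mtens f : tens f -> measurable_fun K (f : T -> R).
  by move=> tf; exact/continuous_measurable_leb/tens_continuous.
have sbumps f : smooth1 f -> forall i, smooth1 (fupd (bumps k) j f i).
  by move=> sf i; rewrite /fupd; case: ifP => // _; exact: smooth1_bump.
have bumps0 (x : X) : 0 <= \prod_(i | i != j) bumps k i (x 0 i) <= 1.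
  by rewrite prodr_ge0 ?prodr_ile1// => i _; rewrite bump_ge0// bump_le1.
have tsplit f (x : X) : prodf (fupd (bumps k) j f) x =
    f (x 0 j) * \prod_(i | i != j) bumps k i (x 0 i).
  rewrite /prodf (bigD1 j)//= /fupd eqxx; congr (_ * _).
  by apply: eq_bigr => i /negbTE ->.
have gd (x : X) : `|prodf (fupd (bumps k) j (tn k)) x| <=
    d * \1_(box a (vshift b k.+1%:R^-1)) x.
  rewrite indicE; case: (boolP (x \in _)) => [_|/negP nx].
    rewrite mulr1 tsplit normrM; have /andP[p0 p1] := bumps0 x.
    by rewrite (ger0_norm p0) -[leRHS]mulr1 ler_pM.
  rewrite mulr0 normr_le0; apply: contrapT => /negP fx0; apply: nx.
  apply/mem_set => i; rewrite mxE.
  have : fupd (bumps k) j (tn k) i (x 0 i) != 0.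
    apply: contra fx0 => /eqP fi.
    by rewrite /prodf (bigD1 i)//= fi mul0r.
  rewrite /fupd; case: (i =P j) => [->|_].
    by move=> /tab/andP[-> /ltW].
  by move=> /bump_neq0/andP[-> /ltW].
have hgi : intg leb K (fun x => h x * prodf (fupd (bumps k) j (tn k)) x).
  apply: (intgMb (C := d)) => //; first exact/mtens/tens_prodf/sbumps.
  move=> x _; apply: le_trans (gd x) _.
  by rewrite ler_piMr// indicE; case: (_ \in _).
have wgi : intg leb K (fun x => w x * prodf (fupd (bumps k) j (dtn k)) x).
  have sdtn : smooth1 (dtn k).
    have -> : dtn k = fun t => bump (a 0 j) m k t + -1 * bump m (b 0 j) k t.
      by apply/funext => t; rewrite mulN1r.
    apply: smooth1D; first exact: smooth1_bump.
    by apply: smooth1M; [exact: smooth1_cst|exact: smooth1_bump].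
  apply: (intgMb (C := 1)) => //; first exact/mtens/tens_prodf/sbumps.
  move=> x _; rewrite tsplit normrM; have /andP[p0 p1] := bumps0 x.
  rewrite (ger0_norm p0) mulr_ile1//.
  have := bump_ge0 (a 0 j) m k (x 0 j); have := bump_ge0 m (b 0 j) k (x 0 j).
  have := bump_le1 (a 0 j) m k (x 0 j); have := bump_le1 m (b 0 j) k (x 0 j).
  by rewrite /dtn ler_norml => *; lra.
have -> : \int[leb]_(x in K) (w x * prodf (fupd (bumps k) j (dtn k)) x) =
    - \int[leb]_(x in K) (h x * prodf (fupd (bumps k) j (tn k)) x).
  have dtP t : is_derive (t : R) 1 (fupd (bumps k) j (tn k) j) (dtn k t).
    by rewrite /fupd eqxx; exact: dt.
  have := wh _ tg; rewrite (partial_prodf dtP).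
  have -> : fupd (fupd (bumps k) j (tn k)) j (dtn k) = fupd (bumps k) j (dtn k).
    by apply/funext => i; rewrite /fupd; case: (i =P j).
  have fabd t : dtn k t != 0 -> a 0 j < t < b 0 j + k.+1%:R^-1.
    have [t0|/bump_neq0/andP[at_ tm] _] := eqVneq (bump (a 0 j) m k t) 0.
      rewrite /dtn t0 sub0r oppr_eq0 => /bump_neq0/andP[mt ->].
      by rewrite (le_lt_trans am).
    by rewrite at_ (lt_le_trans tm)// lerD2r.
  rewrite !(integral_support mOm mK KOm); last 2 first.
  - by move=> x nK; rewrite (prodf_bumps_out (fab _ tab) nK) mulr0.
  - by move=> x nK; rewrite (prodf_bumps_out (fab _ fabd) nK) mulr0.
  by rewrite !Rintegral_EFin// -EFinN => -[].
rewrite normrN; apply: le_trans (le_normr_Rintegral mK hgi) _.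
have mI : measurable_fun K (\1_(box a (vshift b k.+1%:R^-1)) : T -> R).
  exact: measurable_indic.
have hI : intg leb K (fun x => `|h x| * \1_(box a (vshift b k.+1%:R^-1)) x).
  exact: (intg_indic mK (mbx _ _) (intg_norm mK hi)).
rewrite -RintegralZl//; apply: le_Rintegral => //.
- exact: intg_norm.
- exact: intgZ.
- by move=> x Kx; rewrite normrM mulrCA ler_wpM2l.
Qed.

End test_limit.
End box_integrals.

(** * Dyadic cells of a box *)

Section cells.
Context {R : realType} {N : nat}.
Notation X := 'rV[R]_N.
Notation T := (lebT R N).
Notation bx := (X * X)%type.
Implicit Types (B : bx) (i j : 'I_N) (js : seq 'I_N) (c : bool) (x y : X).

Definition boxp B : set X := box B.1 B.2.
Definition mid B j : R := (B.1 0 j + B.2 0 j) / 2.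
Definition half c j B : bx :=
  if c then (B.1, upd B.2 j (mid B j)) else (upd B.1 j (mid B j), B.2).
Definition side B j : R := B.2 0 j - B.1 0 j.

(** Bisects in the directions [js] one after the other and keeps each time the half on the side of
    [x]. Naming the cells by points avoids enumerating the subboxes. *)
Fixpoint cell js B x : bx :=
  if js is j :: js' then cell js' (half (x 0 j <= mid B j) j B) x else B.

Lemma boxp_half c j B x :
  boxp (half c j B) x <-> boxp B x /\ (x 0 j <= mid B j) = c.
Proof.
rewrite /boxp /half /box /mid; case: c => /=; split.
- move=> bx0; have := bx0 j; rewrite updE eqxx => /andP[ax xm]; split=> [i|//].
  have := bx0 i; rewrite updE; case: (i =P j) => [-> _|//].
  by rewrite ax /=; lra.
- move=> [bx0 xm] i; rewrite updE; case: (i =P j) => [->|_]; last exact: bx0.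
  by rewrite xm andbT; have /andP[] := bx0 j.
- move=> bx0; have := bx0 j; rewrite updE eqxx => /andP[ax xm]; split.
    move=> i; have := bx0 i; rewrite updE; case: (i =P j) => [-> _|//].
    by rewrite xm andbT; lra.
  by apply/negbTE; rewrite -ltNge.
- move=> [bx0 /negbT]; rewrite -ltNge => xm i.
  rewrite updE; case: (i =P j) => [->|_]; last exact: bx0.
  by rewrite xm; have /andP[] := bx0 j.
Qed.

Lemma boxp_half_sub c j B : boxp (half c j B) `<=` boxp B.
Proof. by move=> x /boxp_half[]. Qed.

Lemma boxp_halves j B :
  boxp B = boxp (half true j B) `|` boxp (half false j B).
Proof.
apply/seteqP; split => [x Bx|x [|]/boxp_half[]//].
case: (boolP (x 0 j <= mid B j)) => xm; [left|right]; apply/boxp_half; split=> //.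
exact/negbTE.
Qed.

Lemma boxp_halves_disj j B :
  [disjoint boxp (half true j B) & boxp (half false j B)].
Proof.
apply/eqP; rewrite -subset0 => x [/boxp_half[_ xt] /boxp_half[_]].
by rewrite xt.
Qed.

Lemma measurable_boxp B : measurable (boxp B : set T).
Proof. exact: measurable_box. Qed.

Lemma leb_boxp_lty B : (leb (boxp B : set T) < +oo)%E.
Proof. exact: leb_box_lty. Qed.

(** The upper half is the translate of the lower one by half a side. *)
Lemma leb_halves j B : leb (boxp (half false j B) : set T) =
  leb (boxp (half true j B) : set T).
Proof.
pose v : X := (mid B j - B.1 0 j) *: delta_mx 0 j.
rewrite /leb -[RHS](leb_outer_shift v); congr (leb_outer R N _).
apply/seteqP; split => x; rewrite /half /boxp /box/= => bx0 i.
  have := bx0 i; rewrite !updE !mxE /=; case: (i =P j) => [->|_].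
    by rewrite /mid mulr1; lra.
  by rewrite mulr0 subr0.
have := bx0 i; rewrite !updE !mxE /=; case: (i =P j) => [->|_].
  by rewrite /mid mulr1; lra.
by rewrite mulr0 subr0.
Qed.

Lemma cell_cat js js' B x : cell (js ++ js') B x = cell js' (cell js B x) x.
Proof. by elim: js B => //= j js IH B; rewrite IH. Qed.

Lemma cell_sub js B x : boxp (cell js B x) `<=` boxp B.
Proof.
by elim: js B => [|j js IH] B y //= /IH/boxp_half[].
Qed.

Lemma cell_self js B x : boxp B x -> boxp (cell js B x) x.
Proof. by elim: js B => //= j js IH B Bx; apply/IH/boxp_half. Qed.

Lemma cell_eq js B x y : boxp (cell js B x) y -> cell js B y = cell js B x.
Proof.
elim: js B => //= j js IH B yx.
have /boxp_half[_ ->] := cell_sub yx; exact: IH.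
Qed.

Lemma side_half c j B i : side (half c j B) i = side B i / (if i == j then 2 else 1).
Proof.
rewrite /side /half /mid; case: c => /=; rewrite updE; case: (i =P j) => [->|_];
  by [lra|rewrite divr1].
Qed.

Lemma side_cell js B x i :
  side (cell js B x) i = side B i / 2 ^+ count_mem i js.
Proof.
elim: js B => /= [|j js IH] B; first by rewrite expr0 divr1.
rewrite IH side_half exprD [j == i]eq_sym; case: (i == j).
  by rewrite expr1 invfM mulrA.
by rewrite expr0 mul1r divr1.
Qed.

(* Any set of directions would do, as long as all sides shrink. *)
Definition dirs s := flatten (nseq s (enum 'I_N)).

Lemma dirsD s t : dirs (s + t) = dirs s ++ dirs t.
Proof.
by elim: s => //= s IH; rewrite addSn /dirs/= -catA; congr (_ ++ _); exact: IH.
Qed.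

Lemma count_dirs i s : count_mem i (dirs s) = s.
Proof.
elim: s => //= s IH; rewrite /dirs/= count_cat [count _ (flatten _)]IH.
by rewrite count_uniq_mem ?enum_uniq// mem_enum.
Qed.

(** Sets saturated for the partition of [B] into cells, that is, finite unions of cells, described
    pointwise. *)
Definition sat js B (A : set X) :=
  A `<=` boxp B /\ forall x, A x -> boxp (cell js B x) `<=` A.

Lemma sat_cons j js B A c : sat (j :: js) B A ->
  sat js (half c j B) (A `&` boxp (half c j B)).
Proof.
move=> [AB Acell]; split; first by move=> x [].
move=> x [Ax /boxp_half[Bx xc]] y yx; split; last exact: cell_sub yx.
by apply: (Acell x Ax); rewrite /= xc.
Qed.

Lemma sat_cat js js' B A : sat js B A -> sat (js ++ js') B A.
Proof.
move=> [AB Acell]; split => // x Ax; rewrite cell_cat => y /cell_sub.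
exact: Acell.
Qed.

Lemma sat_nil B A : sat [::] B A -> A = set0 \/ A = boxp B.
Proof.
move=> [AB /= BA]; have [->|/set0P[x Ax]] := eqVneq A set0; first by left.
by right; apply/seteqP; split => //; exact: BA Ax.
Qed.

Lemma sat_halves j js B A : sat (j :: js) B A ->
  A = (A `&` boxp (half true j B)) `|` (A `&` boxp (half false j B)).
Proof.
by move=> [AB _]; rewrite -setIUr -boxp_halves setIidl.
Qed.

Lemma measurable_sat js B A : sat js B A -> measurable (A : set T).
Proof.
elim: js B A => [|j js IH] B A.
  by move=> /sat_nil[->|->]; [exact: measurable0|exact: measurable_boxp].
move=> sA; rewrite (sat_halves sA); apply: measurableU; exact/IH/sat_cons.
Qed.

(** A saturated set splits over the two halves of [B] into sets saturated for the remaining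
    directions; the induction ends at single cells, where the hypothesis applies. *)
Lemma sat_integral js B (A : set X) (f g : X -> R) : sat js B A ->
  intg leb (boxp B : set T) f -> intg leb (boxp B : set T) g ->
  (forall x, boxp B x -> \int[leb]_(y in (boxp (cell js B x) : set T)) f y =
                         \int[leb]_(y in (boxp (cell js B x) : set T)) g y) ->
  \int[leb]_(x in (A : set T)) f x = \int[leb]_(x in (A : set T)) g x.
Proof.
elim: js B A => [|j js IH] B A sA fi gi fg.
  case: (sat_nil sA) => ->; first by rewrite !Rintegral_set0.
  have [B0|/set0P[x Bx]] := eqVneq (boxp B) set0; last exact: fg Bx.
  by rewrite B0 !Rintegral_set0.
have mA c : measurable (A `&` boxp (half c j B) : set T).
  exact: measurable_sat (sat_cons c sA).
have sub : (A `&` boxp (half true j B)) `|` (A `&` boxp (half false j B))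
    `<=` boxp B by rewrite -(sat_halves sA); exact: sA.1.
have mB : measurable (boxp B : set T) := measurable_boxp B.
have mU : measurable ((A `&` boxp (half true j B)) `|`
  (A `&` boxp (half false j B)) : set T) by exact: measurableU.
have dis : [disjoint A `&` boxp (half true j B) & A `&` boxp (half false j B)].
  apply/eqP; rewrite -subset0 => x [[_ xt] [_ xf]].
  have /eqP := boxp_halves_disj j B; rewrite -subset0; apply.
  by split; [exact: xt|exact: xf].
rewrite (sat_halves sA) !Rintegral_setU//; last 2 first.
- exact: integrableS mB mU sub gi.
- exact: integrableS mB mU sub fi.
have half_eq c : \int[leb]_(x in (A `&` boxp (half c j B) : set T)) f x =
    \int[leb]_(x in (A `&` boxp (half c j B) : set T)) g x.
  apply: IH; first exact: sat_cons sA.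
  - exact: integrableS mB (measurable_boxp _) (@boxp_half_sub _ _ _) fi.
  - exact: integrableS mB (measurable_boxp _) (@boxp_half_sub _ _ _) gi.
  - by move=> x /boxp_half[Bx xc]; have := fg x Bx; rewrite /= xc.
by rewrite !half_eq.
Qed.

End cells.

(** * A function whose integral vanishes on every dyadic cell is zero almost everywhere *)

Section null_cells.
Context {R : realType} {N : nat}.
Notation X := 'rV[R]_N.
Notation T := (lebT R N).
Variables (B : X * X) (f : X -> R).
Hypothesis fi : intg leb (boxp B : set T) f.
Hypothesis f0 : forall s x, boxp B x ->
  \int[leb]_(y in (boxp (cell (dirs s) B x) : set T)) f y = 0.

Let mB : measurable (boxp B : set T) := measurable_boxp B.

(** A pi-system of subsets of the whole space: only the trace on [B] has to be a union of cells of
    some depth. *)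
Definition sat_dirs : set (set X) :=
  [set A | exists s, sat (dirs s) B (A `&` boxp B)].

Lemma sat_dirsI : setI_closed sat_dirs.
Proof.
move=> A A' [s [AB sA]] [t [AB' sA']].
exists (s + t)%N; split; first by move=> x [].
move=> x [[Ax A'x] Bx] y yx.
have [Ay By] : (A `&` boxp B) y.
  by apply: (sA x) => //; move: yx; rewrite dirsD cell_cat => /cell_sub.
have [A'y _] : (A' `&` boxp B) y.
  by apply: (sA' x) => //; move: yx; rewrite addnC dirsD cell_cat => /cell_sub.
by [].
Qed.

Notation satT := (g_sigma_algebraType sat_dirs).

(** The sides of the cells tend to zero, so within [B] the half-space is the union, over all depths,
    of the cells that it contains. *)
Lemma sat_half_space i t : measurable (half_space i t : set satT).
Proof.
(* Points of the half-space outside [B] belong to every [A s], since only the trace on [B]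
   counts. *)
pose A s : set X := [set x | half_space i t x /\
  (boxp B x -> boxp (cell (dirs s) B x) `<=` half_space i t)].
rewrite (_ : half_space i t = \bigcup_s A s).
  apply: bigcupT_measurable => s; apply: sub_sigma_algebra; exists s.
  split; first by move=> x [].
  move=> x [[tx cx] Bx] y yx; split; last exact: cell_sub yx.
  by split; [exact: cx|rewrite (cell_eq yx) => _; exact: cx].
apply/seteqP; split => [x tx|x [s _ []//]].
have [Bx|nBx] := pselect (boxp B x); last by exists 0%N => //; split.
pose d := side B i; pose e := x 0 i - t.
have e0 : 0 < e by rewrite subr_gt0.
have d0 : 0 < d.
  by have /andP[ax xb] := Bx i; rewrite subr_gt0 (lt_le_trans ax xb).
have [s ds] : exists s, d / 2 ^+ s < e.
  exists (Num.trunc (d / e)).+1.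
  rewrite ltr_pdivrMr ?exprn_gt0// mulrC -ltr_pdivrMr//.
  apply: lt_trans (truncnS_gt _) _.
  by rewrite -natrX ltr_nat ltn_expl.
exists s => //; split => // _ y yx.
have := yx i; have := cell_self (dirs s) Bx i; have := side_cell (dirs s) B x i.
rewrite count_dirs -/d /side => sc /andP[_ xc] /andP[cy _].
rewrite /half_space/=; apply: le_lt_trans cy.
rewrite /e in ds; lra.
Qed.

Lemma sat_box a b : measurable (box a b : set satT).
Proof.
rewrite box_half_spaces; apply: fin_bigcap_measurable => // i _.
by apply: measurableD; exact: sat_half_space.
Qed.

(** Dynkin's theorem: the sets whose trace on [B] is measurable with vanishing integral form a
    lambda-system, and it contains the pi-system [sat_dirs] by [sat_integral]. *)
Lemma sat_integral0 (A : set satT) : measurable A ->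
  measurable (A `&` boxp B : set T) /\
  (\int[leb]_(x in (A `&` boxp B : set T)) (f x)%:E = 0)%E.
Proof.
move=> mA.
have intS (S : set X) : measurable (S `&` boxp B : set T) ->
    intg leb (S `&` boxp B : set T) f.
  by move=> mS; apply: (integrableS mB mS _ fi) => x [].
have sat0 (S : set X) s : sat (dirs s) B (S `&` boxp B) ->
    measurable (S `&` boxp B : set T) /\
    (\int[leb]_(x in (S `&` boxp B : set T)) (f x)%:E = 0)%E.
  move=> sS; have mS := measurable_sat sS; split => //.
  rewrite Rintegral_EFin//; last exact: intS.
  rewrite (@sat_integral _ _ _ _ _ f (cst 0) sS fi).
  - by rewrite Rintegral_cst// mul0r.
  - exact: integrable0.
  - by move=> x Bx; rewrite f0// Rintegral_cst ?mul0r//; exact: measurable_boxp.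
apply: (@dynkin_induction _ satT sat_dirs (fun A : set X =>
  measurable (A `&` boxp B : set T) /\
  (\int[leb]_(x in (A `&` boxp B : set T)) (f x)%:E = 0)%E)) mA => //.
- exact: sat_dirsI.
- by apply: (sat0 _ 0%N); split => [x []//|x [_ Bx] y By].
- by move=> S [s sS]; exact: sat0 sS.
- move=> S _ [mS S0].
  have -> : ~` S `&` boxp B = boxp B `\` (S `&` boxp B).
    by rewrite setDIr setDv setU0 setDE setIC.
  have mD : measurable (boxp B `\` (S `&` boxp B) : set T) by exact: measurableD.
  split => //.
  have iD : intg leb (boxp B `\` (S `&` boxp B) : set T) f.
    by apply: (integrableS mB mD _ fi) => x [].
  have satB : sat (dirs 0) B (setT `&` boxp B).
    by rewrite setTI; split => [x //|x Bx y By].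
  have [_] := sat0 _ _ satB; rewrite setTI Rintegral_EFin// => -[fB].
  move: S0; rewrite !Rintegral_EFin//; last exact: intS.
  move=> -[S0]; congr EFin.
  have SB : S `&` boxp B `<=` boxp B by move=> x [].
  have dis : [disjoint S `&` boxp B & boxp B `\` (S `&` boxp B)].
    by apply/eqP; rewrite setDE setICA setICr setI0.
  have := @Rintegral_setU _ _ _ leb (S `&` boxp B) (boxp B `\` (S `&` boxp B)) f mS mD.
  by rewrite setDUK// fB S0 add0r => /(_ fi dis) <-.
- move=> F mF tF F0; rewrite setI_bigcupl.
  have mU : measurable (\bigcup_k (F k `&` boxp B) : set T).
    by apply: bigcupT_measurable => k; case: (F0 k).
  split => //.
  rewrite (@integral_bigcup _ _ _ leb (fun k => F k `&` boxp B) (EFin \o f)).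
  - by rewrite eseries0// => k _ _; case: (F0 k).
  - apply/trivIsetP => k l _ _ kl; apply/seteqP; split => // x [[Fk _] [Fl _]].
    by move/trivIsetP : tF => /(_ k l Logic.I Logic.I kl) <-; split.
  - by move=> k; case: (F0 k).
  - by apply: (integrableS mB mU _ fi) => x [k _ []].
Qed.

(** [A] lies in a countable intersection of unions of boxes with the same measure. [sat_integral0]
    applies to that hull, and the part of it in [B] outside [A] is null. *)
Lemma null_on_subsets (A : set T) : measurable A -> A `<=` boxp B ->
  \int[leb]_(x in A) f x = 0.
Proof.
move=> mA AB.
have leB := leb_boxp_lty B.
have leA : (leb_outer R N A < +oo)%E by exact: le_lt_trans (le_leb_outer AB) leB.
have [F [AF FA]] := leb_outer_approx leA.
set U := \bigcap_k _ in AF FA.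
have mobox (ab : option (X * X)) : measurable (obox ab : set satT).
  by case: ab => [[a b]|]; [exact: sat_box|exact: measurable0].
have mU : measurable (U : set satT).
  by apply: bigcapT_measurable => k; exact: bigcupT_measurable.
have [mUB UB0] := sat_integral0 mU.
have iUB : intg leb (U `&` boxp B : set T) f.
  by apply: (integrableS mB mUB _ fi) => x [].
have AUB : A `<=` U `&` boxp B by move=> x Ax; split; [exact: AF|exact: AB].
have mD : measurable ((U `&` boxp B) `\` A : set T) by exact: measurableD.
have D0 : leb ((U `&` boxp B) `\` A : set T) = 0%E.
  rewrite measureD//; last by apply: le_lt_trans leB; apply: le_measure => //;
    rewrite ?inE//; move=> x [].
  rewrite (setIidr AUB).
  have lE : leb_outer R N (U `&` boxp B) = leb_outer R N A.
    apply/eqP; rewrite eq_le [X in _ && X](le_leb_outer AUB) andbT.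
    by rewrite -FA; apply: le_leb_outer => x [].
  change (leb_outer R N (U `&` boxp B) - leb_outer R N A = 0)%E.
  by rewrite lE subee// ge0_fin_numE//; exact: leb_outer_ge0.
have UBE : \int[leb]_(x in (U `&` boxp B : set T)) f x = 0.
  by rewrite /Rintegral UB0.
have dis : [disjoint A & (U `&` boxp B) `\` A].
  by apply/eqP; rewrite setDE setICA setICr setI0.
have := @Rintegral_setU _ _ _ leb A ((U `&` boxp B) `\` A) f mA mD.
rewrite setDUK// UBE => /(_ iUB dis).
rewrite [X in _ + X](_ : _ = 0) ?addr0//.
have iD : intg leb ((U `&` boxp B) `\` A : set T) f.
  by apply: (integrableS mUB mD _ iUB) => x [].
by rewrite /Rintegral null_set_integral//; exact: measurable_int iD.
Qed.

(** The integral of [|f|] is read off from the set where [f] is positive and from its complement in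
    [B]; both contributions vanish. *)
Lemma cells_null : {ae leb, forall x : T, boxp B x -> f x = 0}.
Proof.
have mf : measurable_fun (boxp B : set T) f by exact: intg_meas fi.
pose P : set T := boxp B `&` f @^-1` `]0, +oo[%classic.
have mP : measurable P by exact: mf.
have PB : P `<=` boxp B by move=> x [].
have mQ : measurable (boxp B `\` P : set T) by exact: measurableD.
apply: Rintegral_norm_eq0 => //.
have dis : [disjoint P & boxp B `\` P].
  by apply/eqP; rewrite setDE setICA setICr setI0.
have := @Rintegral_setU _ _ _ leb P (boxp B `\` P) (fun x => `|f x|) mP mQ.
rewrite setDUK// => /(_ (intg_norm mB fi) dis) ->.
rewrite [X in X + _](_ : _ = \int[leb]_(x in P) f x); last first.
  apply: eq_Rintegral => x /set_mem[_]; rewrite /= in_itv/= andbT => /ltW fx0.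
  by rewrite ger0_norm.
rewrite [X in _ + X](_ : _ = \int[leb]_(x in boxp B `\` P) (-1 * f x)); last first.
  apply: eq_Rintegral => x /set_mem[Bx nP]; rewrite mulN1r ler0_norm// leNgt.
  by apply/negP => fx; apply: nP; split => //=; rewrite in_itv/= fx.
rewrite RintegralZl//; last by apply: (integrableS mB mQ _ fi) => x [].
rewrite !null_on_subsets//; first by rewrite mulr0 addr0.
Qed.

End null_cells.

(** * Poincare inequality and compactness *)

Section averages.
Context {R : realType} {N : nat}.
Notation X := 'rV[R]_N.
Notation T := (lebT R N).
Implicit Types (B : X * X) (i j : 'I_N) (js : seq 'I_N) (c : bool) (x y : X).
Implicit Types (w f H : X -> R).

Definition mu B : R := fine (leb (boxp B : set T)).

(* Division by zero gives [0], which is harmless on null boxes. *)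
Definition avg w B : R := (\int[leb]_(x in (boxp B : set T)) w x) / mu B.

(** The conditional expectation of [w] with respect to the partition of [B] into cells. *)
Definition avg_cell w js B x : R := avg w (cell js B x).

Lemma mu_half c j B : mu (half c j B) = mu (half true j B).
Proof. by case: c => //; rewrite /mu leb_halves. Qed.

Lemma mu_ge0 B : 0 <= mu B.
Proof. exact/fine_ge0/leb_outer_ge0. Qed.

Lemma leb_fin B : leb (boxp B : set T) \is a fin_num.
Proof. by rewrite ge0_fin_numE ?leb_boxp_lty//; exact: leb_outer_ge0. Qed.

Lemma mu_halves j B : mu B = 2 * mu (half true j B).
Proof.
rewrite /mu {1}(boxp_halves j B) measureU; last 3 first.
- exact: measurable_boxp.
- exact: measurable_boxp.
- by apply/eqP; exact: boxp_halves_disj.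
by rewrite fineD ?leb_fin// -/(mu _) -/(mu _) (mu_half false); ring.
Qed.

Lemma Rintegral_halves j B f : intg leb (boxp B : set T) f ->
  \int[leb]_(x in (boxp B : set T)) f x =
  \int[leb]_(x in (boxp (half true j B) : set T)) f x +
  \int[leb]_(x in (boxp (half false j B) : set T)) f x.
Proof.
move=> fi; rewrite {1}(boxp_halves j B) Rintegral_setU//.
- exact: measurable_boxp.
- exact: measurable_boxp.
- by rewrite -boxp_halves.
- exact: boxp_halves_disj.
Qed.

Lemma intg_half c j B f : intg leb (boxp B : set T) f ->
  intg leb (boxp (half c j B) : set T) f.
Proof.
apply: integrableS; [exact: measurable_boxp|exact: measurable_boxp|].
exact: boxp_half_sub.
Qed.

Lemma intg_halves j B f : intg leb (boxp (half true j B) : set T) f ->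
  intg leb (boxp (half false j B) : set T) f -> intg leb (boxp B : set T) f.
Proof.
move=> /integrableP[m1 i1] /integrableP[m2 i2].
have mh c : measurable (boxp (half c j B) : set T) by exact: measurable_boxp.
apply/integrableP; rewrite (boxp_halves j B).
have mU : measurable_fun (boxp (half true j B) `|` boxp (half false j B) : set T)
    (EFin \o f) by apply/measurable_funU.
split; first exact: mU.
have mU' : measurable_fun (boxp (half true j B) `|` boxp (half false j B) : set T)
    (fun x => `|(EFin \o f) x|)%E by exact: measurableT_comp.
have f0 (x : T) : (boxp (half true j B) `|` boxp (half false j B)) x ->
  (0 <= `|(EFin \o f) x|)%E by [].
rewrite (ge0_integral_setU leb (mh true) (mh false) mU' f0 (boxp_halves_disj j B)).
exact: lte_add_pinfty.
Qed.

Lemma avg_cell_half c j js B w : forall x, boxp (half c j B) x ->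
  avg_cell w (j :: js) B x = avg_cell w js (half c j B) x.
Proof. by move=> x /boxp_half[_ xc]; rewrite /avg_cell/= xc. Qed.

Lemma intg_avg_cell w js B : intg leb (boxp B : set T) (avg_cell w js B).
Proof.
elim: js B => [|j js IH] B.
  apply: (@intg_bounded _ _ _ _ _ _ `|avg w B|) => //.
  - exact: measurable_boxp.
  - exact: leb_boxp_lty.
  - by rewrite /avg_cell/=; exact: measurable_cst.
suff ih c : intg leb (boxp (half c j B) : set T) (avg_cell w (j :: js) B).
  exact: intg_halves (ih true) (ih false).
apply: eq_integrable (IH (half c j B)); first exact: measurable_boxp.
by move=> x /set_mem hx /=; rewrite (avg_cell_half _ _ hx).
Qed.

Lemma Rintegral_cst_boxp B (r : R) :
  \int[leb]_(x in (boxp B : set T)) r = r * mu B.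
Proof. by rewrite Rintegral_cst//; exact: measurable_boxp. Qed.

(** At a fixed depth there are finitely many cells, and the average over each of them tends to
    zero. *)
Lemma avg_cell_cvg0 (v : nat -> X -> R) js B :
  (forall Q : X * X, boxp Q `<=` boxp B ->
    \int[leb]_(y in (boxp Q : set T)) v n y @[n --> \oo] --> 0) ->
  \int[leb]_(x in (boxp B : set T)) `|avg_cell (v n) js B x| @[n --> \oo] --> 0.
Proof.
elim: js B => [|j js IH] B vB.
  have -> : (fun n => \int[leb]_(x in (boxp B : set T)) `|avg_cell (v n) [::] B x|)
      = (fun n => `|\int[leb]_(x in (boxp B : set T)) v n x| / mu B * mu B).
    apply/funext => n; rewrite [LHS](Rintegral_cst_boxp B `|avg (v n) B|).
    by rewrite /avg normrM normfV (ger0_norm (mu_ge0 B)).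
  have e0 : `|0 : R| / mu B * mu B = 0 by rewrite normr0 !mul0r.
  rewrite -[X in _ --> X]e0.
  by apply: cvgMl; apply: cvgMl; apply: cvg_norm; exact: vB.
have -> : (fun n => \int[leb]_(x in (boxp B : set T)) `|avg_cell (v n) (j :: js) B x|)
  = (fun n => \int[leb]_(x in (boxp (half true j B) : set T))
      `|avg_cell (v n) js (half true j B) x| +
    \int[leb]_(x in (boxp (half false j B) : set T))
      `|avg_cell (v n) js (half false j B) x|).
  apply/funext => n; rewrite (Rintegral_halves j); last first.
    by apply: intg_norm; [exact: measurable_boxp|exact: intg_avg_cell].
  have hE c : \int[leb]_(x in (boxp (half c j B) : set T))
        `|avg_cell (v n) (j :: js) B x| =
      \int[leb]_(x in (boxp (half c j B) : set T))
        `|avg_cell (v n) js (half c j B) x|.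
    by apply: eq_Rintegral => x /set_mem hx; rewrite (avg_cell_half _ _ hx).
  by rewrite (hE true) (hE false).
rewrite -[X in _ --> X]addr0; apply: cvgD; apply: IH => Q QB; apply: vB;
  exact: subset_trans QB (@boxp_half_sub _ _ _ _ _).
Qed.

End averages.

(** * The Poincare inequality on a box, by successive bisection *)

Section poincare.
Context {R : realType} {N : nat}.
Notation X := 'rV[R]_N.
Notation T := (lebT R N).
Implicit Types (B : X * X) (i j : 'I_N) (js : seq 'I_N) (c : bool) (x y : X).
Variables (B0 : X * X) (w H : X -> R).
Hypothesis wi : intg leb (boxp B0 : set T) w.
Hypothesis Hi : intg leb (boxp B0 : set T) H.
Hypothesis H0 : forall x, 0 <= H x.

(** Inclusion is expressed through the corners, which also keeps the sides nonnegative; inclusion of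
    sets would say nothing about the corners of an empty box. *)
Definition subbox B := forall i,
  [/\ B0.1 0 i <= B.1 0 i, B.1 0 i <= B.2 0 i & B.2 0 i <= B0.2 0 i].

(** Weak differentiability of [w] enters only through this estimate, which [weak_partial_halves]
    supplies when [H] dominates the partial derivatives. *)
Hypothesis half_diff : forall B j, subbox B ->
  `|\int[leb]_(x in (boxp (half true j B) : set T)) w x -
    \int[leb]_(x in (boxp (half false j B) : set T)) w x| <=
  side B j / 2 * \int[leb]_(x in (boxp B : set T)) H x.

Lemma subbox_half c j B : subbox B -> subbox (half c j B).
Proof.
move=> sB i; have [h1 h2 h3] := sB i.
by rewrite /half /mid; case: c; split => //=; rewrite updE;
  case: (i =P j) => [ij|//]; subst i; lra.
Qed.

Lemma subbox_sub B : subbox B -> boxp B `<=` boxp B0.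
Proof.
move=> sB x Bx i; have [h1 h2 h3] := sB i; have /andP[ax xb] := Bx i.
by rewrite (le_lt_trans h1 ax) (le_trans xb h3).
Qed.

Let intg_sub f B : subbox B -> intg leb (boxp B0 : set T) f ->
  intg leb (boxp B : set T) f.
Proof.
move=> sB; apply: integrableS; [exact: measurable_boxp|exact: measurable_boxp|].
exact: subbox_sub.
Qed.

Definition IH B := \int[leb]_(x in (boxp B : set T)) H x.

Lemma IH_ge0 B : 0 <= IH B.
Proof. by apply: Rintegral_ge0 => x _. Qed.

Lemma IH_halves j B : subbox B ->
  IH B = IH (half true j B) + IH (half false j B).
Proof. by move=> sB; rewrite /IH (Rintegral_halves j)//; exact: intg_sub. Qed.

Lemma side_ge0 B j : subbox B -> 0 <= side B j.
Proof. by move=> /(_ j)[_]; rewrite subr_ge0. Qed.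

(** The halves have the same measure [m], so [m] times the deviation of the average over a half from
    the average over [B] is half the difference of the integrals over the two halves. *)
Lemma avg_half_diff c j B : subbox B ->
  mu (half c j B) * `|avg w (half c j B) - avg w B| <= side B j / 4 * IH B.
Proof.
move=> sB; have := half_diff j sB; rewrite -/(IH B).
rewrite /avg (Rintegral_halves j (intg_sub sB wi)) (mu_half c) (mu_halves j B).
set m := mu _; set I1 := \int[leb]_(x in boxp (half true j B)) w x.
set I2 := \int[leb]_(x in boxp (half false j B)) w x.
move=> h; have m0 : 0 <= m by exact: mu_ge0.
have [->|mn0] := eqVneq m 0.
  rewrite mul0r; apply: mulr_ge0; last exact: IH_ge0.
  by rewrite divr_ge0 ?side_ge0.
have -> : m * `|(\int[leb]_(x in (boxp (half c j B) : set T)) w x) / m -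
    (I1 + I2) / (2 * m)| = `|I1 - I2| / 2.
  rewrite -{1}(ger0_norm m0) -normrM.
  case: c; rewrite -/I1 -/I2.
    have -> : m * (I1 / m - (I1 + I2) / (2 * m)) = (I1 - I2) / 2 by field.
    by rewrite normrM (ger0_norm (_ : 0 <= 2^-1)).
  have -> : m * (I2 / m - (I1 + I2) / (2 * m)) = - ((I1 - I2) / 2) by field.
  by rewrite normrN normrM (ger0_norm (_ : 0 <= 2^-1)).
by lra.
Qed.

(** The sum of the side lengths of a cell at depth [js], which is the same for all cells of that
    depth. *)
Definition sides js B : R := \sum_i side B i / 2 ^+ count_mem i js.

Lemma sides_half c j js B : sides js (half c j B) = sides (j :: js) B.
Proof.
apply: eq_bigr => i _; rewrite side_half /= exprD [j == i]eq_sym.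
by case: (i == j); rewrite ?expr1 ?expr0 ?mul1r ?divr1// invfM mulrA.
Qed.

Lemma sides_cons_nil j B : sides [:: j] B = sides [::] B - side B j / 2.
Proof.
have -> : side B j / 2 = \sum_(i | i == j) side B i / 2 by rewrite big_pred1_eq.
rewrite big_mkcond /sides -sumrB; apply: eq_bigr => i _.
rewrite /= addn0 [j == i]eq_sym; case: (i == j).
  by rewrite expr1 expr0; lra.
by rewrite expr0 subr0.
Qed.

Lemma sides_ge0 js B : subbox B -> 0 <= sides js B.
Proof.
by move=> sB; apply: sumr_ge0 => i _; rewrite divr_ge0 ?side_ge0// exprn_ge0.
Qed.

(* The side lost at each bisection pays for the change of the averages. *)
Lemma avg_cell_dev js B : subbox B ->
  \int[leb]_(x in (boxp B : set T)) `|avg_cell w js B x - avg w B| <=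
  sides [::] B * IH B.
Proof.
elim: js B => [|j js IHjs] B sB.
  under eq_Rintegral do rewrite /avg_cell/= subrr normr0.
  by rewrite Rintegral_cst_boxp mul0r mulr_ge0 ?sides_ge0 ?IH_ge0.
have mbx Q : measurable (boxp Q : set T) by exact: measurable_boxp.
have ic Q (r : R) : intg leb (boxp Q : set T) (cst r).
  apply: (@intg_bounded _ _ _ _ _ _ `|r|) => //; exact: leb_boxp_lty.
have iE Q : intg leb (boxp Q : set T) (fun x => `|avg_cell w js Q x - avg w Q|).
  exact: (intg_norm (mbx _) (intgB (mbx _) (intg_avg_cell _ _ _) (ic _ _))).
have iEB : intg leb (boxp B : set T) (fun x => `|avg_cell w (j :: js) B x - avg w B|).
  exact: (intg_norm (mbx _) (intgB (mbx _) (intg_avg_cell _ _ _) (ic _ _))).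
rewrite (Rintegral_halves j iEB).
have hc c : \int[leb]_(x in (boxp (half c j B) : set T))
      `|avg_cell w (j :: js) B x - avg w B| <=
    sides [:: j] B * IH (half c j B) + side B j / 4 * IH B.
  apply: (@le_trans _ _ (\int[leb]_(x in (boxp (half c j B) : set T))
     (`|avg_cell w js (half c j B) x - avg w (half c j B)| +
      `|avg w (half c j B) - avg w B|))).
    apply: le_Rintegral => //.
    - exact: intg_half iEB.
    - exact: (intgD (mbx _) (iE _) (ic _ _)).
    - move=> x hx; rewrite (avg_cell_half _ _ hx).
      exact: ler_distD.
  rewrite (RintegralD (mbx _) (iE _) (ic _ _)).
  rewrite Rintegral_cst_boxp [X in _ + X <= _]mulrC; apply: lerD.
    by rewrite -(sides_half c); apply: IHjs; exact: subbox_half.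
  exact: avg_half_diff.
apply: le_trans (lerD (hc true) (hc false)) _.
(* The errors [side B j / 4] from the two halves add up to exactly [side B j / 2], the amount by
   which [sides] has decreased. *)
rewrite sides_cons_nil (IH_halves j sB).
by lra.
Qed.

(** The bound of [avg_cell_dev] inside each cell at depth [js], whose sides have already shrunk. *)
Lemma avg_cell_cat_dev js js' B : subbox B ->
  \int[leb]_(x in (boxp B : set T))
    `|avg_cell w (js ++ js') B x - avg_cell w js B x| <= sides js B * IH B.
Proof.
elim: js B => [|j js IHjs] B sB; first exact: avg_cell_dev.
rewrite (Rintegral_halves j); last first.
  apply: intg_norm; first exact: measurable_boxp.
  by apply: intgB; [exact: measurable_boxp|exact: intg_avg_cell..].
have hc c : \int[leb]_(x in (boxp (half c j B) : set T))
      `|avg_cell w ((j :: js) ++ js') B x - avg_cell w (j :: js) B x| <=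
    sides (j :: js) B * IH (half c j B).
  rewrite -(sides_half c); apply: le_trans (IHjs _ (subbox_half c j sB)).
  rewrite le_eqVlt; apply/orP; left; apply/eqP; apply: eq_Rintegral => x /set_mem hx.
  by rewrite cat_cons !(avg_cell_half _ _ hx).
by rewrite (IH_halves j sB) mulrDr lerD.
Qed.

Hypothesis sB0 : forall i, B0.1 0 i <= B0.2 0 i.

Let mB0 : measurable (boxp B0 : set T) := measurable_boxp B0.

Lemma sides_dirs s : sides (dirs s) B0 = sides [::] B0 / 2 ^+ s.
Proof.
rewrite /sides mulr_suml; apply: eq_bigr => i _.
by rewrite count_dirs/= expr0 divr1.
Qed.

Lemma Rintegral_avg_cell B : intg leb (boxp B : set T) w ->
  \int[leb]_(x in (boxp B : set T)) avg w B = \int[leb]_(x in (boxp B : set T)) w x.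
Proof.
move=> iw; rewrite Rintegral_cst_boxp /avg.
have [m0|mn0] := eqVneq (mu B) 0; last by rewrite divfK.
rewrite m0 mulr0 /Rintegral null_set_integral//.
- exact: measurable_boxp.
- exact: measurable_int iw.
- by transitivity (mu B)%:E; [exact: esym (fineK (leb_fin B))|rewrite m0].
Qed.

Lemma sat_cell s t x : sat (dirs (s + t)) B0 (boxp (cell (dirs s) B0 x)).
Proof.
rewrite dirsD; apply: sat_cat; split; first exact: cell_sub.
by move=> y yx z; rewrite (cell_eq yx).
Qed.

Let E s x := avg_cell w (dirs s) B0 x.

Lemma Rintegral_cell s t x :
  \int[leb]_(y in (boxp (cell (dirs s) B0 x) : set T)) E (s + t) y =
  \int[leb]_(y in (boxp (cell (dirs s) B0 x) : set T)) w y.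
Proof.
apply: (sat_integral (sat_cell s t x) (intg_avg_cell _ _ _) wi) => z Bz.
rewrite -Rintegral_avg_cell; last first.
  apply: integrableS mB0 (measurable_boxp _) _ wi; exact: cell_sub.
by apply: eq_Rintegral => y /set_mem yz; rewrite /avg_cell (cell_eq yz).
Qed.

Lemma avg_cell_step s t :
  \int[leb]_(x in (boxp B0 : set T)) `|E (s + t) x - E s x| <=
  sides [::] B0 * IH B0 / 2 ^+ s.
Proof.
apply: le_trans (_ : _ <= sides (dirs s) B0 * IH B0) _.
  by rewrite /E dirsD; exact: avg_cell_cat_dev.
by rewrite sides_dirs mulrAC.
Qed.

(** The conditional expectations are rapidly Cauchy in L^1 by [avg_cell_step]. Their limit [g] has
    the same integral as [w] on every cell, hence equals [w] almost everywhere by [cells_null]. The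
    estimate between depths [s] and [k] then passes to the limit in [k]. *)
Lemma poincare s :
  \int[leb]_(x in (boxp B0 : set T)) `|w x - E s x| <=
  sides [::] B0 * IH B0 / 2 ^+ s.
Proof.
have iE t : intg leb (boxp B0 : set T) (E t) by exact: intg_avg_cell.
have C0 : 0 <= sides [::] B0 * IH B0 by rewrite mulr_ge0 ?sides_ge0 ?IH_ge0.
have iEE t t' : intg leb (boxp B0 : set T) (fun x => `|E t x - E t' x|).
  by apply: intg_norm => //; exact: intgB.
have [|g [gi _ Eg]] := L1_complete mB0 iE.
  apply: (geometric_lty C0) => [k|k].
    by apply: integral_ge0 => x _; rewrite lee_fin.
  rewrite Rintegral_EFin// lee_fin.
  by have := avg_cell_step k 1; rewrite (addn1 k).
have iEg t : intg leb (boxp B0 : set T) (fun x => `|E t x - g x|).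
  by apply: intg_norm => //; exact: intgB.
have cellsE t x : boxp B0 x ->
    \int[leb]_(y in (boxp (cell (dirs t) B0 x) : set T)) (g y - w y) = 0.
  move=> B0x; set Q := boxp _.
  have mQ : measurable (Q : set T) by exact: measurable_boxp.
  have QB : Q `<=` boxp B0 by exact: cell_sub.
  have iQ h : intg leb (boxp B0 : set T) h -> intg leb (Q : set T) h.
    by move=> hi; exact: integrableS mB0 mQ QB hi.
  apply/eqP; rewrite -normr_le0.
  apply: (ler_cvg_to (cvg_cst _) Eg); near=> k.
  have tk : (t <= k)%N by near: k; exact: nbhs_infty_ge.
  have -> : \int[leb]_(y in (Q : set T)) (g y - w y) =
            \int[leb]_(y in (Q : set T)) (g y - E k y).
    rewrite !RintegralB//; try exact: iQ.
    by congr (_ - _); rewrite -(subnKC tk) Rintegral_cell.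
  apply: le_trans (le_normr_Rintegral mQ _) _.
    by apply: intgB => //; exact: iQ.
  under eq_Rintegral do rewrite distrC.
  by apply: Rintegral_subset_le => //.
have gw := cells_null (intgB mB0 gi wi) cellsE.
have iwg : intg leb (boxp B0 : set T) (fun x => w x - g x) by exact: intgB.
have wg0 : \int[leb]_(x in (boxp B0 : set T)) `|w x - g x| = 0.
  apply: Rintegral_norm_ae0 => //; apply: filterS gw => x gwx /gwx/eqP.
  by rewrite subr_eq0 => /eqP ->; rewrite subrr.
have lim : sides [::] B0 * IH B0 / 2 ^+ s +
    \int[leb]_(x in (boxp B0 : set T)) `|E k x - g x| @[k --> \oo] -->
    sides [::] B0 * IH B0 / 2 ^+ s.
  by rewrite -[X in _ --> X]addr0; apply: cvgD => //; exact: cvg_cst.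
apply: (ler_cvg_to (cvg_cst _) lim).
near=> k.
have sk : (s <= k)%N by near: k; exact: nbhs_infty_ge.
apply: (@le_trans _ _ (\int[leb]_(x in (boxp B0 : set T))
  (`|w x - g x| + (`|E k x - E s x| + `|E k x - g x|)))).
  apply: le_Rintegral => //.
  - by apply: intg_norm => //; exact: intgB.
  - apply: intgD => //; first exact: intg_norm.
    exact: intgD.
  - move=> x _; apply: le_trans (ler_distD (g x) _ _) _; rewrite lerD2l.
    by rewrite [leRHS]addrC (distrC (E k x) (g x)); exact: ler_distD.
rewrite !RintegralD//; [|exact: intg_norm|exact: intgD].
by rewrite wg0 add0r lerD2r -(subnKC sk); exact: avg_cell_step.
Unshelve. all: by end_near. Qed.

End poincare.

(* Equi-small oscillation on cells plus convergence of the averages. *)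
Lemma rellich {R : realType} {N : nat} (B : 'rV[R]_N * 'rV[R]_N)
    (v H : nat -> 'rV[R]_N -> R) (C : R) :
  (forall i, B.1 0 i <= B.2 0 i) ->
  (forall n, intg leb (boxp B : set (lebT R N)) (v n)) ->
  (forall n, intg leb (boxp B : set (lebT R N)) (H n)) ->
  (forall n x, 0 <= H n x) ->
  (forall n, \int[leb]_(x in (boxp B : set (lebT R N))) H n x <= C) ->
  (forall n Q j, subbox B Q ->
    `|\int[leb]_(x in (boxp (half true j Q) : set (lebT R N))) v n x -
      \int[leb]_(x in (boxp (half false j Q) : set (lebT R N))) v n x| <=
    side Q j / 2 * \int[leb]_(x in (boxp Q : set (lebT R N))) H n x) ->
  (forall Q : 'rV[R]_N * 'rV[R]_N, boxp Q `<=` boxp B ->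
    \int[leb]_(y in (boxp Q : set (lebT R N))) v n y @[n --> \oo] --> 0) ->
  \int[leb]_(x in (boxp B : set (lebT R N))) `|v n x| @[n --> \oo] --> 0.
Proof.
move=> sB vi Hi H0 HC hd vQ.
have mB : measurable (boxp B : set (lebT R N)) by exact: measurable_boxp.
have sBB : subbox B B by move=> i; split.
have C0 : 0 <= C by apply: le_trans (HC 0%N); exact: Rintegral_ge0.
pose S := sides [::] B * C; have S0 : 0 <= S by rewrite mulr_ge0// (sides_ge0 _ sBB).
apply/cvgr0Pnorm_le => e e0.
(* A depth independent of [n] at which the Poincare error is at most [e / 2], because [2^s] exceeds
   [s]. *)
pose s := (Num.trunc (S / (e / 2))).+1.
have Se : S / 2 ^+ s <= e / 2.
  rewrite ler_pdivrMr ?exprn_gt0// mulrC -ler_pdivrMr ?divr_gt0//.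
  apply/ltW; apply: lt_trans (truncnS_gt _) _.
  by rewrite -natrX ltr_nat ltn_expl.
have := avg_cell_cvg0 (dirs s) vQ => /cvgr0Pnorm_le/(_ (e / 2)).
rewrite divr_gt0// => /(_ isT); apply: filterS => n.
rewrite !ger0_norm; [|exact: Rintegral_ge0..] => En.
have iE : intg leb (boxp B : set (lebT R N)) (avg_cell (v n) (dirs s) B).
  exact: intg_avg_cell.
apply: (@le_trans _ _ (\int[leb]_(x in (boxp B : set (lebT R N)))
  (`|v n x - avg_cell (v n) (dirs s) B x| + `|avg_cell (v n) (dirs s) B x|))).
  apply: le_Rintegral => //; first exact: intg_norm.
    by apply: intgD => //; apply: intg_norm => //; exact: intgB.
  by move=> x _; rewrite -[X in `|X| <= _](subrK (avg_cell (v n) (dirs s) B x)) ler_normD.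
rewrite RintegralD//; [|by apply: intg_norm => //; exact: intgB|exact: intg_norm].
have := poincare (vi n) (Hi n) (H0 n) (hd n) sB s => P.
have : sides [::] B * IH (H n) B / 2 ^+ s <= S / 2 ^+ s.
  rewrite ler_pM2r ?invr_gt0 ?exprn_gt0// /S; apply: ler_wpM2l; last exact: HC.
  exact: (sides_ge0 _ sBB).
lra.
Qed.

Lemma ae_countable d (T : measurableType d) (R : realType)
    (mu : {measure set T -> \bar R}) (I : countType) (A : I -> set T) (P : set T) :
  (forall i, {ae mu, forall x, A i x -> P x}) ->
  {ae mu, forall x, (exists i, A i x) -> P x}.
Proof.
move=> aeA.
have : mu.-negligible (\bigcup_n (if @unpickle I n is Some i
    then ~` [set x | A i x -> P x] else set0)).
  apply: negligible_bigcup => n.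
  by case: unpickle => [i|]; [exact: aeA|exact: negligible_set0].
apply: negligibleS => x /= /not_implyP[[i Ai] nP]; exists (pickle i) => //.
by rewrite pickleK; apply: contra_not nP; apply.
Qed.

(** * Weak derivatives *)

Section test_functions.
Context {R : realType} {N : nat}.
Notation X := 'rV[R]_N.
Notation T := (lebT R N).
Variable Om : set X.
Implicit Types (g w h : X -> R) (j : 'I_N).

Lemma test_partial g j : test_fun Om g -> test_fun Om (partial j g).
Proof.
move=> [sg [cg gOm]].
have sub : closure [set x | partial j g x != 0] `<=` closure [set x | g x != 0].
  rewrite closureE; apply: smallest_sub; first exact: closed_closure.
  move=> x /= px; apply: contrapT => nx.
  have ox : nbhs x (~` closure [set x | g x != 0]).
    by apply: open_nbhs_nbhs; split => //; exact/closed_openC/closed_closure.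
  suff : 'D_(delta_mx 0 j) g x = 0 by move/eqP; apply/negP.
  rewrite -(@derive_cst R X R (0 : R) x (delta_mx 0 j)).
  apply: near_eq_derive; apply: filterS ox => y ny.
  by apply: contrapT => /eqP gy; apply: ny; exact: subset_closure.
split.
  by move=> s; have := sg (rcons s j); rewrite foldr_rcons.
split; last exact: subset_trans sub gOm.
have cp := @closed_closure _ [set x : X | partial j g x != 0].
exact: (subclosed_compact cp cg).
Qed.

Lemma test_continuous g : test_fun Om g -> continuous g.
Proof. by move=> [/(_ [::])[]]. Qed.

Lemma test_bounded g : test_fun Om g -> exists C, forall x, `|g x| <= C.
Proof.
move=> tg; have cg := test_continuous tg; have [_ [cs _]] := tg.
have cgs : {within closure [set x | g x != 0], continuous g}.
  exact: continuous_subspaceT.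
have /compact_bounded[M [_ gM]] := continuous_compact cgs cs.
exists (`|M| + 1) => x.
have M0 : 0 <= `|M| + 1 by rewrite addr_ge0.
have [->|gx] := eqVneq (g x) 0; first by rewrite normr0.
apply: gM; first by rewrite ltr_pwDr// ler_norm.
by exists x => //; exact: subset_closure.
Qed.

Lemma test_intgM g w (D : set T) : measurable D -> intg leb D w ->
  test_fun Om g -> intg leb D (fun x => w x * g x).
Proof.
move=> mD wi tg; have [C gC] := test_bounded tg.
apply: (intgMb (C := C) mD wi _ (fun x _ => gC x)).
exact/continuous_measurable_leb/test_continuous.
Qed.

Hypothesis oOm : open Om.
Let mOm : measurable (Om : set T) := measurable_open oOm.

(** The integration by parts of [weak_gradient] with real-valued integrals, so that linear
    combinations raise no infinities; [wpartE] translates between both forms for integrable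
    functions. *)
Definition wpart j w h := forall g, test_fun Om g ->
  \int[leb]_(x in (Om : set T)) (w x * partial j g x) =
  - \int[leb]_(x in (Om : set T)) (h x * g x).

Lemma wpartE j w h : intg leb (Om : set T) w -> intg leb (Om : set T) h ->
  wpart j w h <-> forall g, test_fun Om g ->
  (\int[leb]_(x in (Om : set T)) (w x * partial j g x)%:E =
    - \int[leb]_(x in (Om : set T)) (h x * g x)%:E)%E.
Proof.
move=> wi hi; split=> wh g tg; have := wh g tg.
  rewrite !Rintegral_EFin//; [by move=> ->|exact: test_intgM|].
  by apply: test_intgM => //; exact: test_partial.
rewrite !Rintegral_EFin//; [by move=> -[]|exact: test_intgM|].
by apply: test_intgM => //; exact: test_partial.
Qed.

Lemma wpart_lin j w h w' h' k : intg leb (Om : set T) w ->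
  intg leb (Om : set T) h -> intg leb (Om : set T) w' ->
  intg leb (Om : set T) h' -> wpart j w h -> wpart j w' h' ->
  wpart j (fun x => w x + k * w' x) (fun x => h x + k * h' x).
Proof.
move=> wi hi wi' hi' wh wh' g tg.
have lin a b t : intg leb (Om : set T) a -> intg leb (Om : set T) b ->
    test_fun Om t -> \int[leb]_(x in (Om : set T)) ((a x + k * b x) * t x) =
    \int[leb]_(x in (Om : set T)) (a x * t x) +
    k * \int[leb]_(x in (Om : set T)) (b x * t x).
  move=> ai bi tt.
  have iat := test_intgM mOm ai tt; have ibt := test_intgM mOm bi tt.
  rewrite -(RintegralZl k mOm ibt) -(RintegralD mOm iat (intgZ k mOm ibt)).
  by apply: eq_Rintegral => x _; ring.
have tp := test_partial j tg.
rewrite (lin w w' (partial j g) wi wi' tp) (lin h h' g hi hi' tg).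
by rewrite (wh g tg) (wh' g tg); ring.
Qed.

(** The enlarged closed box in [Om] houses the supports of the test functions that approximate the
    indicator of [B]. *)
Definition room (B : X * X) (e : R) :=
  0 < e /\ cbox B.1 (vshift B.2 e) `<=` Om.

Lemma room_sub B e Q : room B e -> subbox B Q -> room Q e.
Proof.
move=> [e0 BOm] sQ; split => //; apply: subset_trans BOm.
by apply: le_cbox => i; have [h1 h2 h3] := sQ i; rewrite // !mxE lerD2r.
Qed.

Lemma room_box B e : room B e -> boxp B `<=` Om.
Proof.
by move=> [e0 BOm] x /box_cbox Bx; apply/BOm/cbox_vshift => //; exact: ltW.
Qed.

Definition ratbox (q : 'rV[rat]_N * 'rV[rat]_N * nat) : X * X :=
  (ratv q.1.1, ratv q.1.2).

(** [Om] is the union of countably many rational boxes with room around them, so almost everywhere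
    statements are local. Empty boxes are discarded, which puts the corners in order. *)
Lemma ae_boxes (P : set X) :
  (forall q, room (ratbox q) q.2.+1%:R^-1 ->
    (forall i, (ratbox q).1 0 i <= (ratbox q).2 0 i) ->
    {ae leb, forall x : T, boxp (ratbox q) x -> P x}) ->
  {ae leb, forall x : T, Om x -> P x}.
Proof.
move=> aeP.
pose A q : set T := if `[< room (ratbox q) q.2.+1%:R^-1 >]
  then boxp (ratbox q) else set0.
have aeA q : {ae leb, forall x : T, A q x -> P x}.
  rewrite /A; case: asboolP => [rq|_]; last by apply: aeW => x [].
  have [B0|/set0P[x Bx]] := eqVneq (boxp (ratbox q)) set0.
    by apply: aeW => x; rewrite B0.
  apply: aeP rq _ => i; have /andP[ax xb] := Bx i.
  by rewrite (le_trans (ltW ax)).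
apply: filterS (ae_countable aeA) => x Px; rewrite [Om]open_bigcup_box//.
move=> [q qOm qx]; apply: Px; exists q; rewrite /A; case: asboolP => // -[].
by split => //.
Qed.

(** The fundamental lemma of the calculus of variations: [test_eq_box] shows that the difference has
    zero integral on every cell of a rational box, and [cells_null] concludes. *)
Lemma weak_unique h1 h2 : L1loc Om h1 -> L1loc Om h2 ->
  (forall g, test_fun Om g -> \int[leb]_(x in (Om : set T)) (h1 x * g x)%:E =
    \int[leb]_(x in (Om : set T)) (h2 x * g x)%:E)%E ->
  {ae leb, forall x : T, Om x -> h1 x = h2 x}.
Proof.
move=> [_ i1] [_ i2] h12; apply: ae_boxes => q rB sB.
set B := ratbox q in rB sB *; set e := q.2.+1%:R^-1 in rB.
have mB := measurable_boxp B.
have iK h Q : (forall K, K `<=` Om -> compact K ->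
    intg leb (K : set T) h) -> room Q e ->
    intg leb (cbox Q.1 (vshift Q.2 e) : set T) h.
  by move=> ih [_ QOm]; apply: ih => //; exact: compact_cbox.
have iB h Q : (forall K, K `<=` Om -> compact K ->
    intg leb (K : set T) h) -> room Q e -> intg leb (boxp Q : set T) h.
  move=> ih rQ; have ik := iK h Q ih rQ.
  apply: (integrableS (measurable_cbox _ _) (measurable_boxp Q) _ ik).
  by apply: box_room; have [] := rQ.
have sBB : subbox B B by move=> i; split.
have cellsub s x : subbox B (cell s B x).
  suff H Q : subbox B Q -> subbox B (cell s Q x) by exact: H.
  elim: s Q => //= j s IH Q sQ; apply: IH; exact: subbox_half.
have cells0 s x : boxp B x ->
    \int[leb]_(y in (boxp (cell (dirs s) B x) : set T)) (h1 y - h2 y) = 0.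
  move=> _; set Q := cell _ _ _; have rQ : room Q e := room_sub rB (cellsub _ _).
  have mQ := measurable_boxp Q.
  rewrite (RintegralB mQ (iB _ _ i1 rQ) (iB _ _ i2 rQ)).
  have [e0 QOm] := rQ.
  by rewrite /boxp (test_eq_box mOm e0 QOm (iK _ _ i1 rQ) (iK _ _ i2 rQ) h12) subrr.
have := cells_null (intgB mB (iB _ _ i1 rB) (iB _ _ i2 rB)) cells0.
by apply: filterS => x hx /hx/eqP; rewrite subr_eq0 => /eqP.
Qed.

(** The dominating function [H] adds the moduli of all partial derivatives, so that it serves for
    bisections in every direction. *)
Lemma rellich_weak (v : nat -> X -> R) (h : nat -> 'I_N -> X -> R) C B e :
  room B e -> (forall i, B.1 0 i <= B.2 0 i) ->
  (forall n, intg leb (Om : set T) (v n)) ->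
  (forall n j, intg leb (Om : set T) (h n j)) ->
  (forall n j, wpart j (v n) (h n j)) ->
  (forall n j, \int[leb]_(x in (Om : set T)) `|h n j x| <= C) ->
  (forall Q : X * X, boxp Q `<=` Om ->
    \int[leb]_(x in (boxp Q : set T)) v n x @[n --> \oo] --> 0) ->
  \int[leb]_(x in (boxp B : set T)) `|v n x| @[n --> \oo] --> 0.
Proof.
move=> rB sB vi hi wh hC vQ.
have mB := measurable_boxp B; have BOm := room_box rB.
have iS f (D : set T) : measurable D -> D `<=` Om -> intg leb (Om : set T) f ->
    intg leb D f.
  by move=> mD DO fi; exact: (integrableS mOm mD DO fi).
have iHs n j : intg leb (boxp B : set T) (fun x => `|h n j x|).
  exact: (intg_norm mB (iS _ _ mB BOm (hi n j))).
pose H n x := \sum_j `|h n j x|.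
have iH n : intg leb (boxp B : set T) (H n) by exact: intg_sum.
apply: (@rellich _ _ B v H (\sum_(j < N) C) sB) => //.
- by move=> n; exact: iS.
- by move=> n x; exact: sumr_ge0.
- move=> n; rewrite Rintegral_sum//; apply: ler_sum => j _.
  apply: le_trans (hC n j); apply: Rintegral_subset_le => //.
  exact: intg_norm.
- move=> n Q j sQ; have [e0 QOm] := room_sub rB sQ.
  have mQ := measurable_boxp Q.
  have QB : boxp Q `<=` boxp B by exact: subbox_sub.
  have [_ aQ _] := sQ j.
  have am : Q.1 0 j <= mid Q j by rewrite /mid; lra.
  have amb : mid Q j - Q.1 0 j = Q.2 0 j - mid Q j by rewrite /mid; lra.
  have mK := measurable_cbox Q.1 (vshift Q.2 e).
  have := weak_partial_halves mOm e0 QOm am amb (iS _ _ mK QOm (vi n))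
    (iS _ _ mK QOm (hi n j)) (proj1 (wpartE j (vi n) (hi n j)) (wh n j)).
  move=> /le_trans; apply.
  have -> : mid Q j - Q.1 0 j = side Q j / 2 by rewrite /mid /side; lra.
  apply: ler_wpM2l; first by rewrite divr_ge0// subr_ge0.
  have iHQ f : intg leb (boxp B : set T) f -> intg leb (boxp Q : set T) f.
    by move=> fi; exact: (integrableS mB mQ QB fi).
  apply: le_Rintegral => //; [exact: (iHQ _ (iHs n j))|exact: iHQ|].
  by move=> x _; rewrite /H (bigD1 j)//= lerDl sumr_ge0.
- by move=> Q QB; apply: vQ; exact: subset_trans QB BOm.
Qed.

End test_functions.

(** * Convex combinations of the gradients *)

Section hull.
Context {R : realType} {N d : nat}.
Notation X := 'rV[R]_N.
Notation T := (lebT R N).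
Notation pairT := ((X -> 'rV[R]_d) * (X -> 'M[R]_(d, N)))%type.
Variables (Om : set X) (un : nat -> X -> 'rV[R]_d) (Gn : nat -> X -> 'M[R]_(d, N)).
Hypothesis oOm : open Om.
Hypothesis Omoo : (leb (Om : set T) < +oo)%E.
Let mOm : measurable (Om : set T) := measurable_open oOm.
Implicit Types (p q : pairT) (x : X) (i : 'I_d) (j : 'I_N).

Definition sqn m n (A : 'M[R]_(m, n)) : R := \sum_i \sum_j A i j ^+ 2.

Lemma enorm_sqr m n (A : 'M[R]_(m, n)) : enorm A ^+ 2 = sqn A.
Proof.
by rewrite sqr_sqrtr// sumr_ge0// => i _; rewrite sumr_ge0// => j _; exact: sqr_ge0.
Qed.

Lemma sqn_ge0 m n (A : 'M[R]_(m, n)) : 0 <= sqn A.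
Proof. by rewrite -enorm_sqr sqr_ge0. Qed.

Lemma sqn_entry m n (A : 'M[R]_(m, n)) k l : A k l ^+ 2 <= sqn A.
Proof.
rewrite /sqn (bigD1 k)//= (bigD1 l)//= -addrA lerDl addr_ge0//.
  by apply: sumr_ge0 => ? _; exact: sqr_ge0.
by apply: sumr_ge0 => ? _; apply: sumr_ge0 => ? _; exact: sqr_ge0.
Qed.

(** Functions and gradients are combined with the same weights, so that the second component remains
    a weak gradient of the first. *)
Definition midp p q : pairT :=
  (fun x => 2^-1 *: (p.1 x + q.1 x), fun x => 2^-1 *: (p.2 x + q.2 x)).

Lemma parallelogram m n (A B : 'M[R]_(m, n)) :
  sqn (A - B) = 2 * sqn A + 2 * sqn B - 4 * sqn (2^-1 *: (A + B)).
Proof.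
rewrite /sqn !mulr_sumr -big_split/= -sumrB; apply: eq_bigr => i _.
rewrite !mulr_sumr -big_split/= -sumrB; apply: eq_bigr => j _.
by rewrite !mxE; field.
Qed.

(* Dyadic convex combinations suffice for the parallelogram argument. *)
Inductive hull (k : nat) : pairT -> Prop :=
| hull_pt n : (k <= n)%N -> hull k (un n, Gn n)
| hull_mid p q : hull k p -> hull k q -> hull k (midp p q).

Lemma hull_le k l p : (k <= l)%N -> hull l p -> hull k p.
Proof.
move=> kl; elim=> [n ln|{}p q _ hp _ hq]; last exact: hull_mid.
by apply: hull_pt; exact: leq_trans ln.
Qed.

(** The weights do not depend on the point, so at each [x] the combined gradient arises from the
    values [Gn n x] by midpoints alone. *)
Lemma hull_convex k p x (C : set 'M[R]_(d, N)) : hull k p ->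
  (forall n, (k <= n)%N -> C (Gn n x)) ->
  (forall A B, C A -> C B -> C (2^-1 *: (A + B))) -> C (p.2 x).
Proof.
by move=> hp CG Cmid; elim: hp => [n kn|{}p q _ Cp _ Cq] /=; [exact: CG|exact: Cmid].
Qed.

Record good p : Prop := {
  good_u : forall i, intg leb (Om : set T) (fun x => p.1 x 0 i) ;
  good_G : forall i j, intg leb (Om : set T) (fun x => p.2 x i j) ;
  good_sqn : intg leb (Om : set T) (fun x => sqn (p.2 x)) ;
  good_weak : forall i j, wpart Om j (fun x => p.1 x 0 i) (fun x => p.2 x i j) }.

Hypothesis goodn : forall n, good (un n, Gn n).

Lemma good_mid p q : good p -> good q -> good (midp p q).
Proof.
move=> gp gq.
have e1 i : (fun x => (midp p q).1 x 0 i) =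
    (fun x => 2^-1 * p.1 x 0 i + 2^-1 * q.1 x 0 i).
  by apply/funext => x; rewrite !mxE mulrDr.
have e2 i j : (fun x => (midp p q).2 x i j) =
    (fun x => 2^-1 * p.2 x i j + 2^-1 * q.2 x i j).
  by apply/funext => x; rewrite !mxE mulrDr.
have i1 i : intg leb (Om : set T) (fun x => (midp p q).1 x 0 i).
  by rewrite e1; exact: (intgD mOm (intgZ _ mOm (good_u gp i)) (intgZ _ mOm (good_u gq i))).
have i2 i j : intg leb (Om : set T) (fun x => (midp p q).2 x i j).
  by rewrite e2; exact: (intgD mOm (intgZ _ mOm (good_G gp i j)) (intgZ _ mOm (good_G gq i j))).
split => //.
- have msq : measurable_fun (Om : set T) (fun x => sqn ((midp p q).2 x)).
    rewrite /sqn; apply: measurable_sum => i; apply: measurable_sum => j.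
    by apply: measurable_funX; exact: intg_meas (i2 i j).
  apply: (intg_le mOm msq (intgD mOm (good_sqn gp) (good_sqn gq))) => x _.
  rewrite ger0_norm ?sqn_ge0//.
  have := parallelogram (p.2 x) (q.2 x); have := sqn_ge0 (p.2 x - q.2 x).
  have := sqn_ge0 (p.2 x); have := sqn_ge0 (q.2 x).
  by rewrite /midp/=; lra.
- move=> i j.
  (* [wpart_lin] adds a multiple of one function to another with coefficient one; starting from
     zero, two applications produce the midpoint. *)
  have z : intg leb (Om : set T) (cst (0 : R)) by exact: integrable0.
  have wz : wpart Om j (cst (0 : R)) (cst 0).
    move=> g _; under eq_Rintegral do rewrite mul0r.
    under [in RHS]eq_Rintegral do rewrite mul0r.
    by rewrite Rintegral_cst// mul0r oppr0.
  have iZ f k : intg leb (Om : set T) f -> intg leb (Om : set T) (fun x => cst 0 x + k * f x).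
    by move=> fi; exact: (intgD mOm z (intgZ k mOm fi)).
  have wp := wpart_lin oOm 2^-1 z z (good_u gp i) (good_G gp i j) wz (good_weak gp i j).
  have := wpart_lin oOm 2^-1 (iZ _ _ (good_u gp i)) (iZ _ _ (good_G gp i j))
    (good_u gq i) (good_G gq i j) wp (good_weak gq i j).
  rewrite e1 e2; congr wpart; apply/funext => x; by rewrite /= add0r.
Qed.

Lemma hull_good k p : hull k p -> good p.
Proof. by elim=> [n _|{}p q _ gp _ gq]; [exact: goodn|exact: good_mid]. Qed.

Definition energy p := \int[leb]_(x in (Om : set T)) sqn (p.2 x).

Lemma energy_ge0 p : 0 <= energy p.
Proof. by apply: Rintegral_ge0 => x _; exact: sqn_ge0. Qed.

Lemma energy_diff p q : good p -> good q ->
  intg leb (Om : set T) (fun x => sqn (p.2 x - q.2 x)) /\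
  \int[leb]_(x in (Om : set T)) sqn (p.2 x - q.2 x) =
  2 * energy p + 2 * energy q - 4 * energy (midp p q).
Proof.
move=> gp gq; have gm := good_mid gp gq.
have ip := intgZ 2 mOm (good_sqn gp); have iq := intgZ 2 mOm (good_sqn gq).
have im := intgZ 4 mOm (good_sqn gm).
have eqn : (fun x => sqn (p.2 x - q.2 x)) =
    (fun x => 2 * sqn (p.2 x) + 2 * sqn (q.2 x) - 4 * sqn ((midp p q).2 x)).
  by apply/funext => x; exact: parallelogram.
have ipq := intgD mOm ip iq.
rewrite eqn; split; first exact: (intgB mOm ipq im).
rewrite (RintegralB mOm ipq im) (RintegralD mOm ip iq).
rewrite (RintegralZl _ mOm (good_sqn gp)) (RintegralZl _ mOm (good_sqn gq)).
by rewrite (RintegralZl _ mOm (good_sqn gm)).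
Qed.

Variable K : R.
Hypothesis energyK : forall n, energy (un n, Gn n) <= K.

(** [sup S] is the limit, as [k] grows, of the infimum of the energy over the tail hull of index
    [k]. *)
Let S : set R := [set r | exists k, forall q, hull k q -> r <= energy q].

Let S_sup : has_sup S.
Proof.
split; first by exists 0, 0%N => q _; exact: energy_ge0.
exists K => r [k rk]; apply: le_trans (energyK k).
by apply: rk; exact: hull_pt.
Qed.

(** Beyond some index all energies exceed [sup S - e]. In the same hull some energy is at most
    [sup S + e], since otherwise [sup S + e] would belong to [S]. *)
Lemma near_optimal k e : 0 < e -> exists p s, [/\ (k <= s)%N, hull s p,
  energy p <= sup S + e & forall q, hull s q -> sup S - e <= energy q].
Proof.
move=> e0; have [r [k0 rk0] Sr] := sup_adherent e0 S_sup.
pose s := maxn k k0.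
have [p hp pe] : exists2 p, hull s p & energy p <= sup S + e.
  apply: contrapT => np.
  have : S (sup S + e).
    exists s => q hq; rewrite leNgt; apply/negP => /ltW qe; apply: np.
    by exists q.
  by move=> /(sup_ubound S_sup.2); rewrite gerDl leNgt e0.
exists p, s; split => //; first exact: leq_maxl.
move=> q hq; apply: le_trans (ltW Sr) _; apply: rk0.
by apply: hull_le hq; exact: leq_maxr.
Qed.

Lemma exists_cauchy : exists p : nat -> pairT,
  (forall k, exists2 s, (k <= s)%N & hull s (p k)) /\
  forall k, \int[leb]_(x in (Om : set T)) sqn ((p k.+1).2 x - (p k).2 x) <=
            4 ^- k.
Proof.
(* The parallelogram identity bounds the squared distance by [2 e(k+1) + 6 e(k) <= 8 e(k)], which is
   [4^-k] for this choice. *)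
pose e k : R := 4 ^- k / 8.
have e0 k : 0 < e k by rewrite divr_gt0// invr_gt0 exprn_gt0.
have [p pP] := choice (fun k => near_optimal k (e0 k)).
exists p; split.
  by move=> k; have [s [ks hp _ _]] := pP k; exists s.
move=> k; have [s [ks hp pe qe]] := pP k; have [s' [_ hp' pe' qe']] := pP k.+1.
have ekS : e k.+1 <= e k.
  rewrite /e ler_pM2r// lef_pV2 ?posrE ?exprn_gt0//.
  by rewrite exprS ler_peMl ?exprn_ge0// ler1n.
have [_ ->] := energy_diff (hull_good hp') (hull_good hp).
(* Both members lie in the hull with the smaller of the indices [s] and [s'], whose lower energy
   bound then applies to their midpoint. *)
have mide : sup S - e k <= energy (midp (p k.+1) (p k)).
  have [ss'|s's] := leqP s s'.
    by apply: qe; apply: hull_mid => //; exact: hull_le hp'.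
  apply: le_trans (qe' _ _); first by rewrite lerD2l lerN2.
  by apply: hull_mid => //; apply: hull_le hp; exact: ltnW.
have -> : 4 ^- k = 8 * e k by rewrite /e; field; rewrite expf_neq0.
lra.
Qed.

(** On a set of finite measure, increments of order [2^-k] in L^2 are summable in L^1, so each entry
    of the combined gradients converges almost everywhere and in L^1. *)
Lemma mazur : exists (p : nat -> pairT) (G : X -> 'M[R]_(d, N)),
  [/\ forall k, exists2 s, (k <= s)%N & hull s (p k),
    forall i j, intg leb (Om : set T) (fun x => G x i j),
    forall i j, {ae leb, forall x : T, Om x ->
      (p k).2 x i j @[k --> \oo] --> G x i j} &
    forall i j, \int[leb]_(x in (Om : set T)) `|(p k).2 x i j - G x i j|
      @[k --> \oo] --> 0].
Proof.
have [p [hp cp]] := exists_cauchy.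
have gp k : good (p k) by have [s _ /hull_good] := hp k.
pose m := fine (leb (Om : set T)).
have m0 : 0 <= m by exact/fine_ge0/leb_outer_ge0.
have fast (i : 'I_d * 'I_N) : exists g, [/\ intg leb (Om : set T) g,
    {ae leb, forall x : T, Om x -> (p k).2 x i.1 i.2 @[k --> \oo] --> g x} &
    \int[leb]_(x in (Om : set T)) `|(p k).2 x i.1 i.2 - g x| @[k --> \oo] --> 0].
  apply: (@L1_complete _ T R leb Om (fun k x => (p k).2 x i.1 i.2) mOm).
    by move=> k; exact: good_G.
  have C0 : 0 <= (m + 1) / 2 by rewrite divr_ge0// addr_ge0.
  apply: (geometric_lty C0) => k.
    by apply: integral_ge0 => x _; rewrite lee_fin.
  have idiff : intg leb (Om : set T) (fun x => `|(p k.+1).2 x i.1 i.2 - (p k).2 x i.1 i.2|).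
    exact: (intg_norm mOm (intgB mOm (good_G (gp k.+1) _ _) (good_G (gp k) _ _))).
  rewrite (Rintegral_EFin mOm idiff) lee_fin.
  (* Young's inequality [|t| <= a/2 + t^2/(2a)] with [a = 2^-k] balances the measure term against
     the energy term [4^-k]. *)
  pose a : R := 2 ^- k; have a0 : 0 < a by rewrite invr_gt0 exprn_gt0.
  have [isq _] := energy_diff (gp k.+1) (gp k).
  have ia : intg leb (Om : set T) (cst (a / 2)).
    apply: (@intg_bounded _ _ _ _ _ _ `|a / 2|) => //.
  have ib := intgZ (a^-1 / 2) mOm isq.
  apply: (@le_trans _ _ (\int[leb]_(x in (Om : set T))
      (a / 2 + a^-1 / 2 * sqn ((p k.+1).2 x - (p k).2 x)))).
    apply: (le_Rintegral mOm idiff (intgD mOm ia ib)) => x _.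
    have := sqn_entry ((p k.+1).2 x - (p k).2 x) i.1 i.2; rewrite !mxE.
    set t := _ - _ => st.
    have : t ^+ 2 = `|t| ^+ 2 by rewrite real_normK// num_real.
    have h : 0 <= (`|t| - a) ^+ 2 by exact: sqr_ge0.
    move=> t2; rewrite t2 in st.
    apply: (@le_trans _ _ (a / 2 + a^-1 / 2 * `|t| ^+ 2)); last first.
      by rewrite lerD2l ler_wpM2l// divr_ge0// invr_ge0 ltW.
    rewrite -subr_ge0 (_ : _ - _ = (`|t| - a) ^+ 2 / (2 * a)).
      by rewrite divr_ge0// mulr_ge0// ltW.
    by field; rewrite gt_eqF.
  rewrite (RintegralD mOm ia ib) (RintegralZl _ mOm isq) Rintegral_cst//.
  apply: (@le_trans _ _ (a / 2 * m + a^-1 / 2 * 4 ^- k)).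
    by rewrite lerD2l ler_wpM2l// divr_ge0// invr_ge0 ltW.
  rewrite le_eqVlt; apply/orP; left; apply/eqP.
  have -> : 4 ^- k = a ^+ 2 :> R.
    have -> : 4 = 2 ^+ 2 :> R by ring.
    by rewrite /a exprVn -!exprM mulnC.
  rewrite /a; field; rewrite expf_neq0//.
have [g gP] := choice fast.
exists p, (fun x => \matrix_(i, j) g (i, j) x); split => // i j.
- by under eq_fun do rewrite mxE; have [] := gP (i, j).
- have [_ + _] := gP (i, j); apply: filterS => x gx Ox; rewrite mxE; exact: gx.
- by under eq_fun => k do under eq_Rintegral do rewrite mxE; have [] := gP (i, j).
Qed.

End hull.

(** * Passing to the limit in sublevel sets at a single point *)

Lemma ball_mxP {R : realType} m n (x y : 'M[R]_(m, n)) (e : R) : 0 < e ->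
  ball x e y <-> forall i j, `|x i j - y i j| < e.
Proof.
move=> e0; rewrite mx_norm_ball /ball_/=; split.
  rewrite [ltLHS]mx_normrE.
  by move=> /bigmax_ltP[_ h] i j; have := h (i, j) isT; rewrite /= !mxE.
move=> xy; rewrite [ltLHS]mx_normrE; apply/bigmax_ltP; split => // -[i j] _ /=.
by rewrite !mxE.
Qed.

(** Bolzano-Weierstrass along the indices where [P] holds: the corresponding tails generate a proper
    filter on a compact cube. *)
Lemma cluster_rV {R : realType} n (y : nat -> 'rV[R]_n) (P : nat -> Prop) (M : R) :
  (forall k i, P k -> `|y k 0 i| <= M) ->
  (forall n1, exists2 k, (n1 <= k)%N & P k) ->
  exists z : 'rV[R]_n, forall e n1, 0 < e ->
    exists k, [/\ (n1 <= k)%N, P k & forall i, `|z 0 i - y k 0 i| < e].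
Proof.
move=> yM Pinf.
pose B n1 : set 'rV[R]_n := [set y k | k in [set k | (n1 <= k)%N /\ P k]].
pose F := filter_from [set: nat] B.
have FF : ProperFilter F.
  apply: filter_from_proper; last first.
    by move=> n1 _; have [k nk Pk] := Pinf n1; exists (y k); exists k.
  apply: filter_from_filter; first by exists 0%N.
  move=> i j _ _; exists (maxn i j) => // _ [k [ijk Pk] <-].
  move: ijk; rewrite geq_max => /andP[ik jk].
  by split; exists k.
have cK : compact (cbox (\row_i - M) (\row_i M) : set 'rV[R]_n) by exact: compact_cbox.
have [|z [_ zF]] := cK F FF.
  exists 0%N => // _ [k [_ Pk] <-] i; rewrite !mxE -ler_norml; exact: yM.
exists z => e n1 e0.
have zb : nbhs z (ball z e) by exact: nbhsx_ballx.
have [_ [[k [nk Pk] <-] zk]] := zF (B n1) (ball z e)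
  (ex_intro2 _ _ n1 Logic.I (@subset_refl _ _)) zb.
exists k; split => // i; exact: (proj1 (ball_mxP _ _ e0) zk).
Qed.

Lemma cluster_mx {R : realType} m n (y : nat -> 'M[R]_(m, n)) (P : nat -> Prop)
    (M : R) :
  (forall k i j, P k -> `|y k i j| <= M) ->
  (forall n1, exists2 k, (n1 <= k)%N & P k) ->
  exists z : 'M[R]_(m, n), forall e n1, 0 < e ->
    exists k, [/\ (n1 <= k)%N, P k & forall i j, `|z i j - y k i j| < e].
Proof.
move=> yM Pinf.
have yM' k i : P k -> `|mxvec (y k) 0 i| <= M.
  by case/mxvec_indexP: i => i j Pk; rewrite mxvecE; exact: yM.
have [v vP] := cluster_rV yM' Pinf.
exists (vec_mx v) => e n1 e0; have [k [nk Pk vk]] := vP e n1 e0.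
by exists k; split => // i j; have := vk (mxvec_index i j); rewrite mxvecE mxE.
Qed.

Lemma level_convex_mid {R : realType} m n (g : 'M[R]_(m, n) -> R) (t : R) A B :
  level_convex g -> g A <= t -> g B <= t -> g (2^-1 *: (A + B)) <= t.
Proof.
move=> /(_ t) cg gA gB.
have h0 : 0 <= 2^-1 :> R by [].
have h1 : 2^-1 <= 1 :> R by lra.
have := cg A B (Itv01 h0 h1); rewrite !inE => /(_ gA gB).
suff -> : conv (Itv01 h0 h1) (A : convex_lmodType 'M[R]_(m, n)) B
  = 2^-1 *: (A + B) by [].
rewrite scalerDr /conv/=; congr (_ + _ *: _).
change (1 - 2^-1 = 2^-1 :> R); lra.
Qed.

Lemma coercive_bound {R : realType} (alpha gamma e t : R) : 0 < alpha ->
  0 < gamma -> 0 <= e -> alpha * e `^ gamma <= t ->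
  e <= (t / alpha) `^ gamma^-1.
Proof.
move=> a0 g0 e0 et.
have -> : e = (e `^ gamma) `^ gamma^-1.
  by rewrite -powRrM mulfV ?gt_eqF// powRr1.
apply: ge0_ler_powR.
- by rewrite invr_ge0 ltW.
- by rewrite nnegrE powR_ge0.
- rewrite nnegrE divr_ge0 ?(ltW a0)// (le_trans _ et)//.
  by rewrite mulr_ge0 ?powR_ge0// ltW.
- by rewrite ler_pdivlMr// mulrC.
Qed.

(* Near the limit, sublevel sets stay close to the limiting sublevel set, which
   is closed and convex: averaging cannot leave it. *)
Lemma sublevel_limit {R : realType} d N
    (F : 'rV[R]_d -> 'M[R]_(d, N) -> R) (alpha gamma lam : R)
    (zn : nat -> 'rV[R]_d) (z : 'rV[R]_d)
    (xin vn : nat -> 'M[R]_(d, N)) (xi : 'M[R]_(d, N)) :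
  lower_semicontinuous (fun q : 'rV[R]_d * 'M[R]_(d, N) => (F q.1 q.2)%:E) ->
  level_convex (F z) -> 0 < alpha -> 0 < gamma ->
  (forall z' A, alpha * enorm A `^ gamma <= F z' A) ->
  (forall i, zn k 0 i @[k --> \oo] --> z 0 i) ->
  (\forall k \near \oo, F (zn k) (xin k) <= lam) ->
  (forall k, exists2 s, (k <= s)%N & forall C : set 'M[R]_(d, N),
    (forall n, (s <= n)%N -> C (xin n)) ->
    (forall A B, C A -> C B -> C (2^-1 *: (A + B))) -> C (vn k)) ->
  (forall i j, vn k i j @[k --> \oo] --> xi i j) ->
  F z xi <= lam.
Proof.
move=> lscF cF a0 g0 coe zz [n0 _ Fn0] vC vxi.
have zball (e : R) : 0 < e -> \forall k \near \oo, ball z e (zn k).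
  move=> e0; have : \forall k \near \oo, forall i, `|z 0 i - zn k 0 i| < e.
    by apply: filter_forall => i; move/cvgrPdist_lt : (zz i); exact.
  by apply: filterS => k zk; apply/ball_mxP => // i j; rewrite ord1.
have lsc (A : 'M[R]_(d, N)) : lam < F z A -> exists2 e, 0 < e &
    forall z' A', ball z e z' -> ball A e A' -> lam < F z' A'.
  move=> FA; have [|V /nbhs_ballP[e /= e0 eV] VF] := lscF (z, A) lam.
    by rewrite lte_fin.
  exists e => // z' A' zz' AA'.
  have VzA : V (z', A') by apply: eV; split.
  by have := VF _ VzA; rewrite lte_fin.
(* Otherwise infinitely many [xin n] stay at distance [e] from the sublevel set of [F z]. Coercivity
   bounds them, and by joint lower semicontinuity a cluster point belongs to that set. *)
have close (e : R) : 0 < e -> exists n1, forall n, (n1 <= n)%N ->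
    exists2 A, F z A <= lam & forall i j, `|A i j - xin n i j| < e.
  move=> e0; apply: contrapT => bad.
  pose P n := (n0 <= n)%N /\
    ~ exists2 A, F z A <= lam & forall i j, `|A i j - xin n i j| < e.
  have Pinf n1 : exists2 n, (n1 <= n)%N & P n.
    apply: contrapT => nP; apply: bad; exists (maxn n0 n1) => n.
    rewrite geq_max => /andP[n0n n1n]; apply: contrapT => nA.
    by apply: nP; exists n.
  have xiM k i j : P k -> `|xin k i j| <= (lam / alpha) `^ gamma^-1.
    move=> [nk _]; have Fk := Fn0 k nk.
    apply: le_trans (_ : _ <= enorm (xin k)) _.
      rewrite -(@ler_pXn2r _ 2)// ?nnegrE ?sqrtr_ge0//.
      by rewrite enorm_sqr real_normK ?num_real// sqn_entry.
    apply: coercive_bound => //; first exact: sqrtr_ge0.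
    exact: le_trans (coe _ _) Fk.
  have [A AP] := cluster_mx xiM Pinf.
  have FA : F z A <= lam.
    rewrite leNgt; apply/negP => /lsc[e' e'0 lse].
    have [n1 _ zn1] := zball e' e'0.
    have [k [nk [n0k _] Ak]] := AP e' n1 e'0.
    have := Fn0 k n0k; rewrite leNgt => /negP; apply.
    by apply: lse; [exact: zn1|exact/ball_mxP].
  have [k [_ [_ nk] Ak]] := AP e 0%N e0.
  by apply: nk; exists A.
rewrite leNgt; apply/negP => /lsc[e e0 lse].
have e20 : 0 < e / 2 by rewrite divr_gt0.
have [n1 n1P] := close _ e20.
have vball : \forall k \near \oo, forall ij : 'I_d * 'I_N,
    `|xi ij.1 ij.2 - vn k ij.1 ij.2| < e / 2.
  by apply: filter_forall => ij; move/cvgrPdist_lt : (vxi ij.1 ij.2); exact.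
have [k [n1k vk]] : exists k, (n1 <= k)%N /\ forall ij : 'I_d * 'I_N,
    `|xi ij.1 ij.2 - vn k ij.1 ij.2| < e / 2.
  have [n2 _ n2P] := vball; exists (maxn n1 n2).
  by split; [exact: leq_maxl|apply: n2P; exact: leq_maxr].
have [s ks sC] := vC k.
(* The neighbourhood of radius [e / 2] of a convex set is stable under midpoints and contains a tail
   of [xin], hence also [vn k], which is itself [e / 2]-close to [xi]. *)
pose C : set 'M[R]_(d, N) := [set B | exists2 A, F z A <= lam &
  forall i j, `|A i j - B i j| < e / 2].
have [||A FA Av] := sC C.
- by move=> n sn; apply: n1P; rewrite (leq_trans n1k)// (leq_trans ks).
- move=> B B' [A FA AB] [A' FA' AB']; exists (2^-1 *: (A + A')).
    exact: level_convex_mid.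
  move=> i j; rewrite !mxE; have := AB i j; have := AB' i j.
  by rewrite !ltr_norml => *; lra.
have := FA; rewrite leNgt => /negP; apply; apply: lse.
  by apply/ball_mxP => // i j; rewrite subrr normr0.
apply/ball_mxP => // i j; have := Av i j; have := vk (i, j).
by rewrite !ltr_norml /= => *; lra.
Qed.

(** * Measurability of the integrand and identification of the weak limit *)

Section core.
Context {R : realType} {N d : nat}.
Notation X := 'rV[R]_N.
Notation T := (lebT R N).
Variable Om : set X.
Hypothesis oOm : open Om.
Hypothesis Omoo : (leb (Om : set T) < +oo)%E.
Let mOm : measurable (Om : set T) := measurable_open oOm.

(** Cutting [u] and [G] off outside [Om] makes [x |-> (x, u x, G x)] measurable on the whole space;
    it is then composed with the jointly measurable integrand. *)
Lemma measurable_integrand (f : X -> 'rV[R]_d -> 'M[R]_(d, N) -> R)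
    (u : X -> 'rV[R]_d) (G : X -> 'M[R]_(d, N)) :
  normal_integrand Om f ->
  (forall i, measurable_fun (Om : set T) (fun x => u x 0 i)) ->
  (forall i j, measurable_fun (Om : set T) (fun x => G x i j)) ->
  meas_fun Om (fun x => f x (u x) (G x)).
Proof.
move=> [mf _] mu mG.
pose u' (x : T) : borelT R 1 d := \row_i (((fun x : T => u x 0 i) \_ Om) x).
pose G' (x : T) : borelT R d N := \matrix_(i, j) (((fun x : T => G x i j) \_ Om) x).
have mu' : measurable_fun setT u'.
  apply: measurable_fun_mx => i j; rewrite /u'; under eq_fun do rewrite mxE.
  by apply/(measurable_restrictT _ mOm); exact: mu.
have mG' : measurable_fun setT G'.
  apply: measurable_fun_mx => i j; rewrite /G'; under eq_fun do rewrite mxE.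
  by apply/(measurable_restrictT _ mOm); exact: mG.
pose h (x : T) : (T * borelT R 1 d * borelT R d N)%type := ((x, u' x), G' x).
have mh : measurable_fun setT h.
  exact: (measurable_fun_pair (measurable_fun_pair (@measurable_id _ T setT) mu') mG').
pose E : set (T * borelT R 1 d * borelT R d N) := (Om `*` setT) `*` setT.
have mE : measurable E by apply: measurableX => //; exact: measurableX.
have sub : h @` (Om : set T) `<=` E by move=> _ [x Ox <-]; split.
have mhO : measurable_fun (Om : set T) h by exact: measurable_funTS.
have := measurable_comp mE sub mf mhO.
apply: eq_measurable_fun => x /set_mem Ox /=; congr (f x _ _).
  by apply/rowP => i; rewrite mxE patchE mem_set.
by apply/matrixP => i j; rewrite mxE patchE mem_set.
Qed.

Lemma measurable_enorm m n (D : set T) (A : X -> 'M[R]_(m, n)) :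
  (forall i j, measurable_fun D (fun x => A x i j)) ->
  measurable_fun D (fun x => enorm (A x)).
Proof.
move=> mA.
have ms : measurable_fun D (fun x => sqn (A x)).
  rewrite /sqn; apply: measurable_sum => i; apply: measurable_sum => j.
  exact: measurable_funX.
have mq : measurable_fun setT (@Num.sqrt R).
  by apply: continuous_measurable_fun; exact: sqrt_continuous.
exact: measurableT_comp mq ms.
Qed.

Lemma entry_le_enorm m n (A : 'M[R]_(m, n)) i j : `|A i j| <= enorm A.
Proof.
rewrite -(@ler_pXn2r _ 2)// ?nnegrE ?sqrtr_ge0//.
by rewrite enorm_sqr real_normK ?num_real// sqn_entry.
Qed.

(** Integrating one component against a bounded function is a bounded linear functional on L^1. *)
Lemma weak_cvg_test (un : nat -> X -> 'rV[R]_d) (u : X -> 'rV[R]_d) i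
    (psi : X -> R) C :
  L1 Om u -> (forall n, L1 Om (un n)) -> weak_cvg_L1 Om un u ->
  measurable_fun (Om : set T) psi -> (forall x, Om x -> `|psi x| <= C) ->
  \int[leb]_(x in (Om : set T)) (un n x 0 i * psi x) @[n --> \oo] -->
  \int[leb]_(x in (Om : set T)) (u x 0 i * psi x).
Proof.
move=> iu iun wc mpsi psiC.
pose l (v : X -> 'rV[R]_d) := \int[leb]_(x in (Om : set T)) (v x 0 i * psi x).
apply: (wc l); split.
  move=> a v w iv iw; rewrite /l.
  have i1 : intg leb (Om : set T) (fun x => v x 0 i * psi x).
    exact: (intgMb mOm (iv i) mpsi psiC).
  have i2 : intg leb (Om : set T) (fun x => w x 0 i * psi x).
    exact: (intgMb mOm (iw i) mpsi psiC).
  rewrite -(RintegralZl a mOm i1) -(RintegralD mOm (intgZ a mOm i1) i2).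
  by apply: eq_Rintegral => x _; rewrite !mxE; ring.
exists `|C| => v iv.
have ivn := intg_norm mOm (iv i).
have iv1 := intgMb mOm (iv i) mpsi psiC.
have lC : `|l v| <= `|C| * \int[leb]_(x in (Om : set T)) `|v x 0 i|.
  apply: le_trans (le_normr_Rintegral mOm iv1) _.
  rewrite -(RintegralZl _ mOm ivn).
  apply: (le_Rintegral mOm (intg_norm mOm iv1) (intgZ _ mOm ivn)) => x Ox.
  by rewrite normrM mulrC ler_wpM2r// (le_trans (psiC x Ox))// ler_norm.
have -> : normL1 Om v = (\int[leb]_(x in (Om : set T)) (enorm (v x))%:E)%E by [].
apply: le_trans (_ : _ <= `|C|%:E * (\int[leb]_(x in (Om : set T)) `|v x 0 i|)%:E)%E _.
  by rewrite -EFinM lee_fin.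
apply: lee_wpmul2l; first by rewrite lee_fin.
have m1 : measurable_fun (Om : set T) (fun x => (`|v x 0 i|)%:E).
  by apply/measurable_EFinP; exact: intg_meas ivn.
have m2 : measurable_fun (Om : set T) (fun x => (enorm (v x))%:E).
  apply/measurable_EFinP; apply: measurable_enorm => k j.
  by rewrite ord1; exact: intg_meas (iv j).
rewrite -(Rintegral_EFin mOm ivn).
have h1 x : Om x -> (0 <= (`|v x 0 i|)%:E)%E by move=> _; rewrite lee_fin.
have h12 x : Om x -> ((`|v x 0 i|)%:E <= (enorm (v x))%:E)%E.
  by move=> _; rewrite lee_fin entry_le_enorm.
exact: (ge0_le_integral _ mOm h1 m1 m2 h12).
Qed.

Lemma weak_cvg_box (un : nat -> X -> 'rV[R]_d) (u : X -> 'rV[R]_d) i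
    (Q : set T) : measurable Q -> Q `<=` Om ->
  L1 Om u -> (forall n, L1 Om (un n)) -> weak_cvg_L1 Om un u ->
  \int[leb]_(x in Q) (un n x 0 i - u x 0 i) @[n --> \oo] --> 0.
Proof.
move=> mQ QOm iu iun wc.
have mI : measurable_fun (Om : set T) (\1_Q : T -> R) by exact: measurable_indic.
have IC x : Om x -> `|\1_Q x| <= (1 : R).
  by move=> _; rewrite indicE; case: (_ \in _); rewrite ?normr1 ?normr0.
have := weak_cvg_test (i := i) iu iun wc mI IC.
have iQ h : intg leb (Om : set T) h -> intg leb Q h.
  by move=> hi; exact: (integrableS mOm mQ QOm hi).
have -> : (fun n => \int[leb]_(x in (Om : set T)) (un n x 0 i * \1_Q x)) =
    (fun n => \int[leb]_(x in Q) un n x 0 i).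
  by apply/funext => n; exact: Rintegral_indic.
rewrite (Rintegral_indic leb (fun x => u x 0 i) mOm mQ QOm) => cv.
have -> : (fun n => \int[leb]_(x in Q) (un n x 0 i - u x 0 i)) =
  (fun n => \int[leb]_(x in Q) un n x 0 i - \int[leb]_(x in Q) u x 0 i).
  by apply/funext => n; rewrite RintegralB//; apply: iQ; [exact: iun|exact: iu].
rewrite -[X in _ --> X](subrr (\int[leb]_(x in Q) u x 0 i)).
by apply: cvgB => //; exact: cvg_cst.
Qed.

Lemma intg_L1loc (h : X -> R) : intg leb (Om : set T) h -> L1loc Om h.
Proof.
move=> hi; split; first exact: intg_meas hi.
move=> K KO cK; exact: (integrableS mOm (measurable_compact cK) KO hi).
Qed.

Section limit.
Variables (un : nat -> X -> 'rV[R]_d) (u : X -> 'rV[R]_d).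
Variable Gn : nat -> X -> 'M[R]_(d, N).
Variable K : R.
Hypothesis iu : L1 Om u.
Hypothesis goodn : forall n, good Om (un n, Gn n).
Hypothesis energyK : forall n, energy Om (un n, Gn n) <= K.
Hypothesis wc : weak_cvg_L1 Om un u.

Let iun n : L1 Om (un n).
Proof. exact: good_u (goodn n). Qed.

(** The inequality holds for all indices from [k] on and is a convex condition, so it passes to
    midpoints and holds uniformly on the hull. *)
Lemma hull_weak_cvg i (psi : X -> R) C e :
  measurable_fun (Om : set T) psi -> (forall x, Om x -> `|psi x| <= C) -> 0 < e ->
  exists k, forall p, hull un Gn k p ->
    `|\int[leb]_(x in (Om : set T)) (p.1 x 0 i * psi x) -
      \int[leb]_(x in (Om : set T)) (u x 0 i * psi x)| <= e.
Proof.
move=> mpsi psiC e0.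
have /cvgrPdist_le/(_ e e0)[k _ kP] := weak_cvg_test (i := i) iu iun wc mpsi psiC.
exists k => p; elim=> [n kn|{}p q hp IHp hq IHq].
  by rewrite distrC; exact: kP.
have gp := hull_good oOm goodn hp; have gq := hull_good oOm goodn hq.
have ip := intgMb mOm (good_u gp i) mpsi psiC.
have iq := intgMb mOm (good_u gq i) mpsi psiC.
have -> : \int[leb]_(x in (Om : set T)) ((midp p q).1 x 0 i * psi x) =
    2^-1 * \int[leb]_(x in (Om : set T)) (p.1 x 0 i * psi x) +
    2^-1 * \int[leb]_(x in (Om : set T)) (q.1 x 0 i * psi x).
  rewrite -(RintegralZl _ mOm ip) -(RintegralZl _ mOm iq).
  rewrite -(RintegralD mOm (intgZ _ mOm ip) (intgZ _ mOm iq)).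
  by apply: eq_Rintegral => x _; rewrite !mxE; ring.
move: IHp IHq; set a := \int[leb]_(x in _) _; set b := \int[leb]_(x in _) _.
by set c := \int[leb]_(x in _) _; rewrite !ler_norml => *; lra.
Qed.

(** The combined gradients converge in L^1 by [mazur], while the same combinations of the functions
    still converge weakly to [u] by [hull_weak_cvg]; so both sides of the integration by parts pass
    to the limit. *)
Lemma limit_gradient : exists (p : nat -> (X -> 'rV[R]_d) * (X -> 'M[R]_(d, N)))
    (G : X -> 'M[R]_(d, N)),
  [/\ forall k, exists2 s, (k <= s)%N & hull un Gn s (p k),
    forall i j, intg leb (Om : set T) (fun x => G x i j),
    forall i j, {ae leb, forall x : T, Om x ->
      (p k).2 x i j @[k --> \oo] --> G x i j} &
    forall i j, wpart Om j (fun x => u x 0 i) (fun x => G x i j)].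
Proof.
have [p [G [hp iG aeG cG]]] := mazur oOm Omoo goodn energyK.
exists p, G; split => // i j g tg.
have tpg := test_partial j tg.
have [C gC] := test_bounded tg; have [C' pgC] := test_bounded tpg.
have mg : measurable_fun (Om : set T) g.
  exact/continuous_measurable_leb/(test_continuous tg).
have mpg : measurable_fun (Om : set T) (partial j g).
  exact/continuous_measurable_leb/(test_continuous tpg).
have lim1 : \int[leb]_(x in (Om : set T)) ((p k).1 x 0 i * partial j g x)
    @[k --> \oo] --> \int[leb]_(x in (Om : set T)) (u x 0 i * partial j g x).
  apply/cvgrPdist_le => e e0.
  have [k0 k0P] := hull_weak_cvg i mpg (fun x _ => pgC x) e0.
  exists k0 => // k /= k0k; rewrite distrC; apply: k0P.
  have [s ks hs] := hp k; apply: hull_le hs; exact: leq_trans ks.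
have gp k : good Om (p k) by have [s _ /(hull_good oOm goodn)] := hp k.
have lim2 : \int[leb]_(x in (Om : set T)) ((p k).2 x i j * g x)
    @[k --> \oo] --> \int[leb]_(x in (Om : set T)) (G x i j * g x).
  have C0 : 0 <= C by apply: le_trans (gC 0); exact: normr_ge0.
  have bnd k : `|\int[leb]_(x in (Om : set T)) (G x i j * g x) -
      \int[leb]_(x in (Om : set T)) ((p k).2 x i j * g x)| <=
      C * \int[leb]_(x in (Om : set T)) `|(p k).2 x i j - G x i j|.
    have ipk := intgMb mOm (good_G (gp k) i j) mg (fun x _ => gC x).
    have iGg := intgMb mOm (iG i j) mg (fun x _ => gC x).
    have idf := intg_norm mOm (intgB mOm (good_G (gp k) i j) (iG i j)).
    rewrite -(RintegralB mOm iGg ipk).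
    apply: le_trans (le_normr_Rintegral mOm (intgB mOm iGg ipk)) _.
    rewrite -(RintegralZl _ mOm idf).
    apply: (le_Rintegral mOm (intg_norm mOm (intgB mOm iGg ipk)) (intgZ _ mOm idf)).
    move=> x _; rewrite -mulrBl normrM mulrC distrC.
    by rewrite ler_wpM2r.
  apply/cvgrPdist_le => e e0.
  have lim0 : C * \int[leb]_(x in (Om : set T)) `|(p k).2 x i j - G x i j|
      @[k --> \oo] --> 0.
    by rewrite -[X in _ --> X](mulr0 C); apply: cvgMr; exact: cG.
  move/cvgr0Pnorm_le : lim0 => /(_ e e0); apply: filterS => k ke.
  by apply: le_trans (bnd k) _; apply: le_trans (ler_norm _) ke.
have lim2' : \int[leb]_(x in (Om : set T)) ((p k).1 x 0 i * partial j g x)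
    @[k --> \oo] --> - \int[leb]_(x in (Om : set T)) (G x i j * g x).
  under eq_cvg do rewrite (good_weak (gp _) i j tg).
  exact: cvgN lim2.
exact: cvg_unique lim1 lim2'.
Qed.

Lemma weak_gradient_wpart (G : X -> 'M[R]_(d, N)) :
  (forall i j, intg leb (Om : set T) (fun x => G x i j)) ->
  (forall i j, wpart Om j (fun x => u x 0 i) (fun x => G x i j)) ->
  weak_gradient Om u G.
Proof.
move=> iG wG; split; first by move=> i j; exact: intg_L1loc.
move=> g tg i j; exact: (proj1 (wpartE oOm j (iu i) (iG i j)) (wG i j)).
Qed.

(** [wgrad] is some weak gradient obtained by choice; uniqueness identifies it with [G]. *)
Lemma W11loc_limit (G : X -> 'M[R]_(d, N)) :
  (forall i j, intg leb (Om : set T) (fun x => G x i j)) ->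
  (forall i j, wpart Om j (fun x => u x 0 i) (fun x => G x i j)) ->
  W11loc Om u /\ forall i j, {ae leb, forall x : T, Om x ->
    G x i j = wgrad Om u x i j}.
Proof.
move=> iG wG; have wgG := weak_gradient_wpart iG wG.
split; first by split; [move=> i; exact: (intg_L1loc (iu i))|exists G].
have wgw : weak_gradient Om u (wgrad Om u) by apply: getPex; exists G.
move=> i j; apply: (weak_unique oOm (wgG.1 i j) (wgw.1 i j)) => g tg.
have := wgG.2 g tg i j; rewrite (wgw.2 g tg i j) => /esym/(congr1 oppe).
by rewrite !oppeK.
Qed.

End limit.
End core.

Lemma fast_ae_cvg0 d (T : measurableType d) (R : realType)
    (mu : {measure set T -> \bar R}) (D : set T) (h : nat -> T -> R) :
  measurable D -> (forall k, intg mu D (h k)) ->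
  (forall k x, D x -> 0 <= h k x) ->
  (forall k, \int[mu]_(x in D) h k x <= 2 ^- k) ->
  {ae mu, forall x, D x -> h k x @[k --> \oo] --> 0}.
Proof.
move=> mD ih h0 hk; apply: ae_cvg0 => //; first by move=> k; exact: intg_meas (ih k).
apply: (@geometric_lty _ _ 1) => // k.
  by apply: integral_ge0 => x Dx; rewrite lee_fin h0.
by rewrite (Rintegral_EFin mD (ih k)) lee_fin mul1r.
Qed.

(** * Local strong convergence and an almost everywhere convergent subsequence *)

Section strong.
Context {R : realType} {N d : nat}.
Notation X := 'rV[R]_N.
Notation T := (lebT R N).
Variable Om : set X.
Hypothesis oOm : open Om.
Hypothesis Omoo : (leb (Om : set T) < +oo)%E.
Let mOm : measurable (Om : set T) := measurable_open oOm.
Variables (un : nat -> X -> 'rV[R]_d) (u : X -> 'rV[R]_d).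
Variable Gn : nat -> X -> 'M[R]_(d, N).
Variable K : R.
Hypothesis iu : L1 Om u.
Hypothesis goodn : forall n, good Om (un n, Gn n).
Hypothesis energyK : forall n, energy Om (un n, Gn n) <= K.
Hypothesis wc : weak_cvg_L1 Om un u.

Let iun n : L1 Om (un n).
Proof. exact: good_u (goodn n). Qed.

(** The compactness argument is applied to [un n - u], so [u] must have a weak gradient beforehand;
    [limit_gradient] provides it. The gradients of the differences are bounded in L^1 because
    [|t| <= 1 + t^2] and [Om] has finite measure. *)
Lemma strong_box i B e : room Om B e -> (forall k, B.1 0 k <= B.2 0 k) ->
  \int[leb]_(x in (boxp B : set T)) `|un n x 0 i - u x 0 i| @[n --> \oo] --> 0.
Proof.
move=> rB sB.
have [_ [G [_ iG _ wG]]] := limit_gradient oOm Omoo iu goodn energyK wc.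
have i1 : intg leb (Om : set T) (fun=> 1 : R).
  by apply: (intg_bounded (C := 1)) => //= x _; rewrite normr1.
pose m := \int[leb]_(x in (Om : set T)) (1 : R).
have e1 w : (fun x : X => w x + -1 * u x 0 i) = (fun x => w x - u x 0 i).
  by apply/funext => x; rewrite mulN1r.
pose h n j x := Gn n x i j + -1 * G x i j.
have iGn n j : intg leb (Om : set T) (fun x => Gn n x i j) := good_G (goodn n) i j.
have ih n j : intg leb (Om : set T) (h n j).
  exact: (intgD mOm (iGn n j) (intgZ (-1) mOm (iG i j))).
have Gn1 n j : \int[leb]_(x in (Om : set T)) `|Gn n x i j| <= m + K.
  have isq := good_sqn (goodn n).
  apply: le_trans (_ : _ <= m + energy Om (un n, Gn n)) _; last by rewrite lerD2l.
  rewrite /m /energy -(RintegralD mOm i1 isq).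
  apply: (le_Rintegral mOm (intg_norm mOm (iGn n j)) (intgD mOm i1 isq)) => x _.
  apply: le_trans (_ : _ <= 1 + Gn n x i j ^+ 2) _; last by rewrite lerD2l sqn_entry.
  by rewrite -(real_normK (num_real (Gn n x i j))); have := normr_ge0 (Gn n x i j); nra.
pose C := m + K + \sum_j \int[leb]_(x in (Om : set T)) `|G x i j|.
have hC n j : \int[leb]_(x in (Om : set T)) `|h n j x| <= C.
  apply: le_trans (_ : _ <= m + K + \int[leb]_(x in (Om : set T)) `|G x i j|) _.
    apply: le_trans (lerD (Gn1 n j) (lexx _)).
    have n1 := intg_norm mOm (iGn n j); have n2 := intg_norm mOm (iG i j).
    rewrite -(RintegralD mOm n1 n2).
    apply: (le_Rintegral mOm (intg_norm mOm (ih n j)) (intgD mOm n1 n2)) => x _.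
    by rewrite /h mulN1r ler_normB.
  rewrite lerD2l (bigD1 j)//= lerDl sumr_ge0// => k _.
  by apply: Rintegral_ge0 => x _.
apply: (rellich_weak (h := h) oOm rB sB _ ih _ hC).
- by move=> n; exact: (intgB mOm (iun n i) (iu i)).
- move=> n j; have := wpart_lin oOm (-1) (iun n i) (iGn n j) (iu i) (iG i j)
    (good_weak (goodn n) i j) (wG i j).
  by rewrite e1.
- by move=> Q QOm; exact: (weak_cvg_box oOm i (measurable_boxp Q) QOm iu iun wc).
Qed.

(** A diagonal choice: the [k]-th index controls, up to [2^-k], the measure of [bad] and the errors
    on all rational boxes with code at most [k]. Summability gives convergence almost everywhere on
    each box, and a Borel-Cantelli argument handles [bad]. *)
Lemma strong_subsequence (bad : nat -> set T) :
  (forall n, measurable (bad n)) -> (forall n, bad n `<=` Om) ->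
  fine (leb (bad n)) @[n --> \oo] --> 0 ->
  exists sg : nat -> nat, [/\ forall k, (k <= sg k)%N,
    forall i, {ae leb, forall x : T, Om x ->
      un (sg k) x 0 i @[k --> \oo] --> u x 0 i} &
    {ae leb, forall x : T, Om x -> \forall k \near \oo, ~ bad (sg k) x}].
Proof.
move=> mbad badOm bad0.
have p20 k : 0 < 2 ^- k :> R by rewrite invr_gt0 exprn_gt0.
have step k : exists n, [/\ (k <= n)%N, fine (leb (bad n)) <= 2 ^- k &
    forall q, (pickle q <= k)%N -> room Om (ratbox q : X * X) q.2.+1%:R^-1 ->
      (forall l, (ratbox q : X * X).1 0 l <= (ratbox q : X * X).2 0 l) -> forall i,
      \int[leb]_(x in (boxp (ratbox q) : set T)) `|un n x 0 i - u x 0 i| <= 2 ^- k].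
  pose Q n q i := room Om (ratbox q : X * X) q.2.+1%:R^-1 ->
      (forall l, (ratbox q : X * X).1 0 l <= (ratbox q : X * X).2 0 l) ->
      \int[leb]_(x in (boxp (ratbox q) : set T)) `|un n x 0 i - u x 0 i| <= 2 ^- k.
  have near1 : \forall n \near \oo, forall (l : 'I_k.+1) (i : 'I_d),
      if unpickle l is Some q then Q n q i else True.
    apply: filter_forall => l; apply: filter_forall => i.
    case: unpickle => [q|]; last exact: nearW.
    have [[rq sq]|nq] := pselect (room Om (ratbox q) q.2.+1%:R^-1 /\
        forall l, (ratbox q : X * X).1 0 l <= (ratbox q : X * X).2 0 l); last first.
      by apply: nearW => n rq sq; case: nq.
    have /cvgr0Pnorm_le/(_ _ (p20 k)) := strong_box i rq sq.
    by apply: filterS => n nk _ _; apply: le_trans (ler_norm _) nk.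
  have near2 : \forall n \near \oo, fine (leb (bad n)) <= 2 ^- k.
    have /cvgr0Pnorm_le/(_ _ (p20 k)) := bad0.
    by apply: filterS => n nk; apply: le_trans (ler_norm _) nk.
  have [n0 _ n0P] := filterI near1 near2.
  exists (maxn k n0); have [P1 P2] := n0P _ (leq_maxr k n0).
  split => //; first exact: leq_maxl.
  move=> q qk rq sq i; have ql : (pickle q < k.+1)%N by [].
  by have := P1 (Ordinal ql) i; rewrite pickleK; exact.
have [sg sgP] := choice step.
have iv n i : intg leb (Om : set T) (fun x => `|un n x 0 i - u x 0 i|).
  exact: (intg_norm mOm (intgB mOm (iun n i) (iu i))).
exists sg; split; first by move=> k; have [] := sgP k.
- move=> i; apply: (ae_boxes oOm) => q rq sq.
  have mB := measurable_boxp (ratbox q : X * X).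
  have iB n := integrableS mOm mB (room_box rq) (iv n i).
  (* The box [q] is controlled only from the index [pickle q] on, hence the shift. *)
  pose h k x := `|un (sg (k + pickle q)%N) x 0 i - u x 0 i|.
  have hk k : \int[leb]_(x in (boxp (ratbox q) : set T)) h k x <= 2 ^- k.
    have [_ _ /(_ q (leq_addl _ _) rq sq i)] := sgP (k + pickle q)%N.
    move=> /le_trans; apply.
    by rewrite lef_pV2 ?posrE ?exprn_gt0// ler_weXn2l ?ler1n// leq_addr.
  have h0 k x : boxp (ratbox q) x -> 0 <= h k x by move=> _; exact: normr_ge0.
  have := fast_ae_cvg0 mB (fun k => iB (sg (k + pickle q)%N)) h0 hk.
  apply: filterS => x hx /hx {}hx.
  rewrite -(cvg_shiftn (pickle q)).
  apply/cvgrPdist_le => e e0; move/cvgr0Pnorm_le : hx => /(_ e e0).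
  by apply: filterS => k; rewrite normr_id distrC.
- pose h k : T -> R := \1_(bad (sg k)).
  have ibad k : intg leb (Om : set T) (h k).
    have mI : measurable_fun (Om : set T) (h k) by exact: measurable_indic.
    apply: (intg_bounded (C := 1) mOm Omoo mI) => x _.
    by rewrite /h indicE; case: (_ \in _); rewrite ?normr1 ?normr0.
  have h0 k x : Om x -> 0 <= h k x by move=> _; rewrite /h indicE.
  have hk k : \int[leb]_(x in (Om : set T)) h k x <= 2 ^- k.
    have [_ b2 _] := sgP k.
    rewrite /Rintegral integral_indic// (setIidl (badOm _)); exact: b2.
  have := fast_ae_cvg0 mOm ibad h0 hk.
  apply: filterS => x hx /hx /cvgr0Pnorm_lt /(_ 1 ltr01); apply: filterS => k.
  by rewrite /h indicE => h1 bx; move: h1; rewrite mem_set// normr1 ltxx.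
Qed.
End strong.

(** * Sublevel bounds survive weak convergence *)

Section lower_semicontinuity.
Context {R : realType} {N d : nat}.
Notation X := 'rV[R]_N.
Notation T := (lebT R N).
Variable Om : set X.
Hypothesis oOm : open Om.
Hypothesis Omoo : (leb (Om : set T) < +oo)%E.
Let mOm : measurable (Om : set T) := measurable_open oOm.
Variable f : X -> 'rV[R]_d -> 'M[R]_(d, N) -> R.
Variables (alpha gamma : R).
Hypothesis nf : normal_integrand Om f.
Hypothesis lcf : {ae leb, forall x : T, Om x -> forall z, level_convex (f x z)}.
Hypothesis alpha0 : 0 < alpha.
Hypothesis gamma0 : 0 < gamma.
Hypothesis coef : {ae leb, forall x : T, Om x ->
  forall z xi, alpha * enorm xi `^ gamma <= f x z xi}.

Lemma measurable_superlevel (g : X -> R) lam : meas_fun Om g ->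
  measurable ([set x | Om x /\ lam < g x] : set T).
Proof.
move=> mg; have mI : measurable [set` Interval (BRight lam) (BInfty R false)].
  exact: measurable_itv.
have := mg mOm _ mI; congr measurable; apply/seteqP; split => x /=.
  by move=> [Ox]; rewrite in_itv/= andbT.
by move=> [Ox gx]; split => //; rewrite in_itv/= andbT.
Qed.

(** The convex combinations are formed after extracting the subsequence: at almost every point all
    late terms entering them then satisfy the sublevel bound and have values of [un] converging to
    [u], as [sublevel_limit] requires. *)
Lemma sublevel_weak_limit (un : nat -> X -> 'rV[R]_d) (u : X -> 'rV[R]_d)
    (Gn : nat -> X -> 'M[R]_(d, N)) (K lam : R) :
  L1 Om u -> (forall n, good Om (un n, Gn n)) ->
  (forall n, energy Om (un n, Gn n) <= K) -> weak_cvg_L1 Om un u ->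
  fine (leb ([set x | Om x /\ lam < f x (un n x) (Gn n x)] : set T))
    @[n --> \oo] --> 0 ->
  W11loc Om u /\
  {ae leb, forall x : T, Om x -> f x (u x) (wgrad Om u x) <= lam}.
Proof.
move=> iu goodn energyK wc bad0.
pose bad n : set T := [set x | Om x /\ lam < f x (un n x) (Gn n x)].
have mbad n : measurable (bad n).
  have mu i := intg_meas (good_u (goodn n) i).
  have mG i j := intg_meas (good_G (goodn n) i j).
  exact: (measurable_superlevel lam (measurable_integrand oOm nf mu mG)).
have badOm n : bad n `<=` Om by move=> x [].
have [sg [sgk aeu aebad]] :=
  strong_subsequence oOm Omoo iu goodn energyK wc mbad badOm bad0.
have sgoo : sg k @[k --> \oo] --> \oo.
  move=> A [n _ nA]; exists n => // k /= nk; apply: nA => /=.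
  exact: leq_trans (sgk k).
have wc' : weak_cvg_L1 Om (un \o sg) u.
  by move=> l hl; exact: (cvg_comp _ _ sgoo (wc l hl)).
have goodn' k : good Om ((un \o sg) k, (Gn \o sg) k) := goodn (sg k).
have energyK' k : energy Om ((un \o sg) k, (Gn \o sg) k) <= K := energyK (sg k).
have [p [G [hp iG aeG wG]]] := limit_gradient oOm Omoo iu goodn' energyK' wc'.
have [Wu aeW] := W11loc_limit oOm iu iG wG.
split => //.
have {}aeu : {ae leb, forall (x : T) i, Om x ->
    un (sg k) x 0 i @[k --> \oo] --> u x 0 i}.
  exact: filter_forall aeu.
have {}aeG : {ae leb, forall (x : T) i j, Om x ->
    (p k).2 x i j @[k --> \oo] --> G x i j}.
  by apply: filter_forall => i; apply: filter_forall => j; exact: aeG.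
have {}aeW : {ae leb, forall (x : T) i j, Om x -> G x i j = wgrad Om u x i j}.
  by apply: filter_forall => i; apply: filter_forall => j; exact: aeW.
have ae1 : {ae leb, forall x : T, Om x -> [/\ \forall k \near \oo, ~ bad (sg k) x,
    lower_semicontinuous
      (fun q : 'rV[R]_d * 'M[R]_(d, N) => (f x q.1 q.2)%:E) &
    forall z, level_convex (f x z)]}.
  move: aebad (nf.2) lcf; apply: filterS3 => x h1 h2 h3 Ox.
  by split; [exact: h1|exact: h2|exact: h3].
have ae2 : {ae leb, forall x : T, Om x ->
    (forall i, un (sg k) x 0 i @[k --> \oo] --> u x 0 i) /\
    forall i j, (p k).2 x i j @[k --> \oo] --> wgrad Om u x i j}.
  move: aeu aeG aeW; apply: filterS3 => x h1 h2 h3 Ox.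
  by split => [i|i j]; [exact: h1|rewrite -h3//; exact: h2].
move: ae1 ae2 coef; apply: filterS3 => x h1 h2 h3 Ox.
have [bx lscx lcx] := h1 Ox; have [ux px] := h2 Ox.
apply: (sublevel_limit lscx (lcx (u x)) alpha0 gamma0 (h3 Ox) ux _ _ px
  (xin := fun k => Gn (sg k) x)).
  by apply: filterS bx => k nb; rewrite leNgt; apply/negP => ?; apply: nb.
move=> k; have [s ks hs] := hp k; exists s => // C CG Cm.
exact: (hull_convex hs CG Cm).
Qed.

End lower_semicontinuity.

(** * Limits of extended real sequences and of powers *)

Lemma limn_esup_le {R : realType} (v : nat -> \bar R) a :
  (\forall n \near \oo, (v n <= a)%E) -> (limn_esup v <= a)%E.
Proof.
move=> va; apply: le_trans (ereal_inf_lbound _) _; first by exists [set n | (v n <= a)%E].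
by apply: ge_ereal_sup => _ [n /= vn <-].
Qed.

Lemma limn_einf_ge {R : realType} (v : nat -> \bar R) a :
  (\forall n \near \oo, (a <= v n)%E) -> (a <= limn_einf v)%E.
Proof.
move=> av; rewrite /limn_einf leeNr; apply: limn_esup_le.
by apply: filterS av => n; rewrite leeN2.
Qed.

Lemma limn_einf_lt {R : realType} (v : nat -> \bar R) a n0 :
  (limn_einf v < a)%E -> exists2 n, (n0 <= n)%N & (v n < a)%E.
Proof.
move=> va; apply: contrapT => nv; move: va; rewrite ltNge => /negP; apply.
apply: limn_einf_ge; exists n0 => // n /= n0n; rewrite leNgt; apply/negP => vn.
by apply: nv; exists n.
Qed.

Lemma lte_between {R : realType} (x y : \bar R) : (0 <= x)%E -> (x < y)%E ->
  exists r : R, (x < r%:E)%E /\ (r%:E < y)%E.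
Proof.
case: x => [x| |]; case: y => [y| |]//.
  rewrite !lte_fin => _ xy; exists ((x + y) / 2); rewrite !lte_fin; lra.
by move=> _ _; exists (x + 1); rewrite ltry lte_fin ltrDl.
Qed.

(** Comparison with an integer power: [a^k <= e] for some [k], and eventually [p n >= k]. *)
Lemma cvg_powR0 {R : realType} (a : R) (p : nat -> R) : 0 < a -> a < 1 ->
  p n @[n --> \oo] --> +oo -> a `^ p n @[n --> \oo] --> 0.
Proof.
move=> a0 a1 poo; apply/cvgrPdist_le => e e0.
have : `|a| < 1 by rewrite gtr0_norm.
move/cvg_expr/cvgrPdist_le/(_ e e0) => [k _ /(_ k (leqnn k))] /=.
rewrite sub0r normrN normrX gtr0_norm// => ak.
move/cvgryPge : poo => /(_ k%:R); apply: filterS => n kn.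
rewrite sub0r normrN ger0_norm ?powR_ge0//; apply: le_trans ak.
by rewrite -powR_mulrn ?(ltW a0)//; apply: ger_powR => //; rewrite a0 ltW.
Qed.

(** * Modulars and the two inequalities *)

Section modular.
Context {R : realType} {N : nat}.
Notation X := 'rV[R]_N.
Notation T := (lebT R N).
Variable Om : set X.
Hypothesis oOm : open Om.
Hypothesis Omoo : (leb (Om : set T) < +oo)%E.
Let mOm : measurable (Om : set T) := measurable_open oOm.
Let m := fine (leb (Om : set T)).
Implicit Types (phi : X -> R -> \bar R) (g : X -> R) (l : R).

Lemma meas_fun_div g l : meas_fun Om g -> meas_fun Om (fun x => g x / l).
Proof. by move=> mg; exact: measurable_funM mg (measurable_cst _). Qed.

Lemma meas_fun_norm g : meas_fun Om g -> meas_fun Om (fun x => `|g x|).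
Proof. by move=> mg; exact: (measurableT_comp (@normr_measurable R setT) mg). Qed.

Lemma modular_infty g l : 0 < l -> meas_fun Om g ->
  modular Om phi_infty (fun x => g x / l) =
  (+oo * leb ([set x | Om x /\ (l < `|g x|)%R] : set T))%E.
Proof.
move=> l0 mg; set A : set T := [set x | _].
have mA : measurable A := measurable_superlevel oOm l (meas_fun_norm mg).
rewrite -(integral_cst leb mA) -(setIidr (_ : A `<=` Om)); last by move=> x [].
rewrite integral_mkcondr; apply: eq_integral => x /set_mem Ox.
rewrite patchE /phi_infty normrM normfV (gtr0_norm l0) ler_pdivrMr// mul1r.
case: ifPn => [gl|]; case: ifPn => //.
- by move=> /set_mem[_]; rewrite ltNge gl.
- by move=> xA; rewrite -ltNge => lg; move/negP: xA; case; rewrite inE; split.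
Qed.

(** The modular of [phi_infty] takes only the values zero and infinity, so being at most 1 means
    that the superlevel set is null. *)
Lemma ae_le_luxemburg_infty g l : 0 < l -> meas_fun Om g ->
  (modular Om phi_infty (fun x => (g x / l)%R) <= 1)%E <->
  {ae leb, forall x : T, Om x -> `|g x| <= l}.
Proof.
move=> l0 mg; rewrite modular_infty//; set A : set T := [set x | _].
have mA : measurable A := measurable_superlevel oOm l (meas_fun_norm mg).
have ANg : leb.-negligible A <-> {ae leb, forall x : T, Om x -> `|g x| <= l}.
  suff <- : ~` [set x | Om x -> `|g x| <= l] = A by [].
  apply/seteqP; split => x /=; last by move=> [Ox lg] /(_ Ox); rewrite leNgt lg.
  by move=> /not_implyP[Ox /negP]; rewrite -ltNge; split.
rewrite -ANg (negligibleP leb mA); split => [|->]; last by rewrite mule0.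
have : (0 <= leb A)%E by exact: leb_outer_ge0.
rewrite le_eqVlt => /predU1P[->//|A0].
by rewrite gt0_mulye// leye_eq.
Qed.

Variables (phi : X -> R -> \bar R) (p c L : R).
Hypothesis Phi : Phi_w Om phi.
Hypothesis c1 : 1 <= c.
Hypothesis L_ge1 : 1 <= L.
Hypothesis phi1 : {ae leb, forall x : T, Om x ->
  ((c^-1)%:E <= phi x 1%R <= c%:E)%E}.
Hypothesis incp : aInc_with Om p L phi.

Lemma modular_le g h : meas_fun Om g -> meas_fun Om h ->
  {ae leb, forall x : T, Om x -> `|g x| <= `|h x|} ->
  (modular Om phi g <= modular Om phi h)%E.
Proof.
move=> mg mh gh.
have g0 x : Om x -> (0 <= phi x `|g x|)%E by move=> Ox; apply: (Phi_w_ge0 Phi).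
have h0 x : Om x -> (0 <= phi x `|h x|)%E by move=> Ox; apply: (Phi_w_ge0 Phi).
apply: (ae_ge0_le_integral mOm g0 (Phi_w_meas Phi mg) h0 (Phi_w_meas Phi mh)).
move: gh (Phi_w_incr Phi); apply: filterS2 => x hx incx Ox.
by apply: incx => //; exact: hx.
Qed.

(** Some admissible [l'] lies below [l], and enlarging the divisor lowers the modular. *)
Lemma luxemburg_lt_modular g l : meas_fun Om g ->
  (luxemburg Om phi g < l%:E)%E -> (modular Om phi (fun x => (g x / l)%R) <= 1)%E.
Proof.
move=> mg /ereal_inf_lt[_ [l' [l'0 gl'] <-]]; rewrite lte_fin => l'l.
apply: le_trans gl'; apply: modular_le; [exact: meas_fun_div..|].
apply: aeW => x _; rewrite !normrM !normfV ler_wpM2l// lef_pV2 ?posrE ?normr_gt0 ?gt_eqF//.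
  by rewrite !gtr0_norm ?(lt_trans l'0 l'l)// ltW.
exact: lt_trans l'l.
Qed.

(** The growth condition at [t] with the factor [1/t] gives [phi x 1 <= L t^(-p) phi x t], and
    [phi x 1] is at least [1/c]. *)
Lemma powR_le_phi : {ae leb, forall x : T, Om x -> forall t, 1 <= t ->
  ((t `^ p)%:E <= (c * L)%:E * phi x t)%E}.
Proof.
move: phi1 incp; apply: filterS2 => x px ix Ox t t1.
have t0 : 0 < t by exact: lt_le_trans t1.
have /andP[cp _] := px Ox.
have := ix Ox t t^-1 (ltW t0); rewrite invr_ge0 (ltW t0) invf_le1// t1 => /(_ isT).
rewrite mulVf ?gt_eqF// => it.
have := le_trans cp it.
have pt : 0 < t `^ p by rewrite powR_gt0.
have c0 : 0 < c := lt_le_trans ltr01 c1.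
have L0 : 0 < L := lt_le_trans ltr01 L_ge1.
have -> : t^-1 `^ p = (t `^ p)^-1.
  by rewrite -[t^-1]powR_inv1 ?(ltW t0)// -powRrM mulN1r powRN.
have : (0 <= phi x t)%E by exact: (Phi_w_ge0 Phi Ox (ltW t0)).
case: (phi x t) => [s| |]//; last by move=> _ _; rewrite gt0_muley ?leey// lte_fin mulr_gt0.
rewrite -!EFinM !lee_fin => s0 h.
have : c^-1 * (c * t `^ p) <= L / t `^ p * s * (c * t `^ p).
  by rewrite ler_wpM2r// mulr_ge0 ?ltW.
have -> : c^-1 * (c * t `^ p) = t `^ p by field; rewrite ?gt_eqF.
have -> : L / t `^ p * s * (c * t `^ p) = c * L * s by field; rewrite ?gt_eqF.
by [].
Qed.

(** The growth condition at 1 with the factor [s] gives [phi x s <= L s^p phi x 1], and [phi x 1] is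
    at most [c]. *)
Lemma phi_le_powR s : 0 <= s -> s <= 1 ->
  {ae leb, forall x : T, Om x -> forall t, 0 <= t -> t <= s ->
  (phi x t <= (L * c * s `^ p)%:E)%E}.
Proof.
move=> s0 s1; have := Phi_w_incr Phi; move: phi1 incp.
apply: filterS3 => x px ix incx Ox t t0 ts.
apply: le_trans (incx Ox t s t0 ts) _.
have := ix Ox 1 s ler01; rewrite s0 s1 mulr1 => /(_ isT) /le_trans; apply.
have /andP[_ pc] := px Ox.
rewrite -mulrA [c * _]mulrC mulrA [leRHS]EFinM lee_wpmul2l// lee_fin.
by rewrite mulr_ge0 ?powR_ge0// (le_trans ler01 L_ge1).
Qed.

Lemma modular_powR_le g s : 0 <= s -> s <= 1 -> meas_fun Om g ->
  {ae leb, forall x : T, Om x -> `|g x| <= s} ->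
  (modular Om phi g <= (L * c * s `^ p * m)%:E)%E.
Proof.
move=> s0 s1 mg gs.
have mE : (m%:E = leb (Om : set T))%E.
  by rewrite /m fineK// ge0_fin_numE//; exact: leb_outer_ge0.
have C0 : 0 <= L * c * s `^ p.
  by rewrite !mulr_ge0 ?powR_ge0// ?(le_trans ler01 L_ge1) ?(le_trans ler01 c1).
rewrite EFinM mE -(integral_cst leb mOm).
have g0 x : Om x -> (0 <= phi x `|g x|)%E by move=> Ox; apply: (Phi_w_ge0 Phi).
apply: (ae_ge0_le_integral mOm g0 (Phi_w_meas Phi mg) _ (measurable_cst _)).
  by move=> x _; rewrite lee_fin.
by move: gs (phi_le_powR s0 s1); apply: filterS2 => x gx px Ox; apply: px => //; exact: gx.
Qed.

End modular.

(** * The upper bound, and the estimates drawn from a bound on the functional *)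

Section gamma_limit.
Context {R : realType} {N d : nat}.
Notation X := 'rV[R]_N.
Notation T := (lebT R N).
Variable Om : set X.
Hypothesis oOm : open Om.
Hypothesis Omoo : (leb (Om : set T) < +oo)%E.
Let mOm : measurable (Om : set T) := measurable_open oOm.
Let m := fine (leb (Om : set T)).
Variable f : X -> 'rV[R]_d -> 'M[R]_(d, N) -> R.
Hypothesis nf : normal_integrand Om f.
Variables (phi : nat -> X -> R -> \bar R) (p : nat -> R) (c L : R).
Hypothesis c1 : 1 <= c.
Hypothesis L_ge1 : 1 <= L.
Hypothesis Phi : forall n, Phi_w Om (phi n).
Hypothesis phi1 : forall n, {ae leb, forall x : T, Om x ->
  ((c^-1)%:E <= phi n x 1%R <= c%:E)%E}.
Hypothesis incp : forall n, aInc_with Om (p n) L (phi n).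
Hypothesis poo : p n @[n --> \oo] --> +oo.

Lemma meas_fun_gradient (u : X -> 'rV[R]_d) : W11loc Om u ->
  weak_gradient Om u (wgrad Om u) /\
  meas_fun Om (fun x => f x (u x) (wgrad Om u x)).
Proof.
move=> [ul [G uG]]; have uw : weak_gradient Om u (wgrad Om u).
  by apply: getPex; exists G.
split => //; exact: (measurable_integrand oOm nf (fun i => (ul i).1)
  (fun i j => (uw.1 i j).1)).
Qed.

Lemma limsup_luxemburg (g : X -> R) : meas_fun Om g ->
  (limn_esup (fun n => luxemburg Om (phi n) g) <= luxemburg Om phi_infty g)%E.
Proof.
move=> mg; apply: le_ereal_inf_tmp => _ [l [l0 gl] <-].
move/(ae_le_luxemburg_infty oOm l0 mg) : gl => gl.
apply/lee_addgt0Pr => e e0; apply: limn_esup_le.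
have le0 : 0 < l + e by rewrite addr_gt0.
(* Dividing by [l + e] instead of [l] brings the argument of the modular below [s < 1], so [l + e]
   becomes admissible for large [n]; [e] is arbitrary. *)
pose s := l / (l + e).
have s0 : 0 < s by rewrite divr_gt0.
have s1 : s < 1 by rewrite ltr_pdivrMr// mul1r ltrDl.
have gs : {ae leb, forall x : T, Om x -> `|g x / (l + e)| <= s}.
  apply: filterS gl => x gx Ox.
  by rewrite normrM normfV (gtr0_norm le0) ler_pM2r ?invr_gt0//; exact: gx.
have lim0 : L * c * s `^ p n * m @[n --> \oo] --> 0.
  rewrite -[X in _ --> X](mul0r m); apply: cvgMl.
  by rewrite -[X in _ --> X](mulr0 (L * c)); apply: cvgMr; exact: cvg_powR0.
move/cvgr0Pnorm_le : lim0 => /(_ 1 ltr01); apply: filterS => n n1.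
apply: ereal_inf_lbound; exists (l + e) => //; split => //.
apply: le_trans (modular_powR_le oOm Omoo (Phi n) c1 L_ge1 (phi1 n) (incp n)
  (ltW s0) (ltW s1) (meas_fun_div (l + e) mg) gs) _.
by rewrite lee_fin (le_trans (ler_norm _) n1).
Qed.

Lemma limsup_F (u : X -> 'rV[R]_d) :
  (limn_esup (fun n => F_ Om f (phi n) u) <= F_infty Om f u)%E.
Proof.
rewrite /F_infty /F_; case: asboolP => [Wu|_]; last by rewrite leey.
exact: (limsup_luxemburg (meas_fun_gradient Wu).2).
Qed.

Variables (alpha gamma : R).
Hypothesis lcf : {ae leb, forall x : T, Om x -> forall z, level_convex (f x z)}.
Hypothesis alpha0 : 0 < alpha.
Hypothesis gamma0 : 0 < gamma.
Hypothesis coef : {ae leb, forall x : T, Om x ->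
  forall z xi, alpha * enorm xi `^ gamma <= f x z xi}.

Section sublevel.
Variables (n : nat) (u : X -> 'rV[R]_d) (lam : R).
Hypothesis lam0 : 0 < lam.
Hypothesis iu : L1 Om u.
Hypothesis Fu : (F_ Om f (phi n) u < lam%:E)%E.
Hypothesis pn : 2 / gamma <= p n.

Let Wu : W11loc Om u.
Proof. by move: Fu; rewrite /F_; case: asboolP. Qed.
Let G := wgrad Om u.
Let g x := f x (u x) (G x).
Let mg : meas_fun Om g.
Proof. exact: (meas_fun_gradient Wu).2. Qed.
Let wG : weak_gradient Om u G.
Proof. exact: (meas_fun_gradient Wu).1. Qed.
Let q x := phi n x `|g x / lam|.
Let mq : measurable_fun (Om : set T) q.
Proof. exact: (Phi_w_meas (Phi n) (meas_fun_div lam mg)). Qed.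
Let q0 x : Om x -> (0 <= q x)%E.
Proof. by move=> Ox; exact: (Phi_w_ge0 (Phi n)). Qed.
Let q1 : (\int[leb]_(x in (Om : set T)) q x <= 1)%E.
Proof.
apply: (luxemburg_lt_modular oOm (Phi n) mg).
by move: Fu; rewrite /F_; case: asboolP.
Qed.

Let cL0 : 0 <= c * L.
Proof. by rewrite mulr_ge0 ?(le_trans ler01 c1) ?(le_trans ler01 L_ge1). Qed.

(** Chebyshev's inequality for the modular: on the superlevel set [c * L] times the integrand is at
    least [(mu/lam)^(p n)], while its integral over [Om] is at most [c * L]. *)
Lemma superlevel_small mu : lam < mu ->
  fine (leb ([set x | Om x /\ mu < f x (u x) (G x)] : set T)) <=
  c * L * (lam / mu) `^ p n.
Proof.
move=> lammu; set A : set T := [set x | _].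
have mA : measurable A := measurable_superlevel oOm mu mg.
have AOm : A `<=` Om by move=> x [].
have mu0 : 0 < mu by exact: lt_trans lammu.
pose s := mu / lam.
have s1 : 1 <= s by rewrite ler_pdivlMr// mul1r ltW.
have s0 : 0 < s by exact: lt_le_trans s1.
have sp0 : 0 < s `^ p n by rewrite powR_gt0.
have p0 : 0 <= p n by apply: le_trans pn; rewrite divr_ge0// ltW.
have h : ((s `^ p n)%:E * leb A <= (c * L)%:E)%E.
  rewrite -(integral_cst leb mA).
  apply: (@le_trans _ _ (\int[leb]_(x in A) ((c * L)%:E * q x))%E).
    have k0 x : A x -> (0 <= cst (s `^ p n)%:E x)%E by move=> _; rewrite lee_fin ltW.
    have kq x : A x -> (0 <= (c * L)%:E * q x)%E.
      by move=> /AOm Ox; rewrite mule_ge0// ?q0// lee_fin.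
    apply: (ae_ge0_le_integral mA k0 (measurable_cst _) kq).
      exact: (measurable_funS mOm AOm (measurable_funeM (c * L)%:E mq)).
    move: (powR_le_phi (Phi n) c1 L_ge1 (phi1 n) (incp n)).
    apply: filterS => x px [Ox mug].
    have st : s <= `|g x / lam|.
      rewrite normrM normfV (gtr0_norm lam0) ler_pM2r ?invr_gt0//.
      exact: ltW (lt_le_trans mug (ler_norm _)).
    apply: le_trans (px Ox `|g x / lam| (le_trans s1 st)).
    by rewrite lee_fin; apply: ge0_ler_powR => //; rewrite nnegrE// ltW.
  apply: (@le_trans _ _ (\int[leb]_(x in (Om : set T)) ((c * L)%:E * q x))%E).
    have kq x : Om x -> (0 <= (c * L)%:E * q x)%E.
      by move=> Ox; rewrite mule_ge0// ?q0// lee_fin.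
    exact: (ge0_subset_integral leb mA mOm (measurable_funeM (c * L)%:E mq) kq AOm).
  rewrite (ge0_integralZl_EFin leb mOm q0 mq cL0) -[leRHS]mule1.
  by apply: lee_wpmul2l => //; rewrite lee_fin.
have Afin : leb A \is a fin_num.
  rewrite ge0_fin_numE ?leb_outer_ge0//; apply: le_lt_trans Omoo.
  exact: le_leb_outer.
move: h; rewrite -{1}(fineK Afin) -EFinM lee_fin => h.
have -> : lam / mu = s^-1 by rewrite invf_div.
have -> : s^-1 `^ p n = (s `^ p n)^-1.
  by rewrite -[s^-1]powR_inv1 ?(ltW s0)// -powRrM mulN1r powRN.
by rewrite ler_pdivlMr// mulrC.
Qed.

Let K0 := ((lam / alpha) `^ gamma^-1) ^+ 2.

(** With [t = g/lam], coercivity bounds [|G|^2] by [K0 t^(2/gamma)]. Since [2/gamma <= p n], this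
    power of [t] is at most 1 for [t < 1] and at most [t^(p n)] otherwise, where [powR_le_phi]
    applies. *)
Lemma sqn_le_phi : {ae leb, forall x : T, Om x ->
  ((sqn (G x))%:E <= K0%:E * (1 + (c * L)%:E * q x))%E}.
Proof.
move: coef (powR_le_phi (Phi n) c1 L_ge1 (phi1 n) (incp n)).
apply: filterS2 => x cx px Ox.
have K00 : 0 <= K0 by exact: sqr_ge0.
have e0 : 0 <= enorm (G x) by exact: sqrtr_ge0.
have gx := cx Ox (u x) (G x).
have g0 : 0 <= g x by apply: le_trans gx; rewrite mulr_ge0 ?powR_ge0// ltW.
set t := `|g x / lam|.
have t0 : 0 <= t by exact: normr_ge0.
have tE : t = g x / lam by rewrite /t ger0_norm// divr_ge0// ltW.
have en : enorm (G x) <= (lam / alpha) `^ gamma^-1 * t `^ gamma^-1.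
  apply: le_trans (coercive_bound alpha0 gamma0 e0 gx) _.
  rewrite -powRM//; last by rewrite divr_ge0// ltW.
  rewrite tE (_ : g x / alpha = lam / alpha * (g x / lam))//.
  by field; rewrite !gt_eqF.
have sq : sqn (G x) <= K0 * t `^ (2 / gamma).
  rewrite -enorm_sqr; apply: le_trans (_ : _ <= ((lam / alpha) `^ gamma^-1 * t `^ gamma^-1) ^+ 2) _.
    by rewrite ler_pXn2r// nnegrE// mulr_ge0 ?powR_ge0.
  by rewrite exprMn [2 / gamma]mulrC powRrM powR_mulrn ?powR_ge0.
have t2 : ((t `^ (2 / gamma))%:E <= 1 + (c * L)%:E * q x)%E.
  have cq : (0 <= (c * L)%:E * q x)%E by rewrite mule_ge0// ?q0// lee_fin.
  have [t1|t1] := leP 1 t.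
    apply: (@le_trans _ _ (t `^ p n)%:E); first by rewrite lee_fin ler_powR.
    by apply: le_trans (px Ox t t1) _; rewrite leeDr.
  apply: (@le_trans _ _ 1%E); last by rewrite leeDl.
  have r0 : 0 <= 2 / gamma by rewrite divr_ge0// ltW.
  have := ge0_ler_powR r0; move=> /(_ t 1); rewrite !nnegrE powR1.
  by rewrite lee_fin; apply => //; exact: ltW.
apply: (@le_trans _ _ (K0 * t `^ (2 / gamma))%:E); first by rewrite lee_fin.
by rewrite EFinM; apply: lee_wpmul2l => //; rewrite lee_fin.
Qed.

(** Integrating [sqn_le_phi] gives a constant that depends on [lam] but not on [n], as [mazur]
    requires. Integrability of the entries follows from [|t| <= 1 + t^2]. *)
Lemma sublevel_good : good Om (u, G) /\ energy Om (u, G) <= K0 * (m + c * L).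
Proof.
have mGij i j : measurable_fun (Om : set T) (fun x => G x i j) := (wG.1 i j).1.
have msq : measurable_fun (Om : set T) (fun x => sqn (G x)).
  rewrite /sqn; apply: measurable_sum => i; apply: measurable_sum => j.
  exact: measurable_funX.
have K00 : 0 <= K0 by exact: sqr_ge0.
have cq x : Om x -> (0 <= (c * L)%:E * q x)%E.
  by move=> Ox; rewrite mule_ge0// ?q0// lee_fin.
have mcq := measurable_funeM (c * L)%:E mq.
have mE : (m%:E = leb (Om : set T))%E.
  by rewrite /m fineK// ge0_fin_numE//; exact: leb_outer_ge0.
have m1q : measurable_fun (Om : set T) (fun x => (1 + (c * L)%:E * q x)%E).
  exact: emeasurable_funD (measurable_cst _) mcq.
have q10 x : Om x -> (0 <= 1 + (c * L)%:E * q x)%E.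
  by move=> Ox; rewrite adde_ge0// cq.
have K1 : (\int[leb]_(x in (Om : set T)) (sqn (G x))%:E <= (K0 * (m + c * L))%:E)%E.
  apply: (@le_trans _ _ (\int[leb]_(x in (Om : set T)) (K0%:E * (1 + (c * L)%:E * q x)))%E).
    have h1 x : Om x -> (0 <= (sqn (G x))%:E)%E by move=> _; rewrite lee_fin sqn_ge0.
    have h2 x : Om x -> (0 <= K0%:E * (1 + (c * L)%:E * q x))%E.
      by move=> Ox; rewrite mule_ge0// ?q10// lee_fin.
    have msq' : measurable_fun (Om : set T) (fun x => (sqn (G x))%:E).
      exact/measurable_EFinP.
    exact: (ae_ge0_le_integral mOm h1 msq' h2 (measurable_funeM K0%:E m1q) sqn_le_phi).
  rewrite (ge0_integralZl_EFin leb mOm q10 m1q K00) [leRHS]EFinM.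
  apply: lee_wpmul2l; first by rewrite lee_fin.
  have h1 x : Om x -> (0 <= cst 1 x :> \bar R)%E by [].
  rewrite (ge0_integralD leb mOm h1 (measurable_cst _) cq mcq) EFinD.
  have -> : (\int[leb]_(x in (Om : set T)) cst 1 x = m%:E :> \bar R)%E.
    by rewrite mE -[RHS]mul1e; exact: (integral_cst leb mOm 1).
  apply: leeD2l.
  rewrite (ge0_integralZl_EFin leb mOm q0 mq cL0) -[leRHS]mule1.
  by apply: lee_wpmul2l => //; rewrite lee_fin.
have isq : intg leb (Om : set T) (fun x => sqn (G x)).
  apply/integrableP; split; first exact/measurable_EFinP.
  apply: le_lt_trans (ltry (K0 * (m + c * L))); apply: le_trans K1.
  by under eq_integral do rewrite /= ger0_norm ?sqn_ge0//.
have i1 : intg leb (Om : set T) (fun=> 1 : R).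
  by apply: (intg_bounded (C := 1)) => //= x _; rewrite normr1.
have iGij i j : intg leb (Om : set T) (fun x => G x i j).
  apply: (intg_le mOm (mGij i j) (intgD mOm i1 isq)) => x _.
  apply: le_trans (_ : _ <= 1 + G x i j ^+ 2) _; last by rewrite lerD2l sqn_entry.
  by rewrite -(real_normK (num_real (G x i j))); have := normr_ge0 (G x i j); nra.
split; last by rewrite -lee_fin /energy -(Rintegral_EFin mOm isq).
split => // i j.
by apply/(wpartE oOm j (iu i) (iGij i j)) => t tt; exact: wG.2.
Qed.

End sublevel.
End gamma_limit.

(** * The lower bound *)

Section liminf.
Context {R : realType} {N d : nat}.
Notation X := 'rV[R]_N.
Notation T := (lebT R N).
Variable Om : set X.
Hypothesis oOm : open Om.
Hypothesis Omoo : (leb (Om : set T) < +oo)%E.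
Variable f : X -> 'rV[R]_d -> 'M[R]_(d, N) -> R.
Hypothesis nf : normal_integrand Om f.
Variables (phi : nat -> X -> R -> \bar R) (p : nat -> R) (c L : R).
Hypothesis c1 : 1 <= c.
Hypothesis L_ge1 : 1 <= L.
Hypothesis Phi : forall n, Phi_w Om (phi n).
Hypothesis phi1 : forall n, {ae leb, forall x : T, Om x ->
  ((c^-1)%:E <= phi n x 1%R <= c%:E)%E}.
Hypothesis incp : forall n, aInc_with Om (p n) L (phi n).
Hypothesis poo : p n @[n --> \oo] --> +oo.
Variables (alpha gamma : R).
Hypothesis lcf : {ae leb, forall x : T, Om x -> forall z, level_convex (f x z)}.
Hypothesis alpha0 : 0 < alpha.
Hypothesis gamma0 : 0 < gamma.
Hypothesis coef : {ae leb, forall x : T, Om x ->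
  forall z xi, alpha * enorm xi `^ gamma <= f x z xi}.

(** Coercivity makes [f] nonnegative, so an upper bound on [f] bounds its modulus. *)
Lemma F_infty_le (u : X -> 'rV[R]_d) mu : 0 < mu -> W11loc Om u ->
  {ae leb, forall x : T, Om x -> f x (u x) (wgrad Om u x) <= mu} ->
  (F_infty Om f u <= mu%:E)%E.
Proof.
move=> mu0 Wu fmu; rewrite /F_infty /F_ asboolT//.
apply: ereal_inf_lbound; exists mu => //; split => //.
apply/(ae_le_luxemburg_infty oOm mu0 (meas_fun_gradient oOm nf Wu).2).
move: fmu coef; apply: filterS2 => x fx cx Ox.
rewrite ger0_norm; first exact: fx.
by apply: le_trans (cx Ox _ _); rewrite mulr_ge0 ?powR_ge0// ltW.
Qed.

Lemma liminf_F (u : X -> 'rV[R]_d) (un : nat -> X -> 'rV[R]_d) :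
  L1 Om u -> (forall n, L1 Om (un n)) -> weak_cvg_L1 Om un u ->
  (F_infty Om f u <= limn_einf (fun n => F_ Om f (phi n) (un n)))%E.
Proof.
move=> iu iun wc; rewrite leNgt; apply/negP => einf_lt.
have einf0 : (0 <= limn_einf (fun n => F_ Om f (phi n) (un n)))%E.
  apply: limn_einf_ge; apply: nearW => n; rewrite /F_; case: asboolP => // _.
  by apply: le_ereal_inf_tmp => _ [l [l0 _] <-]; rewrite lee_fin ltW.
(* The level [lam], above the lower limit, is undercut by infinitely many terms and yields the
   gradient bounds. *)
have [lam [h1 h2]] := lte_between einf0 einf_lt.
have lam0 : 0 < lam by rewrite -lte_fin; exact: le_lt_trans h1.
(* The second level leaves a gap: [lam/mu < 1], so the superlevel sets at [mu] have measure tending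
   to zero. The bound [F_infty Om f u <= mu] then contradicts the choice of [mu]. *)
have [|mu [h3 h4]] := lte_between _ h2; first by rewrite lee_fin ltW.
rewrite lte_fin in h3; have mu0 := lt_trans lam0 h3.
move: h4; apply/negP; rewrite -leNgt.
move/cvgryPge : (poo) => /(_ (2 / gamma)) [n0 _ n0P].
(* Taking indices beyond [n0] secures [2/gamma <= p (tau k)], and indices beyond [k] make [tau] tend
   to infinity. *)
have step k : exists n, (maxn k n0 <= n)%N /\ (F_ Om f (phi n) (un n) < lam%:E)%E.
  by have [n kn Fn] := limn_einf_lt (maxn k n0) h1; exists n.
have [tau tauP] := choice step.
have tau_ge k : (k <= tau k)%N.
  by have [+ _] := tauP k; apply: leq_trans; exact: leq_maxl.
have ptau k : 2 / gamma <= p (tau k).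
  by apply: n0P; have [+ _] := tauP k; apply: leq_trans; exact: leq_maxr.
have tauoo : tau k @[k --> \oo] --> \oo.
  move=> A [n _ nA]; exists n => // k /= nk; apply: nA => /=.
  exact: leq_trans (tau_ge k).
have ptauoo : p (tau k) @[k --> \oo] --> +oo by exact: (cvg_comp _ _ tauoo poo).
have wct : weak_cvg_L1 Om (un \o tau) u.
  by move=> l hl; exact: (cvg_comp _ _ tauoo (wc l hl)).
pose G k := wgrad Om (un (tau k)).
have gk k := sublevel_good oOm Omoo nf c1 L_ge1 Phi phi1 incp alpha0 gamma0 coef
  lam0 (iun (tau k)) (tauP k).2 (ptau k).
have bad0 : fine (leb ([set x | Om x /\ mu < f x (un (tau k) x) (G k x)] : set T))
    @[k --> \oo] --> 0.
  have q0 : 0 < lam / mu by rewrite divr_gt0.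
  have q1 : lam / mu < 1 by rewrite ltr_pdivrMr// mul1r.
  have : c * L * (lam / mu) `^ p (tau k) @[k --> \oo] --> 0.
    by rewrite -[X in _ --> X](mulr0 (c * L)); apply: cvgMr; exact: cvg_powR0.
  move/cvgrPdist_le => lim0; apply/cvgrPdist_le => e e0.
  move: (lim0 e e0); apply: filterS => k; rewrite !sub0r !normrN.
  move/(le_trans (ler_norm _)) => ke; rewrite ger0_norm; last first.
    by apply: fine_ge0; exact: leb_outer_ge0.
  apply: le_trans ke.
  exact: (superlevel_small oOm Omoo nf c1 L_ge1 Phi phi1 incp gamma0
    lam0 (tauP k).2 (ptau k) h3).
have [Wu fmu] := sublevel_weak_limit oOm Omoo nf lcf alpha0 gamma0 coef iu
  (fun k => (gk k).1) (fun k => (gk k).2) wct bad0.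
exact: F_infty_le.
Qed.

End liminf.

Theorem theorem4p2 (R : realType) (N d : nat) (Om : set 'rV[R]_N)
    (f : 'rV[R]_N -> 'rV[R]_d -> 'M[R]_(d, N) -> R)
    (alpha gamma c L : R)
    (phi : nat -> 'rV[R]_N -> R -> \bar R) (p : nat -> R) :
  (2 <= N)%N -> (1 <= d)%N ->
  open Om -> connected Om -> (leb Om < +oo)%E ->
  normal_integrand Om f ->
  {ae leb, forall x, Om x -> forall z, level_convex (f x z)} ->
  0 < alpha -> 0 < gamma ->
  {ae leb, forall x, Om x ->
    forall z xi, alpha * enorm xi `^ gamma <= f x z xi} ->
  1 <= c -> 1 <= L ->
  (forall n, Phi_w Om (phi n)) ->
  (forall n, 1 <= p n) ->
  (forall n, {ae leb, forall x, Om x ->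
    ((c^-1)%:E <= phi n x 1%R <= c%:E)%E}) ->
  (forall n, aInc_with Om (p n) L (phi n)) ->
  p n @[n --> \oo] --> +oo ->
  forall (u : 'rV[R]_N -> 'rV[R]_d) (un : nat -> 'rV[R]_N -> 'rV[R]_d),
    L1 Om u -> (forall n, L1 Om (un n)) -> weak_cvg_L1 Om un u ->
    (limn_esup (fun n => F_ Om f (phi n) u) <= F_infty Om f u)%E /\
    (F_infty Om f u <= limn_einf (fun n => F_ Om f (phi n) (un n)))%E.
Proof.
move=> _ _ oOm _ Omoo nf lcf alpha0 gamma0 coef c1 L_ge1 Phi _ phi1 incp poo u un.
move=> iu iun wc; split.
  exact: (limsup_F oOm Omoo nf c1 L_ge1 Phi phi1 incp poo).
exact: (liminf_F oOm Omoo nf c1 L_ge1 Phi phi1 incp poo lcf alpha0 gamma0 coef iu iun wc).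
Qed.
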